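(* Let $n\geq 3$ and $p\in(1,\infty)$. Let $\mathcal L(x,\partial_x)=a_{ij}(x)\partial_i\partial_j+b_k(x)\partial_k$ and the modulus $\omega$ be as in the context; in particular $a_{ij}=a_{ji}$, and for some $r_0\in(0,1]$ and some constant $c$, $$\sup_{|x|=r}|a_{ij}(x)-\delta_{ij}|\leq\omega(r),\qquad \sup_{|x|=r}|x|\,|b_k(x)|\leq c\,\omega(r)\qquad\text{for }0<r<r_0 .$$ For $\varepsilon>0$ sufficiently small, let $$I(r)=\frac{1}{|S^{n-1}|}\int_{r<|z|<\varepsilon}\left(\operatorname{tr}(\mathbf A_z)-n\frac{\langle\mathbf A_z z,z\rangle}{|z|^2}+\langle\mathbf B_z,z\rangle\right)\frac{dz}{|z|^n},$$ and let $Z$ be the singular solution of $\mathcal L Z=0$ in $B_\varepsilon\setminus\{0\}$ described in the context. Then: (i) If $I(0)=\lim_{r\to0}I(r)$ exists and is finite, then $-\mathcal L(x,\partial_x)Z(x)=C_0\,\delta(x)$ in $B_\varepsilon$, in the distributional sense described in the context, with $C_0=|S^{n-1}|\,e^{I(0)}$. (ii) If $I(r)\to-\infty$ as $r\to0$, then $-\mathcal L(x,\partial_x)Z(x)=C_0\,\delta(x)$ in $B_\varepsilon$ holds in the same sense with $C_0=0$; that is, $Z$ solves $-\mathcal L(x,\partial_x)Z=0$ in $B_\varepsilon$, despite its singularity at $x=0$.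
   Context: The summation convention for repeated indices is used. $B_\varepsilon=\{x\in\mathbb R^n:|x|<\varepsilon\}$ and $|S^{n-1}|$ is the surface area of the unit sphere. $U\subset\mathbb R^n$ is an open set containing the origin, $r_0\in(0,1]$ is such that $\overline{B_{r_0}}\subset U$, and only $\varepsilon<r_0$ is considered. The coefficients $a_{ij},b_k$ are measurable real-valued functions on $U$; $\mathbf A_x=(a_{ij}(x))$ is symmetric and positive definite for each $x\in U$; $\mathbf B_x$ is the vector with components $b_k(x)$; $\langle\mathbf A_zz,z\rangle=a_{ij}(z)z_iz_j$, $\langle\mathbf B_z,z\rangle=b_k(z)z_k$. Modulus $\omega$: $\omega:(0,1)\to(0,\infty)$ is nondecreasing, satisfies the square-Dini condition $\int_0^1\omega^2(r)\,\frac{dr}{r}<\infty$, and for some $\kappa\in(0,1)$ the function $\omega(r)r^{-1+\kappa}$ is nonincreasing on $(0,1)$. Put $\sigma(r)=\int_0^r\omega^2(\rho)\,\frac{d\rho}{\rho}$. $L^p$-means: with $A_r=\{x:r<|x|<2r\}$, $$M_p(w,r)=\left(\frac{1}{|A_r|}\int_{A_r}|w(x)|^p\,dx\right)^{1/p},\quad M_{1,p}(w,r)=r\,M_p(Dw,r)+M_p(w,r),$$ $$M_{2,p}(w,r)=r^2M_p(D^2w,r)+M_{1,p}(w,r).$$ For a function $\zeta$ of $r=|x|$, $M_{2,p}(\zeta,r)$ means $M_{2,p}$ of $x\mapsto\zeta(|x|)$. The singular solution $Z$: for $\varepsilon$ sufficiently small there is a strong solution $Z\in W^{2,p}_{loc}(B_\varepsilon\setminus\{0\})$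 of $\mathcal LZ=0$ in $B_\varepsilon\setminus\{0\}$ (equation satisfied a.e.) of the form $$Z(x)=\left(\int_{|x|}^{\varepsilon}s^{1-n}e^{I(s)}\,ds\right)(1+\zeta(|x|))+v(x),\qquad 0<|x|<\varepsilon,$$ with $M_{2,p}(\zeta,r)\leq c\max(\omega(r),\sigma(r))$ and $M_{2,p}(v,r)\leq c\,r^{2-n}e^{I(r)}\omega(r)$ for $0<r<\varepsilon/2$; $Z$ denotes such a solution. Distributional sense: $-\mathcal LZ=C_0\delta$ in $B_\varepsilon$ means that for every $\phi\in C^1_0(B_\varepsilon)$ ($C^1$ with compact support) $$\langle\mathcal LZ,\phi\rangle:=\int_{B_\varepsilon}\left((a_{ij}-\delta_{ij})\,\partial_i\partial_jZ\,\phi-\partial_iZ\,\partial_i\phi+b_k\,\partial_kZ\,\phi\right)dx$$ converges as an improper integral at $0$, i.e. as $\lim_{\eta\to0}\int_{\eta<|x|<\varepsilon}$, and equals $-C_0\,\phi(0)$. Here $\partial_iZ$, $\partial_i\partial_jZ$ are the weak derivatives of $Z$ in $B_\varepsilon\setminus\{0\}$. *)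

(* Defs.v *)
From HB Require Import structures.
From mathcomp Require Import all_boot all_order all_algebra.
From mathcomp Require Import all_classical all_reals all_analysis.

Set Implicit Arguments.
Unset Strict Implicit.
Unset Printing Implicit Defensive.
Import Order.TTheory GRing.Theory Num.Theory.
Import numFieldNormedType.Exports.

Local Open Scope classical_set_scope.
Local Open Scope ring_scope.

Fact rV_measure_display : measure_display. Proof. exact: default_measure_display. Qed.

Definition rV_coord (R : realType) (n : nat) (i : 'I_n) (x : 'rV[R]_n) : R := x 0 i.

(* These are the Borel sets. *)
Section rV_measurable.
Context (R : realType) (n : nat).

Let rV_set0 : g_sigma_preimage (@rV_coord R n) set0.
Proof. exact: sigma_algebra0. Qed.

Let rV_setC A :
  g_sigma_preimage (@rV_coord R n) A -> g_sigma_preimage (@rV_coord R n) (~` A).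
Proof. exact: sigma_algebraC. Qed.

Let rV_bigcup (F : (set 'rV[R]_n)^nat) :
  (forall i, g_sigma_preimage (@rV_coord R n) (F i)) ->
  g_sigma_preimage (@rV_coord R n) (\bigcup_i (F i)).
Proof. exact: sigma_algebra_bigcup. Qed.

HB.instance Definition _ := @isMeasurable.Build rV_measure_display
  'rV[R]_n (g_sigma_preimage (@rV_coord R n)) rV_set0 rV_setC rV_bigcup.

End rV_measurable.

Lemma measurable_rV_coord (R : realType) (n : nat) (i : 'I_n) :
  measurable_fun [set: 'rV[R]_n] (@rV_coord R n i).
Proof.
move=> _ Y mY; rewrite setTI; apply: sub_sigma_algebra => /=.
rewrite -bigcup_seq/=; exists i => /=; first by rewrite mem_index_enum.
by exists Y => //; rewrite setTI.
Qed.

Lemma measurable_fun_rVP d (T : measurableType d) (R : realType) (n : nat)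
    (f : T -> 'rV[R]_n) :
  (forall i, measurable_fun setT (fun x => f x 0 i)) -> measurable_fun setT f.
Proof.
move=> mf; have mG : @g_sigma_preimage _ _ _ n
    (fun i => @rV_coord R n i \o f) `<=` measurable.
  apply: smallest_sub; first exact: sigma_algebra_measurable.
  case: n f mf => [|n] f mf; first by rewrite big_ord0.
  by rewrite -bigcup_mkord_ord; apply: bigcup_sub => i Ii A [B mB <-]; exact: mf.
move=> _ A mA; apply: mG.
by rewrite g_sigma_preimage_comp; exists A.
Qed.

(* ['I_n.+1] is convertible to ['I_(1 + n)]. *)
Definition rV_cons (R : realType) (n : nat) (tx : R * 'rV[R]_n) : 'rV[R]_n.+1 :=
  row_mx (const_mx tx.1 : 'rV_1) tx.2.

Lemma measurable_rV_cons (R : realType) (n : nat) :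
  measurable_fun setT (@rV_cons R n).
Proof.
apply: measurable_fun_rVP => i.
have [j|j] := split_ordP (i : 'I_(1 + n)) => ->.
  rewrite (_ : (fun _ => _) = fst); first exact: measurable_fst.
  by apply/funext => x; apply: etrans (row_mxEl _ _ _ _) _; rewrite mxE.
rewrite (_ : (fun _ => _) = @rV_coord R n j \o snd).
  by apply: measurableT_comp; [exact: measurable_rV_coord|exact: measurable_snd].
by apply/funext => x; exact: row_mxEr.
Qed.

Definition rV_uncons (R : realType) (n : nat) (x : 'rV[R]_n.+1) : R * 'rV[R]_n :=
  (x 0 ord0, \row_j x 0 (lift ord0 j)).

Lemma rV_consK (R : realType) (n : nat) : cancel (@rV_cons R n) (@rV_uncons R n).
Proof.
move=> [t x]; rewrite /rV_uncons; congr pair.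
  rewrite (_ : @ord0 n = @lshift 1 n ord0); last exact/val_inj.
  by apply: etrans (row_mxEl _ _ _ _) _; rewrite mxE.
apply/rowP => j; rewrite mxE (_ : lift (@ord0 n) j = @rshift 1 n j); last exact/val_inj.
exact: row_mxEr.
Qed.

Lemma measurable_rV_uncons (R : realType) (n : nat) :
  measurable_fun setT (@rV_uncons R n).
Proof.
apply: measurable_fun_pair; first exact: measurable_rV_coord.
apply: measurable_fun_rVP => i.
under eq_fun do rewrite mxE.
exact: measurable_rV_coord.
Qed.

(* The library's [SigmaFiniteMeasure] instance on [m1 \x m2] is shadowed by the one
   for subprobabilities. *)
Lemma product_measure_sigma_finite d1 d2 (T1 : measurableType d1)
    (T2 : measurableType d2) (R : realType)
    (m1 : {sigma_finite_measure set T1 -> \bar R})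
    (m2 : {sigma_finite_measure set T2 -> \bar R}) :
  sigma_finite setT (m1 \x m2)%E.
Proof.
have /sigma_finiteP[F [TF ndF Foo]] := sigma_finiteT m1.
have /sigma_finiteP[G [TG ndG Goo]] := sigma_finiteT m2.
exists (fun n => F n `*` G n).
  rewrite -setXTT TF TG predeqE => -[x y]; split.
    move=> [/= [n _ Fnx] [k _ Gky]]; exists (maxn n k) => //; split.
    - by move: x Fnx; exact/subsetPset/ndF/leq_maxl.
    - by move: y Gky; exact/subsetPset/ndG/leq_maxr.
  by move=> [n _ []/= ? ?]; split; exists n.
move=> k; have [? ?] := Foo k; have [? ?] := Goo k.
split; first exact: measurableX.
by rewrite product_measure1E// lte_mul_pinfty// ge0_fin_numE.
Qed.

Section lebesgue_step.
Context (R : realType) (n : nat) (m : {sigma_finite_measure set 'rV[R]_n -> \bar R}).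

Definition lebesgue_step : set 'rV[R]_n.+1 -> \bar R :=
  pushforward (lebesgue_measure \x m)%E (@rV_cons R n).

Let step0 : (lebesgue_step set0 = 0)%E.
Proof. by rewrite /lebesgue_step /pushforward preimage_set0 measure0. Qed.

Let step_ge0 A : (0 <= lebesgue_step A)%E.
Proof. by rewrite /lebesgue_step /pushforward; exact: measure_ge0. Qed.

Let step_sigma_additive : semi_sigma_additive lebesgue_step.
Proof.
exact: (@measure_semi_sigma_additive _ _ _
  (measure_function_pushforward__canonical__measure_function_Measure
    (lebesgue_measure \x m)%E (@measurable_rV_cons R n))).
Qed.

HB.instance Definition _ := isMeasure.Build _ _ _
  lebesgue_step step0 step_ge0 step_sigma_additive.

Let step_sigma_finite : sigma_finite setT lebesgue_step.
Proof.
have [F TF Foo] : sigma_finite setT (lebesgue_measure \x m)%E.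
  exact: product_measure_sigma_finite.
exists (fun k => @rV_uncons R n @^-1` F k).
  by rewrite -preimage_bigcup -TF preimage_setT.
move=> k; have [mF Fk] := Foo k; split.
  by rewrite -[X in measurable X]setTI; exact: measurable_rV_uncons.
rewrite /lebesgue_step /pushforward -comp_preimage.
by rewrite (_ : _ \o _ = id) //; apply/funext => tx; exact: rV_consK.
Qed.

HB.instance Definition _ := Measure_isSigmaFinite.Build _ _ _
  lebesgue_step step_sigma_finite.

End lebesgue_step.

(* Lebesgue measure on the Borel sets. *)
Fixpoint borel_lebesgue (R : realType) (n : nat) :
    {sigma_finite_measure set 'rV[R]_n -> \bar R} :=
  if n is n'.+1 then lebesgue_step (borel_lebesgue R n') else \d_(0 : 'rV[R]_0).

(* Lebesgue measure on the Lebesgue measurable sets. *)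
Definition lebesgue_rV (R : realType) (n : nat) :=
  @completed_measure_extension _ _ _ (borel_lebesgue R n).

HB.instance Definition _ (R : realType) (n : nat) :=
  Measure.on (@lebesgue_rV R n).

Section Rn_integration.
Context (R : realType) (n : nat).
Implicit Types (D : set 'rV[R]_n) (f : 'rV[R]_n -> R).

Definition rV_measurable_fun D f :=
  measurable_fun (D : set (caratheodory_type (mu_ext (borel_lebesgue R n)))) f.

Definition rV_integrable D f := (@lebesgue_rV R n).-integrable D (EFin \o f).

Definition rV_integral D f : R := \int[@lebesgue_rV R n]_(x in D) f x.

End Rn_integration.

Definition dot (R : realType) (n : nat) (x y : 'rV[R]_n) : R := (x *m y^T) 0 0.

(* The library's [`|x|] on ['rV[R]_n] is the sup norm. *)
Definition enorm (R : realType) (n : nat) (x : 'rV[R]_n) : R := Num.sqrt (dot x x).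

Definition frobenius (R : realType) (n : nat) (A : 'M[R]_n) : R :=
  Num.sqrt (\sum_i \sum_j A i j ^+ 2).

Section balls.
Context (R : realType) (n : nat).

Definition eball (r : R) : set 'rV[R]_n := [set x | enorm x < r].

Definition punctured_ball (r : R) : set 'rV[R]_n := [set x | 0 < enorm x < r].

Definition annulus (r s : R) : set 'rV[R]_n := [set x | r < enorm x < s].

(* The surface measure of [E] in S^(n-1) is [n] times the volume of the cone
   {t x : x in E, 0 < t < 1}. *)
Definition sphere_area : R := n%:R * fine (@lebesgue_rV R n (eball 1)).

End balls.

Section sobolev.
Context (R : realType) (n : nat).
Implicit Types (O : set 'rV[R]_n) (u g phi : 'rV[R]_n -> R)
  (Du : 'rV[R]_n -> 'rV[R]_n) (D2u : 'rV[R]_n -> 'M[R]_n) (i j : 'I_n) (p : R).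

Definition pderiv i phi (x : 'rV[R]_n) : R := 'D_(delta_mx 0 i : 'rV[R]_n) phi x.

(* C^1_0(O): a function on the whole space whose support is a compact subset of O. *)
Definition C1_compact O phi := [/\ forall x, differentiable phi x,
  forall i, continuous (pderiv i phi),
  compact (closure [set x | phi x != 0]) &
  closure [set x | phi x != 0] `<=` O].

(* The test functions are C^1_0, as in Gilbarg and Trudinger. *)
Definition weak_pderiv O i u g := forall phi, C1_compact O phi ->
  rV_integral O (fun x => u x * pderiv i phi x) =
  - rV_integral O (fun x => g x * phi x).

Definition Lp_loc p O u := rV_measurable_fun O u /\
  forall K, compact K -> K `<=` O ->
    (\int[@lebesgue_rV R n]_(x in K) (`|u x| `^ p)%:E < +oo)%E.

Definition W2p_loc p O u Du D2u :=
  [/\ Lp_loc p O u,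
      forall i, Lp_loc p O (fun x => Du x 0 i),
      forall i j, Lp_loc p O (fun x => D2u x i j),
      forall i, weak_pderiv O i u (fun x => Du x 0 i) &
      forall i j, weak_pderiv O i (fun x => Du x 0 j) (fun x => D2u x i j)].

Definition Mp p u (r : R) : \bar R :=
  poweR ((fine (@lebesgue_rV R n (annulus r (2 * r))))^-1%:E *
         \int[@lebesgue_rV R n]_(x in annulus r (2 * r)) (`|u x| `^ p)%:E)%E p^-1.

Definition M1p p u Du (r : R) : \bar R :=
  (r%:E * Mp p (fun x => enorm (Du x)) r + Mp p u r)%E.

Definition M2p p u Du D2u (r : R) : \bar R :=
  ((r ^+ 2)%:E * Mp p (fun x => frobenius (D2u x)) r + M1p p u Du r)%E.

End sobolev.

Definition modulus (R : realType) (omega : R -> R) :=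
  [/\ forall r, 0 < r < 1 -> 0 < omega r,
      forall r s, 0 < r -> r <= s -> s < 1 -> omega r <= omega s,
      (\int[@lebesgue_measure R]_(r in `]0%R, 1%R[) (omega r ^+ 2 / r)%:E < +oo)%E &
      exists2 kappa : R, 0 < kappa < 1 &
        forall r s, 0 < r -> r <= s -> s < 1 ->
          omega s * s `^ (kappa - 1) <= omega r * r `^ (kappa - 1)].

Definition sigma_mod (R : realType) (omega : R -> R) (r : R) : R :=
  \int[@lebesgue_measure R]_(rho in `]0, r[) (omega rho ^+ 2 / rho).

Section operator.
Context (R : realType) (n : nat).
Variables (a : 'rV[R]_n -> 'M[R]_n) (b : 'rV[R]_n -> 'rV[R]_n).
Implicit Types (eps r p : R) (Z phi : 'rV[R]_n -> R)
  (DZ : 'rV[R]_n -> 'rV[R]_n) (D2Z : 'rV[R]_n -> 'M[R]_n).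

Definition L_op DZ D2Z (x : 'rV[R]_n) : R :=
  \sum_i \sum_j a x i j * D2Z x i j + \sum_k b x 0 k * DZ x 0 k.

Definition I_fun eps r : R :=
  (sphere_area R n)^-1 * rV_integral (annulus r eps) (fun z =>
    (\tr (a z) - n%:R * (dot (z *m a z) z / enorm z ^+ 2) + dot (b z) z)
    / enorm z ^+ n).

Definition h_fun eps r : R :=
  \int[@lebesgue_measure R]_(s in `]r, eps[) (s ^- n.-1 * expR (I_fun eps s)).

Definition strong_solution p eps Z DZ D2Z :=
  W2p_loc p (@punctured_ball R n eps) Z DZ D2Z /\
  {ae @lebesgue_rV R n, forall x, punctured_ball eps x -> L_op DZ D2Z x = 0}.

Definition singular_solution p (omega : R -> R) eps Z DZ D2Z :=
  strong_solution p eps Z DZ D2Z /\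
  exists (c : R) (zeta : R -> R) Dzeta D2zeta v Dv D2v,
    [/\ W2p_loc p (punctured_ball eps) (zeta \o @enorm R n) Dzeta D2zeta,
        W2p_loc p (punctured_ball eps) v Dv D2v,
        forall x, punctured_ball eps x ->
          Z x = h_fun eps (enorm x) * (1 + zeta (enorm x)) + v x,
        forall r, 0 < r < eps / 2 ->
          (M2p p (zeta \o @enorm R n) Dzeta D2zeta r <=
           (c * Num.max (omega r) (sigma_mod omega r))%:E)%E &
        forall r, 0 < r < eps / 2 ->
          (M2p p v Dv D2v r <=
           (c * (r ^- (n - 2) * expR (I_fun eps r) * omega r))%:E)%E].

Definition pairing_integrand DZ D2Z phi (x : 'rV[R]_n) : R :=
  \sum_i \sum_j (a x i j - (i == j)%:R) * D2Z x i j * phi x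
  - \sum_i DZ x 0 i * pderiv i phi x
  + \sum_k b x 0 k * DZ x 0 k * phi x.

(* - L Z = C0 delta in the ball of radius eps: the pairing exists as an improper
   integral at 0, every truncation being an absolutely convergent integral. *)
Definition minus_L_eq_delta eps DZ D2Z (C0 : R) :=
  forall phi, C1_compact (@eball R n eps) phi ->
    (forall eta, 0 < eta < eps ->
       rV_integrable (annulus eta eps) (pairing_integrand DZ D2Z phi)) /\
    rV_integral (annulus eta eps) (pairing_integrand DZ D2Z phi)
      @[eta --> 0^'+] --> - (C0 * phi 0).

End operator.

(* Main.v *)
(* Write G for the integrand of the pairing, h(r) for the integral of s^(1-n) e^(I(s))
   over ]r, eps[, and kap = eta^-n e^(I(eta)). For a cutoff chi vanishing in |x| <= eta
   and equal to 1 outside a shell of width d, two weak integrations by parts give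
     int chi G = - sum_i int Z P_i,   P_i = d_i (phi d_i chi),
   so only Z near |x| = eta matters. Put H(x) = h(eta) - kap (|x|^2 - eta^2) / 2 and split
     Z = H + (zeta H + v) + (h - H) (1 + zeta).
   - The divergence theorem turns - sum_i int H P_i into - kap int (1 - chi) div (phi x),
     which tends to - kap int_(|x| <= eta) div (phi x) as d -> 0; as eta -> 0, this is
     - (|S^(n-1)| phi(0) + o(1)) e^(I(eta)).
   - Since h(|x|) - H(x) = O((|x| - eta)^2) and P_i = O(d^-2) on the shell, the last term
     contributes 0 as d -> 0, by dominated convergence.
   - For the middle term integrate by parts back, so that only chi itself appears; the
     bounds on the L^p means at radius eta then give o(1) e^(I(eta)), because omega and
     sigma tend to 0 and h(eta) <= 4 eta^(2-n) e^(I(eta)).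
   Hence the pairing over eta < |x| < eps is - (|S^(n-1)| phi(0) + o(1)) e^(I(eta)), which
   settles both cases. *)

Require Import Defs.
From HB Require Import structures.
From mathcomp Require Import all_boot all_order all_algebra.
From mathcomp Require Import all_classical all_reals all_analysis.
From mathcomp Require Import measurable_realfun.
From mathcomp Require Import ring lra.

Set Implicit Arguments.
Unset Strict Implicit.
Unset Printing Implicit Defensive.
Import Order.TTheory GRing.Theory Num.Theory.
Import numFieldNormedType.Exports.

Local Open Scope classical_set_scope.
Local Open Scope ring_scope.

(** * Lebesgue measure of balls *)

(* The type whose measurable sets are the Lebesgue measurable sets. *)
Notation rVT R n := (caratheodory_type (mu_ext (borel_lebesgue R n))).

(** [Z] is only W^{2,p}, so nothing is integrated by parts up to the sphere |x| = eta: no traces,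
    surface measure or polar coordinates occur. The boundary term appears as the volume integral of
    div (phi x) over a ball, and |S^(n-1)| is n times the volume of the unit ball. The limit d -> 0
    is taken at fixed eta, so its constants may depend on eta; only the bound on the middle term has
    to be uniform. The obstacle is the regularity of h: I is only shown to be Lipschitz in r, so h
    is expanded at eta up to a quadratic error and replaced there by H, the polynomial in |x|^2 with
    the same value and slope (h'(eta) = - eta kap). H is smooth at the origin too, and on the scale
    eta its derivatives of order 0, 1, 2 have size eta^2 kap, eta kap, kap, which is the scaling of
    the bound on v. The bound |I(r) - I(s)| <= K (s^n - r^n) / r^n serves twice: it gives the error
    of h - H, and for small K it keeps e^I from growing by more than 4/3 over a dyadic shell, whence
    the factor 4 in the bound on h(eta). K is a dimensional constant times a bound W for |a_ij -
    delta_ij| and |x| |b_k|, and making W small is what limits eps. *)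

Section lebesgue_rV_basics.
Context (R : realType) (n : nat).
Implicit Types (A D : set 'rV[R]_n) (f : 'rV[R]_n -> R).
Local Notation mu := (@lebesgue_rV R n).

Lemma caratheodory_borel A : measurable A -> measurable (A : set (rVT R n)).
Proof. exact: caratheodory_measurable_mu_ext. Qed.

Lemma lebesgue_rV_borel A : measurable A -> mu A = borel_lebesgue R n A.
Proof. exact: measurable_mu_extE. Qed.

Lemma le_lebesgue_rV A D : A `<=` D -> (mu A <= mu D)%E.
Proof. exact: le_mu_ext. Qed.

Lemma measurable_fun_borel f : measurable_fun [set: 'rV[R]_n] f ->
  measurable_fun [set: rVT R n] f.
Proof.
move=> mf _ Y mY; rewrite setTI; apply: caratheodory_borel.
by rewrite -[X in measurable X]setTI; exact: mf.
Qed.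

Lemma measurable_affine_rV (s : R) (v : 'rV[R]_n) :
  measurable_fun [set: 'rV[R]_n] (fun x => s *: x + v).
Proof.
apply: measurable_fun_rVP => i.
under eq_fun do rewrite !mxE.
apply: measurable_funD => //; apply: measurable_funM => //.
exact: measurable_rV_coord.
Qed.

End lebesgue_rV_basics.

Lemma lebesgue_measure_affine (R : realType) (s v : R) (A : set R) : 0 < s ->
  measurable A ->
  lebesgue_measure [set x | A (s * x + v)] = (s^-1%:E * lebesgue_measure A)%E.
Proof.
move=> s0 mA.
have mf : measurable_fun [set: measurableTypeR R] (fun x : R => s * x + v : measurableTypeR R).
  by apply: measurable_funD => //; exact: measurable_funM.
pose m1 := pushforward (@lebesgue_measure R) (fun x => s * x + v : measurableTypeR R).
pose m1' : {measure set (measurableTypeR R) -> \bar R} :=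
  measure_function_pushforward__canonical__measure_function_Measure
    (@lebesgue_measure R) mf.
pose m2 : {measure set (measurableTypeR R) -> \bar R} := mscale (NngNum (ltW s0)) m1'.
(* Uniqueness of Lebesgue measure: [m2], which is [s] times the pushforward, agrees with it on
   half-open intervals. *)
have -> : lebesgue_measure A = m2 A.
  apply: lebesgue_measure_unique => // X /ocitvP[->|[[a b]]/= ab ->].
    by rewrite !measure0.
  rewrite /m2 /mscale/= /pushforward lebesgue_measure_itv/= lte_fin ab.
  rewrite (_ : _ @^-1` _ = `](a - v) / s, (b - v) / s]%classic); last first.
    apply/seteqP; split => x /=; rewrite !in_itv/=.
      by move=> /andP[? ?]; rewrite ltr_pdivrMr// ler_pdivlMr// mulrC ltrBlDr lerBrDr; apply/andP.
    by rewrite ltr_pdivrMr// ler_pdivlMr// mulrC ltrBlDr lerBrDr.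
  rewrite lebesgue_measure_itv/= lte_fin ltr_pM2r ?invr_gt0// ltrD2r ab.
  rewrite -!EFinD -EFinM; congr EFin; field; exact: lt0r_neq0.
by rewrite /m2 /mscale/= muleA -EFinM mulVf ?lt0r_neq0// mul1e.
Qed.

Lemma rV_cons0 (R : realType) n (tx : R * 'rV[R]_n) : rV_cons tx 0 ord0 = tx.1.
Proof. by have /(congr1 fst) := rV_consK tx. Qed.

Lemma rV_cons_lift (R : realType) n (tx : R * 'rV[R]_n) j :
  rV_cons tx 0 (lift ord0 j) = tx.2 0 j.
Proof. by have /(congr1 snd)/rowP/(_ j) := rV_consK tx; rewrite mxE. Qed.

(** Induction on the dimension, each step by uniqueness of the product measure. The case [v = 0]
    scales balls, the case [s = 1] is translation invariance. *)
Lemma borel_lebesgue_affine (R : realType) n (s : R) (v : 'rV[R]_n)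
    (A : set 'rV[R]_n) : 0 < s -> measurable A ->
  borel_lebesgue R n [set x | A (s *: x + v)] =
    ((s ^- n)%:E * borel_lebesgue R n A)%E.
Proof.
move=> s0; elim: n v A => [|n IH] v A mA.
  rewrite expr0 invr1 mul1e.
  by congr (borel_lebesgue R 0 _); apply/funext => x; congr (A _); apply/rowP => -[].
pose T := (fun x : measurableTypeR R => s * x + v 0 0 : measurableTypeR R).
pose v' := \row_j v 0 (lift ord0 j).
pose aff (tx : measurableTypeR R * 'rV[R]_n) : measurableTypeR R * 'rV[R]_n :=
  (s * tx.1 + v 0 0, s *: tx.2 + v').
have maff : measurable_fun setT aff.
  apply: measurable_fun_pair => /=.
    by apply: measurable_funD => //; apply: measurable_funM => //; exact: measurable_fst.
  by apply: (measurableT_comp (measurable_affine_rV s v')); exact: measurable_snd.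
pose m1 : {measure set (measurableTypeR R * 'rV[R]_n) -> \bar R} :=
  measure_function_pushforward__canonical__measure_function_Measure
    (@lebesgue_measure R \x borel_lebesgue R n)%E maff.
pose m2 : {measure set (measurableTypeR R * 'rV[R]_n) -> \bar R} :=
  mscale (NngNum (exprn_ge0 n.+1 (ltW s0))) m1.
have m2E X : m2 X = ((s ^+ n.+1)%:E *
    (@lebesgue_measure R \x borel_lebesgue R n)%E (aff @^-1` X))%E by [].
have mpre : measurable (@rV_cons R n @^-1` A).
  by rewrite -[X in measurable X]setTI; exact: measurable_rV_cons.
have -> : borel_lebesgue R n.+1 A = m2 (@rV_cons R n @^-1` A).
  apply: product_measure_unique => // B C mB mC.
  rewrite m2E (_ : aff @^-1` _ = [set x | B (s * x + v 0 0)] `*`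
      [set x | C (s *: x + v')]); last first.
    by apply/seteqP; split.
  rewrite product_measure1E//=; last 2 first.
  - rewrite -[X in measurable X]setTI.
    suff : measurable_fun setT T by apply.
    by apply: measurable_funD => //; exact: measurable_funM.
  - rewrite -[X in measurable X]setTI.
    exact: measurable_affine_rV.
  rewrite IH//.
  have /= -> := @lebesgue_measure_affine R s (v 0 0) B s0 mB.
  rewrite -/(borel_lebesgue R n C) muleACA -EFinM (muleA (s ^+ n.+1)%:E) -EFinM.
  by rewrite -invfM -exprS mulfV ?mul1e// expf_neq0 ?lt0r_neq0.
rewrite m2E muleA -EFinM mulVf ?expf_neq0 ?lt0r_neq0// mul1e.
rewrite /lebesgue_step /pushforward/=; congr product_measure1.
apply/funext => -[t x] /=; congr (A _).
apply/rowP => i; rewrite [LHS]mxE [X in X + _]mxE.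
have [j ->|->] := unliftP ord0 i; last by rewrite !rV_cons0.
by rewrite !rV_cons_lift/= !mxE.
Qed.

(** * The Euclidean norm and the volumes of balls and annuli *)

Section enorm_theory.
Context (R : realType) (n : nat).
Implicit Types (x y : 'rV[R]_n).

Lemma dotE x y : dot x y = \sum_i x 0 i * y 0 i.
Proof. by rewrite /dot mxE; apply: eq_bigr => i _; rewrite mxE. Qed.

Lemma dot_ge0 x : 0 <= dot x x.
Proof. by rewrite dotE sumr_ge0// => i _; rewrite -expr2 sqr_ge0. Qed.

Lemma enorm_ge0 x : 0 <= enorm x.
Proof. exact: sqrtr_ge0. Qed.

Lemma sqr_enorm x : enorm x ^+ 2 = dot x x.
Proof. by rewrite sqr_sqrtr// dot_ge0. Qed.

Lemma enorm_coord x i : `|x 0 i| <= enorm x.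
Proof.
rewrite -sqrtr_sqr ler_sqrt ?dot_ge0// dotE (bigD1 i)//= -expr2 lerDl.
by rewrite sumr_ge0// => j _; rewrite -expr2 sqr_ge0.
Qed.

Lemma enormZ (s : R) x : enorm (s *: x) = `|s| * enorm x.
Proof.
rewrite /enorm -sqrtr_sqr -sqrtrM ?sqr_ge0//; congr Num.sqrt.
rewrite !dotE mulr_sumr; apply: eq_bigr => i _; rewrite !mxE; ring.
Qed.

Lemma measurable_dot d (T : measurableType d) (f : T -> 'rV[R]_n) (D : set T) :
  (forall i, measurable_fun D (fun t => f t 0 i)) ->
  measurable_fun D (fun t => dot (f t) (f t)).
Proof.
move=> mf; under eq_fun do rewrite dotE.
by apply: measurable_sum => i; apply: measurable_funM.
Qed.

Lemma measurable_enorm : measurable_fun [set: 'rV[R]_n] (@enorm R n).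
Proof.
have mdot : measurable_fun [set: 'rV[R]_n] (fun x : 'rV[R]_n => dot x x).
  exact: (@measurable_dot _ 'rV[R]_n idfun setT (@measurable_rV_coord R n)).
have msqrt : measurable_fun setT (@Num.sqrt R).
  by apply: continuous_measurable_fun; exact: sqrt_continuous.
exact: (measurableT_comp msqrt mdot).
Qed.

End enorm_theory.

Section eball_measure.
Context (R : realType) (n : nat).
Local Notation mu := (@lebesgue_rV R n).

Definition cball (r : R) : set 'rV[R]_n := [set x | enorm x <= r].

Lemma measurable_eball r : measurable (@eball R n r).
Proof.
rewrite (_ : eball r = @enorm R n @^-1` `]-oo, r[).
  by rewrite -[X in measurable X]setTI; exact: measurable_enorm.
by apply/seteqP; split => x /=; rewrite in_itv.
Qed.

Lemma measurable_cball r : measurable (cball r).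
Proof.
rewrite (_ : cball r = @enorm R n @^-1` `]-oo, r]).
  by rewrite -[X in measurable X]setTI; exact: measurable_enorm.
by apply/seteqP; split => x /=; rewrite in_itv.
Qed.

Lemma annulusE (r s : R) : annulus r s = @eball R n s `\` cball r.
Proof.
apply/seteqP; split => x /=; rewrite /annulus /eball /cball/=.
  by move=> /andP[rx ->]; split => //; apply/negP; rewrite -ltNge.
by move=> [-> /negP]; rewrite -ltNge => ->.
Qed.

Lemma measurable_annulus r s : measurable (@annulus R n r s).
Proof.
by rewrite annulusE; apply: measurableD; [exact: measurable_eball|exact: measurable_cball].
Qed.

Lemma lebesgue_rV_eball r : 0 < r ->
  mu (eball r) = ((r ^+ n)%:E * mu (eball 1))%E.
Proof.
move=> r0; rewrite !lebesgue_rV_borel; [|exact: measurable_eball..].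
have := @borel_lebesgue_affine R n r^-1 0 (eball 1).
rewrite invr_gt0 -exprVn invrK => /(_ r0 (measurable_eball _)) <-.
congr (borel_lebesgue R n _); apply/seteqP; split => x;
  by rewrite /eball/= addr0 enormZ gtr0_norm ?invr_gt0// mulrC ltr_pdivrMr// mul1r.
Qed.

Lemma lebesgue_rV_cball_scale r : 0 < r ->
  mu (cball r) = ((r ^+ n)%:E * mu (cball 1))%E.
Proof.
move=> r0; rewrite !lebesgue_rV_borel; [|exact: measurable_cball..].
have := @borel_lebesgue_affine R n r^-1 0 (cball 1).
rewrite invr_gt0 -exprVn invrK => /(_ r0 (measurable_cball _)) <-.
congr (borel_lebesgue R n _); apply/seteqP; split => x;
  by rewrite /cball/= addr0 enormZ gtr0_norm ?invr_gt0// mulrC ler_pdivrMr// mul1r.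
Qed.

End eball_measure.

Lemma measurable_box (R : realType) n :
  measurable [set x : 'rV[R]_n | forall i, `|x 0 i| <= 1].
Proof.
rewrite (_ : [set _ | _] =
    \bigcap_(i in [set: 'I_n]) (Num.norm \o @rV_coord R n i) @^-1` `]-oo, 1]).
  apply: fin_bigcap_measurable; first exact: finite_finset.
  move=> i _; rewrite -[X in measurable X]setTI.
  suff: measurable_fun setT (Num.norm \o @rV_coord R n i) by apply.
  by apply: measurableT_comp => //; exact: measurable_rV_coord.
apply/seteqP; split => x /= H i; first by rewrite /= in_itv/= H.
by have := H i I; rewrite /= in_itv.
Qed.

(** The unit ball lies in this cube, which is a product under [rV_cons]; this is how balls are seen
    to have finite volume. *)
Lemma borel_lebesgue_box (R : realType) n :
  (borel_lebesgue R n [set x | forall i, (`|x 0 i| <= 1)%R] < +oo)%E.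
Proof.
elim: n => [|n IH].
  by rewrite /= diracE ltry.
rewrite /= /lebesgue_step /pushforward.
rewrite (_ : _ @^-1` _ = `[-1, 1] `*` [set x : 'rV[R]_n | forall i, `|x 0 i| <= 1]).
  rewrite product_measure1E//=; last exact: measurable_box.
  rewrite lebesgue_measure_itv/= lte_fin.
  case: ifP => _; last by rewrite mul0e ltry.
  by rewrite -EFinB lte_mul_pinfty// ?lee_fin; lra.
apply/seteqP; split => -[t x] /=.
  move=> H; split.
    by have := H ord0; rewrite rV_cons0/= ler_norml in_itv.
  by move=> i; have := H (lift ord0 i); rewrite rV_cons_lift.
rewrite in_itv/= -ler_norml => -[t1 H] i.
by have [j ->|->] := unliftP ord0 i; rewrite ?rV_cons0 ?rV_cons_lift.
Qed.

Section eball_volume.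
Context (R : realType) (n : nat).
Local Notation mu := (@lebesgue_rV R n).

Lemma lebesgue_rV_cball_lty r : (mu (cball r) < +oo)%E.
Proof.
have cball1 : (mu (@cball R n 1) < +oo)%E.
  apply: le_lt_trans (borel_lebesgue_box R n).
  rewrite -lebesgue_rV_borel; last exact: measurable_box.
  apply: le_lebesgue_rV; by move=> x /= x1 i; exact: le_trans (enorm_coord _ _) x1.
have [r0|r0] := leP r 0.
  apply: le_lt_trans cball1; apply: le_lebesgue_rV; by move=> x; rewrite /cball/= => xr; lra.
by rewrite lebesgue_rV_cball_scale// lte_mul_pinfty// lee_fin exprn_ge0// ltW.
Qed.

Lemma lebesgue_rV_eball_lty r : (mu (eball r) < +oo)%E.
Proof.
apply: le_lt_trans (lebesgue_rV_cball_lty r); apply: le_lebesgue_rV; by move=> x /ltW.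
Qed.

Definition ball_volume : R := fine (mu (eball 1)).

Lemma ball_volume_ge0 : 0 <= ball_volume.
Proof. by rewrite fine_ge0. Qed.

Lemma ball_volumeE r : 0 < r -> mu (eball r) = (r ^+ n * ball_volume)%:E.
Proof.
move=> r0; rewrite lebesgue_rV_eball// EFinM fineK// ge0_fin_numE//.
exact: lebesgue_rV_eball_lty.
Qed.

(** The closed ball is squeezed between the open balls of radius [r] and of radius [s], as [s]
    decreases to [r]. Thus spheres are null without any surface measure. *)
Lemma cball_volumeE r : 0 < r -> mu (cball r) = (r ^+ n * ball_volume)%:E.
Proof.
move=> r0; apply/eqP; rewrite eq_le; apply/andP; split; last first.
  rewrite -ball_volumeE//; apply: le_lebesgue_rV; by move=> x /ltW.
have fin : mu (cball r) \is a fin_num.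
  by rewrite ge0_fin_numE// lebesgue_rV_cball_lty.
rewrite -(fineK fin) lee_fin.
have cvg_s : s ^+ n * ball_volume @[s --> r^'+] --> r ^+ n * ball_volume.
  by apply: cvgM; [apply: cvg_at_right_filter; exact: exprn_continuous|exact: cvg_cst].
rewrite -(cvg_lim _ cvg_s)//; apply: limr_ge; first by apply/cvg_ex; eexists; exact: cvg_s.
near=> s.
have s0 : r < s by near: s; exact: nbhs_right_gt.
rewrite -lee_fin fineK// -ball_volumeE; last exact: lt_trans s0.
apply: le_lebesgue_rV; by move=> x /= xr; exact: le_lt_trans xr s0.
Unshelve. all: by end_near. Qed.

Lemma annulus_volumeE r s : 0 < r -> r <= s ->
  mu (annulus r s) = ((s ^+ n - r ^+ n) * ball_volume)%:E.
Proof.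
move=> r0; rewrite le_eqVlt => /predU1P[<-|rs].
  rewrite subrr mul0r (_ : annulus _ _ = set0) ?measure0//.
  by apply/seteqP; split => x //=; rewrite /annulus/= => /andP[a1 a2]; lra.
rewrite annulusE measureD; last 3 first.
- exact: (@caratheodory_borel R n _ (measurable_eball _)).
- exact: (@caratheodory_borel R n _ (measurable_cball _)).
- exact: lebesgue_rV_eball_lty.
rewrite (_ : _ `&` _ = cball r).
  rewrite [X in (X - _)%E]ball_volumeE ?(lt_trans r0)// [X in (_ - X)%E]cball_volumeE//.
  by rewrite -EFinB mulrBl.
by apply/seteqP; split => x; [case|move=> xr; split => //; exact: le_lt_trans xr rs].
Qed.

Lemma annulus_lty r s : (mu (annulus r s) < +oo)%E.
Proof.
apply: le_lt_trans (lebesgue_rV_eball_lty s); apply: le_lebesgue_rV.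
by rewrite annulusE; exact: subDsetl.
Qed.

Lemma sphere_areaE : sphere_area R n = n%:R * ball_volume.
Proof. by []. Qed.

End eball_volume.

(** * Borel sets, continuity and compactness *)

Section rV_topology.
Context (R : realType) (n : nat).
Local Notation mu := (@lebesgue_rV R n).

(** An open set is a countable union of cubes with rational centre and radius, so the sigma-algebra
    generated by the coordinates contains the open sets. *)
Lemma open_measurable_rV (A : set 'rV[R]_n) : open A -> measurable A.
Proof.
move=> oA.
pose B (cq : 'rV[rat]_n * rat) : set 'rV[R]_n :=
  [set x | forall i, `|x 0 i - ratr (cq.1 0 i)| < ratr cq.2].
rewrite (_ : A = \bigcup_(cq in [set cq | B cq `<=` A]) B cq); last first.
  apply/seteqP; split => [x Ax|x [cq /= +]]; last exact.
  have /nbhs_ballP[e /= e0 xeA] : nbhs x A by exact: open_nbhs_nbhs.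
  have [q] := @rat_in_itvoo R 0 (e / 2) ltac:(lra).
  rewrite in_itv/= => /andP[q0 qe].
  have cP i : exists c : rat, `|x 0 i - ratr c| < ratr q.
    have [c] := @rat_in_itvoo R (x 0 i - ratr q) (x 0 i + ratr q) ltac:(lra).
    by rewrite in_itv/= => /andP[? ?]; exists c; rewrite ltr_norml; lra.
  have [c cE] := choice cP.
  exists (\row_i c i, q); last by move=> i; rewrite mxE; exact: cE.
  move=> y /= Hy; apply: xeA; split => // j i; rewrite (ord1 j) /ball/=.
  have := Hy i; have := cE i; rewrite mxE => H1 H2.
  rewrite (_ : x 0 i - y 0 i = (x 0 i - ratr (c i)) - (y 0 i - ratr (c i))); last by ring.
  by apply: le_lt_trans (ler_normB _ _) _; lra.
rewrite bigcup_mkcond; apply: countable_bigcupT_measurable; first exact: countableP.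
move=> cq.
case: ifPn => // _.
rewrite (_ : B cq = \bigcap_(i in [set: 'I_n])
    (fun x : 'rV[R]_n => `|rV_coord i x - ratr (cq.1 0 i)|) @^-1` `]-oo, ratr cq.2[).
  apply: fin_bigcap_measurable; first exact: finite_finset.
  move=> i _; rewrite -[X in measurable X]setTI.
  suff: measurable_fun setT (fun x : 'rV[R]_n => `|rV_coord i x - ratr (cq.1 0 i)|) by apply.
  apply: measurableT_comp => //; apply: measurable_funB => //.
  exact: measurable_rV_coord.
apply/seteqP; split => x /= H i; first by rewrite /= in_itv/= H.
by have := H i I; rewrite /= in_itv.
Qed.

Lemma closed_measurable_rV (A : set 'rV[R]_n) : closed A -> measurable A.
Proof.
move=> cA; rewrite -(setCK A); apply: measurableC.
by apply: open_measurable_rV; exact: closed_openC.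
Qed.

Lemma continuous_measurable_rV (f : 'rV[R]_n -> R) :
  continuous f -> measurable_fun [set: 'rV[R]_n] f.
Proof.
move=> /continuousP cf; apply: (measurability _ (RGenOpens.measurableE R)).
move=> _ [_ [a [b ->] <-]]; rewrite setTI.
by apply: open_measurable_rV; apply: cf; exact: interval_open.
Qed.

Lemma continuous_measurable_cara (f : 'rV[R]_n -> R) (D : set (rVT R n)) :
  continuous f -> measurable_fun D f.
Proof.
move=> cf; apply: measurable_funTS.
by apply: measurable_fun_borel; exact: continuous_measurable_rV.
Qed.

Lemma continuous_rV_coord i : continuous (@rV_coord R n i).
Proof. exact: coord_continuous. Qed.

Lemma continuous_sumr (T : topologicalType) m (f : 'I_m -> T -> R) :
  (forall i, continuous (f i)) -> continuous (fun x => \sum_i f i x).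
Proof.
by move=> cf x; apply: cvg_big => [|i _]; [exact: add_continuous|exact: cf].
Qed.

Lemma continuous_dot : continuous (fun x : 'rV[R]_n => dot x x).
Proof.
under eq_fun do rewrite dotE.
apply: (@continuous_sumr 'rV[R]_n n (fun i x => x 0 i * x 0 i)) => i x.
exact: (continuousM (@continuous_rV_coord i x) (@continuous_rV_coord i x)).
Qed.

Lemma continuous_enorm : continuous (@enorm R n).
Proof.
move=> x; exact: (continuous_comp (@continuous_dot x) (@sqrt_continuous R (dot x x))).
Qed.

Lemma closed_cball r : closed (@cball R n r).
Proof.
rewrite (_ : cball r = @enorm R n @^-1` `]-oo, r]).
  by apply: closed_comp => [x _|]; [exact: continuous_enorm|exact: interval_closed].
by apply/seteqP; split => x /=; rewrite in_itv.
Qed.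

Lemma compact_cball r : compact (@cball R n r).
Proof.
apply: bounded_closed_compact; last exact: closed_cball.
exists `|r|; split => // M rM x xr.
rewrite /Num.norm/= mx_normrE; apply/bigmax_leP; split.
  by apply: le_trans (ltW rM); exact: normr_ge0.
move=> [i j] _ /=; rewrite (ord1 i) (le_trans (enorm_coord _ _))//.
by rewrite (le_trans xr)// (le_trans (ler_norm _))// ltW.
Qed.

Lemma compact_continuous_bounded (K : set 'rV[R]_n) (f : 'rV[R]_n -> R) :
  compact K -> continuous f -> exists2 M : R, 0 < M & forall x, K x -> `|f x| <= M.
Proof.
move=> cK cf; have : compact (f @` K).
  by apply: continuous_compact => //; exact: continuous_subspaceT.
move=> /compact_bounded [M [Mr HM]]; exists (`|M| + 1); first by rewrite ltr_wpDl.
move=> x Kx; apply: (HM (`|M| + 1)); last by exists x.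
by rewrite (le_lt_trans (ler_norm _))// ltrDl.
Qed.

Lemma compact_sub_cball (K : set 'rV[R]_n) : compact K ->
  exists2 r, 0 < r & K `<=` cball r.
Proof.
move=> cK; have [M M0 HM] := compact_continuous_bounded cK continuous_enorm.
by exists M => // x /HM; rewrite ger0_norm ?enorm_ge0.
Qed.

Lemma compact_lty (K : set 'rV[R]_n) : compact K -> (mu K < +oo)%E.
Proof.
move=> /compact_sub_cball[r r0 Kr].
exact: le_lt_trans (le_lebesgue_rV Kr) (lebesgue_rV_cball_lty _ _).
Qed.

End rV_topology.

(** * Calculus of C^1 functions *)

Section smoothstep.
Context (R : realType).
Implicit Types t : R.

Definition pos1 t : R := Num.max t 0.
Definition pos2 t : R := pos1 t ^+ 2.
(** This is [pos1 t ^+ 3], written as a product so that its derivative comes from that of [pos2] by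
    the product rule. *)
Definition pos3 t : R := t * pos2 t.

Lemma pos1_le0 t : t <= 0 -> pos1 t = 0.
Proof. by move=> t0; rewrite /pos1 max_r. Qed.

Lemma pos1_ge0 t : 0 <= t -> pos1 t = t.
Proof. by move=> t0; rewrite /pos1 max_l. Qed.

Lemma continuous_pos1 : continuous pos1.
Proof. by move=> t; apply: continuous_max; [exact: cvg_id|exact: cvg_cst]. Qed.

Lemma is_derive_pos2 t : is_derive t 1 pos2 (2 * pos1 t).
Proof.
have cvg_pos2 : h^-1 *: (pos2 (h *: 1 + t) - pos2 t) @[h --> 0^'] --> 2 * pos1 t.
  apply/cvgrPdist_le => e e0; near=> h.
  have h0 : h != 0 by near: h; exact: nbhs_dnbhs_neq.
  have he : `|h| <= e by near: h; apply: dnbhs0_le.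
  rewrite -(@ler_pM2l _ `|h|) ?normr_gt0// -normrM mulrBr.
  rewrite /GRing.scale/= mulr1 mulVKf// /pos2.
  (* The first order remainder of [pos2] is at most [h ^+ 2], whether or not 0 lies between [t] and
     [h + t]. *)
  apply: le_trans (_ : `|h| * `|h| <= _); last by rewrite ler_pM2l ?normr_gt0.
  rewrite -expr2 real_normK ?num_real//.
  have [ht|ht] := leP (h + t) 0; have [t0|t0] := leP t 0;
    rewrite ?(pos1_le0 ht) ?(pos1_le0 t0) ?(pos1_ge0 (ltW ht)) ?(pos1_ge0 (ltW t0)) ler_norml; nra.
apply: DeriveDef; first by apply/cvg_ex; eexists; exact: cvg_pos2.
exact: cvg_lim cvg_pos2.
Unshelve. all: by end_near. Qed.

Lemma is_derive_pos3 t : is_derive t 1 pos3 (3 * pos2 t).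
Proof.
apply: (@is_derive_eq _ _ _ _ _ _ _ _ (is_deriveM (is_derive_id t 1) (is_derive_pos2 t))).
rewrite /GRing.scale/= /pos2.
have [t0|t0] := leP t 0; first by rewrite pos1_le0//; ring.
by rewrite pos1_ge0 ?ltW//; ring.
Qed.

(* The third difference of [max(t, 0) ^ 3 / 6]: C^2, 0 for [t <= 0] and 1 for [3 <= t]. *)
Definition step t := (pos3 t - 3 * pos3 (t - 1) + 3 * pos3 (t - 2) - pos3 (t - 3)) / 6.
Definition step1 t := (pos2 t - 3 * pos2 (t - 1) + 3 * pos2 (t - 2) - pos2 (t - 3)) / 2.
Definition step2 t := pos1 t - 3 * pos1 (t - 1) + 3 * pos1 (t - 2) - pos1 (t - 3).

Lemma is_derive_comp_subr (f : R -> R) c t d : is_derive (t - c) 1 f d ->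
  is_derive t 1 (fun u => f (u - c)) d.
Proof.
move=> df; rewrite -[d]mulr1; apply: (@is_derive1_comp _ f (fun u => u - c)).
by apply: is_derive_eq; rewrite subr0.
Qed.

Lemma is_derive_step t : is_derive t 1 step (step1 t).
Proof.
have d0 := is_derive_pos3 t.
have d1 := is_derive_comp_subr (is_derive_pos3 (t - 1)).
have d2 := is_derive_comp_subr (is_derive_pos3 (t - 2)).
have d3 := is_derive_comp_subr (is_derive_pos3 (t - 3)).
rewrite (_ : step = (6^-1 \*: (pos3 - 3 \*: (fun u => pos3 (u - 1)) +
  3 \*: (fun u => pos3 (u - 2)) - (fun u => pos3 (u - 3))))).
  by apply: is_derive_eq; rewrite /step1 /GRing.scale/=; field.
by apply/funext => u; rewrite /step mulrC.
Qed.

Lemma is_derive_step1 t : is_derive t 1 step1 (step2 t).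
Proof.
have d0 := is_derive_pos2 t.
have d1 := is_derive_comp_subr (is_derive_pos2 (t - 1)).
have d2 := is_derive_comp_subr (is_derive_pos2 (t - 2)).
have d3 := is_derive_comp_subr (is_derive_pos2 (t - 3)).
rewrite (_ : step1 = (2^-1 \*: (pos2 - 3 \*: (fun u => pos2 (u - 1)) +
  3 \*: (fun u => pos2 (u - 2)) - (fun u => pos2 (u - 3))))).
  by apply: is_derive_eq; rewrite /step2 /GRing.scale/=; field.
by apply/funext => u; rewrite /step1 mulrC.
Qed.

Lemma continuous_step1 : continuous step1.
Proof.
move=> t; apply: differentiable_continuous; apply/derivable1_diffP.
by have [] := is_derive_step1 t.
Qed.

Lemma continuous_step2 : continuous step2.
Proof.
have cs c : continuous (fun t => pos1 (t - c)).
  move=> t; apply: (@continuous_comp _ _ _ (fun u => u - c)); last exact: continuous_pos1.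
  by apply: cvgB; [exact: cvg_id|exact: cvg_cst].
move=> t; apply: cvgB; [apply: cvgD; [apply: cvgB|]|].
- exact: continuous_pos1.
- by apply: cvgM; [exact: cvg_cst|exact: cs].
- by apply: cvgM; [exact: cvg_cst|exact: cs].
- exact: cs.
Qed.

Lemma step_le0 t : t <= 0 -> [/\ step t = 0, step1 t = 0 & step2 t = 0].
Proof.
move=> t0; rewrite /step /step1 /step2 /pos3 /pos2 !pos1_le0; [|lra..].
by split; ring.
Qed.

Lemma step_ge3 t : 3 <= t -> [/\ step t = 1, step1 t = 0 & step2 t = 0].
Proof.
move=> t3; rewrite /step /step1 /step2 /pos3 /pos2 !pos1_ge0; [|lra..].
by split; field.
Qed.

(** Only the independence from [t] matters. Between 0 and 3 each truncated power is bounded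
    separately; elsewhere the functions are constant. *)
Lemma step_bound t : [/\ `|step t| <= 36, `|step1 t| <= 36 & `|step2 t| <= 36].
Proof.
have [t0|t0] := leP t 0.
  by have [-> -> ->] := step_le0 t0; rewrite !normr0; split; lra.
have [t3|t3] := leP 3 t.
  by have [-> -> ->] := step_ge3 t3; rewrite normr0 normr1; split; lra.
have b1 s : s <= 3 -> 0 <= pos1 s <= 3.
  move=> s3; have [s0|s0] := leP s 0; first by rewrite pos1_le0// lexx ler0n.
  by rewrite (pos1_ge0 (ltW s0)) (ltW s0).
have b2 s : s <= 3 -> 0 <= pos2 s <= 9.
  by move=> /b1 s3; rewrite /pos2; nra.
have b3 s : s <= 3 -> 0 <= pos3 s <= 27.
  move=> s3; rewrite /pos3; have [s0|s0] := leP s 0.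
    by rewrite /pos2 pos1_le0// expr0n mulr0; lra.
  by have := b2 s s3; nra.
rewrite /step /step1 /step2 !ler_norml.
have := b1 t ltac:(lra); have := b1 (t - 1) ltac:(lra).
have := b1 (t - 2) ltac:(lra); have := b1 (t - 3) ltac:(lra).
have := b2 t ltac:(lra); have := b2 (t - 1) ltac:(lra).
have := b2 (t - 2) ltac:(lra); have := b2 (t - 3) ltac:(lra).
have := b3 t ltac:(lra); have := b3 (t - 1) ltac:(lra).
have := b3 (t - 2) ltac:(lra); have := b3 (t - 3) ltac:(lra).
by split; lra.
Qed.

End smoothstep.

(** * C^1 functions with an explicit gradient *)

Section gradients.
Context (R : realType) (n : nat).
Implicit Types (f g : 'rV[R]_n -> R) (df dg : 'I_n -> 'rV[R]_n -> R)
  (K O : set 'rV[R]_n) (i j : 'I_n).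

(** The gradient is a parameter rather than [pderiv], so that sums, products and compositions carry
    an explicit formula for it. *)
Definition has_grad f df := [/\ forall x, differentiable f x,
  forall i x, pderiv i f x = df i x & forall i, continuous (df i)].

Lemma has_grad_continuous f df : has_grad f df -> continuous f.
Proof. by move=> [+ _ _] x => /(_ x); exact: differentiable_continuous. Qed.

Lemma eq_has_grad f df g dg : has_grad f df -> f =1 g ->
  (forall i, df i =1 dg i) -> has_grad g dg.
Proof.
move=> fdf /funext <- dfg; rewrite (_ : dg = df)//.
by apply/funext => i; apply/funext => x; rewrite dfg.
Qed.

Lemma has_grad_cst (r : R) : has_grad (fun=> r) (fun _ _ => 0).
Proof.
split => [x|i x|i x /=]; [exact: differentiable_cst|exact: derive_cst|exact: cst_continuous].
Qed.

Lemma has_grad_coord i : has_grad (fun x => x 0 i) (fun j _ => (i == j)%:R).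
Proof.
split => [x|j x|j x /=]; [exact: differentiable_coord| |exact: cst_continuous].
have := @derive_mx R 'rV[R]_n 1 n id x (delta_mx 0 j) (@derivable_id _ _ _ _).
by rewrite derive_id => /(congr1 (fun A : 'rV[R]_n => A 0 i)); rewrite !mxE/= /pderiv => <-.
Qed.

Lemma has_gradD f df g dg : has_grad f df -> has_grad g dg ->
  has_grad (fun x => f x + g x) (fun i x => df i x + dg i x).
Proof.
move=> [ff df_ cf] [fg dg_ cg]; split => [x|i x|i].
- exact: differentiableD.
- rewrite /pderiv deriveD; [|exact: diff_derivable..].
  by congr (_ + _); [exact: df_|exact: dg_].
- by move=> x; exact: (continuousD (cf i x) (cg i x)).
Qed.

Lemma has_gradM f df g dg : has_grad f df -> has_grad g dg ->
  has_grad (fun x => f x * g x) (fun i x => df i x * g x + f x * dg i x).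
Proof.
move=> [ff df_ cf] [fg dg_ cg]; split => [x|i x|i].
- exact: differentiableM.
- rewrite /pderiv deriveM; [|exact: diff_derivable..].
  rewrite [LHS]addrC /GRing.scale/= mulrC; congr (_ * _ + _ * _); [exact: df_|exact: dg_].
- move=> x; have fx := differentiable_continuous (ff x).
  have gx := differentiable_continuous (fg x).
  exact: (continuousD (continuousM (cf i x) gx) (continuousM fx (cg i x))).
Qed.

Lemma has_gradZ (r : R) f df : has_grad f df ->
  has_grad (fun x => r * f x) (fun i x => r * df i x).
Proof.
move=> fdf; apply: eq_has_grad (has_gradM (has_grad_cst r) fdf) _ _ => // i x.
by rewrite mul0r add0r.
Qed.

Lemma has_grad_sum m (f : 'I_m -> 'rV[R]_n -> R) (df : 'I_m -> 'I_n -> 'rV[R]_n -> R) :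
  (forall k, has_grad (f k) (df k)) ->
  has_grad (fun x => \sum_k f k x) (fun i x => \sum_k df k i x).
Proof.
elim: m f df => [|m IH] f df fdf.
  by apply: eq_has_grad (has_grad_cst 0) _ _ => [x|i x]; rewrite big_ord0.
apply: eq_has_grad (has_gradD (fdf ord0) (IH _ _ (fun k => fdf (lift ord0 k)))) _ _
  => [x|i x]; by rewrite big_ord_recl.
Qed.

Lemma has_grad_comp (S S1 : R -> R) f df : (forall t : R, is_derive t 1 S (S1 t)) ->
  continuous S1 -> has_grad f df ->
  has_grad (fun x => S (f x)) (fun i x => S1 (f x) * df i x).
Proof.
move=> dS cS [ff df_ cf].
have diffS t : differentiable S t by apply/derivable1_diffP; have [] := dS t.
split => [x|i x|i].
- by apply: differentiable_comp; [exact: ff|exact: diffS].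
- rewrite /pderiv deriveE; last by apply: differentiable_comp; [exact: ff|exact: diffS].
  rewrite diff_comp//= -[X in 'd S _ X]deriveE// diff1E//= derive1E.
  by have /@derive_val -> := dS (f x); rewrite /GRing.scale/= mulrC -df_.
- move=> x; apply: (continuousM _ (cf i x)).
  exact: (continuous_comp (differentiable_continuous (ff x)) (cS (f x))).
Qed.

Lemma C1_compact_has_grad O f : C1_compact O f -> has_grad f (fun i => pderiv i f).
Proof. by move=> [df cf _ _]. Qed.

Lemma has_grad_C1_compact O K f df : has_grad f df -> compact K -> K `<=` O ->
  (forall x, ~ K x -> f x = 0) -> C1_compact O f.
Proof.
move=> [ff df_ cf] cK KO fK.
have sK : closure [set x | f x != 0] `<=` K.
  have clK : closed K by apply: compact_closed => //; exact: norm_hausdorff.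
  rewrite closureE; apply: smallest_sub => // x /= fx.
  by apply: contrapT => /fK/eqP; exact/negP.
split => //.
- by move=> i; rewrite (_ : pderiv i f = df i)//; apply/funext => x; exact: df_.
- by apply: subclosed_compact cK _ => //; exact: closed_closure.
- exact: subset_trans KO.
Qed.

Lemma has_grad_outside K f df i x : has_grad f df -> closed K ->
  (forall x, ~ K x -> f x = 0) -> ~ K x -> df i x = 0.
Proof.
move=> [_ df_ _] cK fK Kx; rewrite -df_ /pderiv.
rewrite (@near_eq_derive _ _ _ _ (cst 0)).
- exact: derive_cst.
- have : open_nbhs x (~` K) by split => //; exact: closed_openC.
  by move=> /open_nbhs_nbhs; apply: filterS => y Ky; rewrite /= fK.
Qed.

End gradients.

(** * Translation invariance and the divergence theorem *)

Section integral_pderiv.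
Context (R : realType) (n : nat).
Local Notation mu := (@lebesgue_rV R n).
Implicit Types (f : 'rV[R]_n -> R) (D K : set 'rV[R]_n).

Lemma integrable_bounded_support D K f (M : R) :
  measurable (D : set (rVT R n)) -> measurable (K : set (rVT R n)) ->
  (mu K < +oo)%E -> rV_measurable_fun D f ->
  (forall x, D x -> `|f x| <= M) -> (forall x, D x -> ~ K x -> f x = 0) ->
  rV_integrable D f.
Proof.
move=> mD mK Koo mf fM fK.
have mDK : measurable (D `&` K : set (rVT R n)) by exact: measurableI.
have intDK : mu.-integrable (D `&` K) (EFin \o f).
  apply: measurable_bounded_integrable => //.
  - by apply: le_lt_trans Koo; apply: le_lebesgue_rV; exact: subIsetr.
  - by apply: measurable_funS mf => //; exact: subIsetl.
  - exists M; split; first exact: num_real.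
    by move=> y My x [Dx _] /=; exact: le_trans (fM x Dx) (ltW My).
apply/(integrable_mkcond _ mD); move/(integrable_mkcond _ mDK) : intDK.
rewrite (_ : _ \_ (D `&` K) = (EFin \o f) \_ D)//.
apply/funext => x; rewrite /patch in_setI.
have [xD|//] := boolP (x \in D); have [//|/negP xK] := boolP (x \in K).
by rewrite /= fK//; [exact: set_mem|move=> Kx; apply: xK; exact: mem_set].
Qed.

Lemma integrable_continuous_support f r : continuous f ->
  (forall x, r < enorm x -> f x = 0) -> rV_integrable setT f.
Proof.
move=> cf f0; have [M M0 fM] := compact_continuous_bounded (@compact_cball R n r) cf.
apply: (@integrable_bounded_support _ (cball r) _ M) => //.
- exact: (@caratheodory_borel R n _ (measurable_cball _)).
- exact: lebesgue_rV_cball_lty.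
- exact: continuous_measurable_cara.
- move=> x _; have [xr|xr] := leP (enorm x) r; first exact: fM.
  by rewrite f0// normr0 ltW.
- by move=> x _ xr; apply: f0; rewrite ltNge; exact/negP.
Qed.

Lemma dot_subr_le (x y : 'rV[R]_n) : dot (x - y) (x - y) <= 2 * dot x x + 2 * dot y y.
Proof.
rewrite !dotE !mulr_sumr -big_split/=; apply: ler_sum => i _; rewrite !mxE.
by have := sqr_ge0 (x 0 i + y 0 i); nra.
Qed.

(** The factor 2 comes from [dot_subr_le], which stands in for the triangle inequality; it is
    harmless, since only some radius outside which translates vanish is wanted. *)
Lemma enorm_addr_gt (x w : 'rV[R]_n) (r : R) :
  2 * (enorm w + `|r|) < enorm x -> r < enorm (x + w).
Proof.
move=> xrw; rewrite ltNge; apply/negP => xr.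
have := dot_subr_le (x + w) w; rewrite addrK -!sqr_enorm.
have r0 : 0 <= r by exact: le_trans (enorm_ge0 _) xr.
have w0 := enorm_ge0 w; rewrite ger0_norm// in xrw.
have xwr : enorm (x + w) ^+ 2 <= r ^+ 2 by rewrite ler_sqr ?nnegrE ?enorm_ge0.
have : (2 * (enorm w + r)) ^+ 2 < enorm x ^+ 2.
  by rewrite ltr_sqr ?nnegrE ?enorm_ge0// mulr_ge0// addr_ge0.
by have := mulr_ge0 w0 r0; nra.
Qed.

Lemma rV_integral_translation f v r : continuous f ->
  (forall x, r < enorm x -> f x = 0) ->
  rV_integral setT (fun x => f (x + v)) = rV_integral setT f.
Proof.
move=> cf f0.
have mtau (w : 'rV[R]_n) :
    measurable_fun [set: rVT R n] (fun x => x + w : 'rV[R]_n).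
  move=> _ Y mY; rewrite setTI; apply: caratheodory_borel.
  rewrite -[X in measurable X]setTI.
  have := @measurable_affine_rV R n 1 w measurableT Y mY.
  by under eq_fun do rewrite scale1r.
have tauE (w : 'rV[R]_n) (Y : set 'rV[R]_n) : measurable Y ->
    pushforward mu (fun x => x + w : 'rV[R]_n) Y = borel_lebesgue R n Y.
  move=> mY; rewrite /pushforward lebesgue_rV_borel.
    have := @borel_lebesgue_affine R n 1 w Y ltr01 mY.
    rewrite expr1n invr1 mul1e => <-; congr (borel_lebesgue R n _).
    by apply/seteqP; split => x /=; rewrite scale1r.
  rewrite -[X in measurable X]setTI.
  have := @measurable_affine_rV R n 1 w measurableT Y mY.
  by under eq_fun do rewrite scale1r.
(* Every translate has the same integral as [f] against the Borel measure, to which [mu] is pushed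
   forward; [w = v] and [w = 0] are then compared. *)
have intE (w : 'rV[R]_n) : (\int[mu]_x (f (x + w)%R)%:E =
    \int[borel_lebesgue R n]_x (f x)%:E)%E.
  have -> : (\int[borel_lebesgue R n]_x (f x)%:E =
      \int[pushforward mu (fun x => (x + w)%R : 'rV[R]_n)]_x (f x)%:E)%E.
    by apply: eq_measure_integral => Y mY _; apply/esym; exact: tauE.
  rewrite (integral_pushforward (mtau w))//.
    by apply/measurable_EFinP; exact: continuous_measurable_rV.
  rewrite preimage_setT.
  apply: (@integrable_continuous_support (fun x => f (x + w)) (2 * (enorm w + `|r|))).
    have cw : continuous (fun y : 'rV[R]_n => y + w).
      move=> x; apply: (@continuousD _ _ _ (fun y : 'rV[R]_n => y) (fun=> w)) => //.
      exact: cst_continuous.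
    by move=> x; exact: (continuous_comp (cw x) (cf (x + w))).
  by move=> x xrw; apply: f0; exact: enorm_addr_gt.
rewrite /rV_integral /Rintegral intE -(intE 0).
congr fine; apply: eq_integral => x _; congr (f _)%:E.
exact: (addr0 (x : 'rV[R]_n)).
Qed.

Lemma has_grad_line f df (x v : 'rV[R]_n) i (t : R) : has_grad f df -> v = delta_mx 0 i ->
  is_derive t 1 (fun s : R => f (x + s *: v)) (df i (x + t *: v)).
Proof.
move=> [ff df_ _] vE.
have cvg_q : h^-1 *: (f (x + (h *: 1 + t) *: v) - f (x + t *: v)) @[h --> 0^']
    --> df i (x + t *: v).
  rewrite -df_ /pderiv -vE.
  have := @diff_derivable _ _ _ _ _ v (ff (x + t *: v)); rewrite /derivable => dv.
  apply: cvg_trans dv; apply: near_eq_cvg; near=> h.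
  have -> : h *: (1 : R^o) = h by exact: mulr1.
  by rewrite /= scalerDl addrCA.
apply: DeriveDef; first by apply/cvg_ex; eexists; exact: cvg_q.
exact: cvg_lim cvg_q.
Unshelve. all: by end_near. Qed.

Lemma enorm_delta i : enorm (delta_mx 0 i : 'rV[R]_n) = 1.
Proof.
rewrite /enorm dotE (bigD1 i)//= big1 ?addr0 => [|j ji].
  by rewrite mxE !eqxx mulr1 sqrtr1.
by rewrite mxE (negPf ji) mul0r.
Qed.

Lemma has_grad_quotient_le f df (M : R) (x : 'rV[R]_n) i t : has_grad f df ->
  (forall y, `|df i y| <= M) -> 0 < t ->
  `|t^-1 * (f (x + t *: delta_mx 0 i) - f x)| <= M.
Proof.
move=> fdf dM t0.
have dl s := @has_grad_line f df x _ i s fdf erefl.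
have [|s _] := @MVT R (fun s => f (x + s *: delta_mx 0 i))
  (fun s => df i (x + s *: delta_mx 0 i)) 0 t t0 (fun s _ => dl s).
  apply: continuous_subspaceT => s; apply: differentiable_continuous.
  by apply/derivable1_diffP; have [] := dl s.
rewrite scale0r addr0 subr0 => ->.
by rewrite mulrC mulfK ?lt0r_neq0.
Qed.

Lemma has_grad_quotient_cvg f df (x : 'rV[R]_n) i : has_grad f df ->
  m.+1%:R * (f (x + m.+1%:R^-1 *: delta_mx 0 i) - f x) @[m --> \oo] --> df i x.
Proof.
move=> fdf.
have [ff df_ _] := fdf.
have := @diff_derivable _ _ _ _ _ (delta_mx 0 i) (ff x).
rewrite /derivable -/(pderiv i f x) => dv.
have {}dv : h^-1 *: (f (h *: delta_mx 0 i + x) - f x) @[h --> 0^'] --> df i x.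
  by rewrite -df_; exact: dv.
have cvg0 : @harmonic R @ \oo --> (0 : R)^'.
  move=> A A0.
  have H : \forall m \near \oo, @harmonic R m != 0 -> A (harmonic m) := @cvg_harmonic R _ A0.
  have : \forall m \near \oo, A (@harmonic R m).
    by apply: filterS H => m; apply; rewrite /harmonic/= invr_eq0 pnatr_eq0.
  by [].
have := cvg_comp _ _ cvg0 dv; apply: cvg_trans; apply: near_eq_cvg; apply: nearW => m /=.
by rewrite /harmonic/= invrK (addrC x).
Qed.

(** The difference quotients of [f] have integral 0 by translation invariance. By the mean value
    theorem they are bounded by a bound for [df i], and they share a bounded support, so dominated
    convergence passes to the derivative. *)
Lemma integral_pderiv0 f df i r : has_grad f df ->
  (forall x, r < enorm x -> f x = 0) -> rV_integral setT (df i) = 0.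
Proof.
move=> fdf f0; have [ff _ cf] := fdf.
have df0 x : r < enorm x -> df i x = 0.
  move=> xr; apply: (has_grad_outside _ fdf (@closed_cball R n r)).
    by move=> y /negP; rewrite -ltNge; exact: f0.
  by apply/negP; rewrite -ltNge.
have [M M0 dM'] := compact_continuous_bounded (@compact_cball R n r) (cf i).
have dM y : `|df i y| <= M.
  by have [/dM'//|/df0->] := leP (enorm y) r; rewrite normr0 ltW.
pose e : 'rV[R]_n := delta_mx 0 i.
(* Outside radius [rho] all translates of [f] by a vector of norm at most 1 vanish, by
   [enorm_addr_gt]. *)
pose rho := 2 * (1 + `|r|).
have rrho : r <= rho.
  by rewrite /rho; have := ler_norm r; have := normr_ge0 r; lra.
pose g m (x : 'rV[R]_n) : R := m.+1%:R * (f (x + m.+1%:R^-1 *: e) - f x).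
have cfT (w : 'rV[R]_n) : continuous (fun x : 'rV[R]_n => f (x + w)).
  have cw : continuous (fun y : 'rV[R]_n => y + w).
    move=> x; apply: (@continuousD _ _ _ (fun y : 'rV[R]_n => y) (fun=> w)) => //.
    exact: cst_continuous.
  by move=> x; exact: (continuous_comp (cw x) (@has_grad_continuous _ _ _ _ fdf (x + w))).
have cd (w : 'rV[R]_n) : continuous (fun x : 'rV[R]_n => f (x + w) - f x).
  by move=> x; exact: (continuousB (cfT w x) (@has_grad_continuous _ _ _ _ fdf x)).
have cg m : continuous (g m).
  by move=> x; exact: (continuous_comp (cd _ x) (@mulrl_continuous _ m.+1%:R _)).
have fT0 m x : rho < enorm x -> f (x + m.+1%:R^-1 *: e) = 0.
  move=> xrho; apply/f0/enorm_addr_gt/(le_lt_trans _ xrho).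
  rewrite ler_pM2l// lerD2r enormZ enorm_delta mulr1 ger0_norm ?invr_ge0//.
  by rewrite invf_le1// ler1n.
have g0 m x : rho < enorm x -> g m x = 0.
  by move=> xrho; rewrite /g fT0// f0 ?(le_lt_trans rrho)// subrr mulr0.
have intg m : rV_integral setT (g m) = 0.
  rewrite /rV_integral RintegralZl//; last first.
    apply: (@integrable_continuous_support _ rho); last first.
      by move=> x xrho; rewrite fT0// f0 ?(le_lt_trans rrho)// subrr.
    exact: cd.
  rewrite RintegralB//; last 2 first.
  - by apply: (@integrable_continuous_support _ rho) => //; exact: fT0.
  - by apply: (@integrable_continuous_support _ r) => //; exact: (has_grad_continuous fdf).
  have := @rV_integral_translation f (m.+1%:R^-1 *: e) r (has_grad_continuous fdf) f0.
  by rewrite /rV_integral => ->; rewrite subrr mulr0.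
have gM m x : `|g m x| <= M.
  have := @has_grad_quotient_le f df M x i m.+1%:R^-1 fdf dM.
  by rewrite invrK invr_gt0; apply.
have intM : mu.-integrable setT (fun x => (M * \1_(@cball R n rho) x)%:E).
  apply: (@integrable_bounded_support setT (cball rho) (fun x => M * \1_(cball rho) x) M) => //.
  - exact: (@caratheodory_borel R n _ (measurable_cball _)).
  - exact: lebesgue_rV_cball_lty.
  - apply: measurable_funM => //; apply: measurable_indic.
    exact: (@caratheodory_borel R n _ (measurable_cball _)).
  - move=> x _; rewrite normrM (gtr0_norm M0) ger_pMr// normr_nat lern1.
    by case: (x \in _).
  - by move=> x _ xK; rewrite indicE memNset// mulr0.
have [] := @dominated_convergence _ _ _ mu setT measurableT
    (fun m x => (g m x)%:E) (fun x => (df i x)%:E) (fun x => (M * \1_(@cball R n rho) x)%:E).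
- by move=> m; apply/measurable_EFinP; exact: continuous_measurable_cara.
- by apply/measurable_EFinP; exact: continuous_measurable_cara.
- apply: aeW => x _; apply: cvg_EFin; first exact: nearW.
  exact: has_grad_quotient_cvg.
- exact: intM.
- apply: aeW => x m _; rewrite lee_fin indicE.
  have [xr|/negP xr] := boolP (x \in _); first by rewrite mulr1.
  rewrite g0 ?normr0 ?mulr0// ltNge; apply/negP => xrho.
  by apply: xr; exact: mem_set.
move=> _ _ cvg_int; rewrite /rV_integral /Rintegral.
rewrite (_ : \int[mu]_(x in setT) (df i x)%:E = 0)%E//.
apply: cvg_unique cvg_int _ => //.
rewrite (_ : [sequence _]_m = cst 0%E); first exact: cvg_cst.
apply/funext => m /=; rewrite -[LHS]fineK; last first.
  by apply: integrable_fin_num => //; exact: (integrable_continuous_support (cg m) (g0 m)).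
by congr EFin; exact: intg.
Qed.

End integral_pderiv.

(** * Weak derivatives *)

Section weak_derivatives.
Context (R : realType) (n : nat).
Local Notation mu := (@lebesgue_rV R n).
Implicit Types (f g u : 'rV[R]_n -> R) (D E K O : set 'rV[R]_n) (i j : 'I_n).

Lemma patch_support D E f : E `<=` D -> (forall x, D x -> ~ E x -> f x = 0) ->
  f \_ E = f \_ D.
Proof.
move=> ED fE; apply/funext => x; rewrite /patch.
have [xE|/negP xE] := boolP (x \in E); first by rewrite mem_set//; apply/ED/set_mem.
by case: ifPn => // /set_mem xD; rewrite fE// => Ex; apply/xE/mem_set.
Qed.

Lemma integrable_support D E f : measurable (D : set (rVT R n)) ->
  measurable (E : set (rVT R n)) -> E `<=` D ->
  (forall x, D x -> ~ E x -> f x = 0) -> rV_integrable E f -> rV_integrable D f.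
Proof.
move=> mD mE ED fE /(integrable_mkcond _ mE) intE; apply/(integrable_mkcond _ mD).
by move: intE; rewrite !restrict_EFin (patch_support ED fE).
Qed.

Lemma rV_integral_support D E f : E `<=` D ->
  (forall x, D x -> ~ E x -> f x = 0) -> rV_integral D f = rV_integral E f.
Proof.
move=> ED fE; rewrite /rV_integral Rintegral_mkcond [RHS]Rintegral_mkcond.
by rewrite (patch_support ED fE).
Qed.

(** Integration by parts against compactly supported C^1 functions takes place in this class; for
    [1 <= p] it contains the local L^p functions. *)
Definition L1_loc O u := rV_measurable_fun O u /\
  forall K, compact K -> K `<=` O -> rV_integrable K u.

Lemma measurable_compact K : compact K -> measurable (K : set (rVT R n)).
Proof.
move=> cK; apply: caratheodory_borel; apply: closed_measurable_rV.
by apply: compact_closed => //; exact: norm_hausdorff.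
Qed.

Lemma norm_le_powR (p : R) (y : R) : 1 <= p -> `|y| <= 1 + `|y| `^ p.
Proof.
move=> p1; have [y1|y1] := leP `|y| 1; first by rewrite (le_trans y1)// lerDl powR_ge0.
by rewrite (le_trans (le1r_powR (ltW y1) p1))// lerDr.
Qed.

Lemma Lp_loc_L1_loc (p : R) O u : measurable (O : set (rVT R n)) -> 1 <= p ->
  Lp_loc p O u -> L1_loc O u.
Proof.
move=> mO p1 [mu_ up]; split => // K cK KO.
have mK := measurable_compact cK.
have muK : rV_measurable_fun K u by exact: measurable_funS mu_.
have mup : measurable_fun (K : set (rVT R n)) (fun x => `|u x| `^ p).
  apply: (measurableT_comp (measurable_powR _)).
  exact: measurableT_comp.
have intp : mu.-integrable K (EFin \o (fun x => 1 + `|u x| `^ p)).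
  rewrite (_ : _ \o _ = (EFin \o cst 1) \+ (fun x => (`|u x| `^ p)%:E))//.
  apply: integrableD => //.
    apply: measurable_bounded_integrable => //; first exact: compact_lty.
    by exists 1; split => // y y1 x _ /=; rewrite normr1 ltW.
  apply/integrableP; split; first exact/measurable_EFinP.
  under eq_integral do rewrite gee0_abs ?lee_fin ?powR_ge0//.
  exact: up.
apply: le_integrable intp => //; first exact/measurable_EFinP.
move=> x Kx /=; rewrite lee_fin (le_trans (norm_le_powR _ p1))//.
exact: ler_norm.
Qed.

Lemma continuous_L1_loc O f : measurable (O : set (rVT R n)) -> continuous f -> L1_loc O f.
Proof.
move=> mO cf; split; first exact: continuous_measurable_cara.
move=> K cK KO; have mK := measurable_compact cK.
have [M M0 fM] := compact_continuous_bounded cK cf.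
apply: (@integrable_bounded_support _ _ K K f M) => //.
- exact: compact_lty.
- exact: continuous_measurable_cara.
Qed.

Lemma L1_locD O u g : L1_loc O u -> L1_loc O g -> L1_loc O (fun x => u x + g x).
Proof.
move=> [mu_ iu] [mg ig]; split; first exact: measurable_funD.
move=> K cK KO; rewrite /rV_integrable (_ : _ \o _ = (EFin \o u) \+ (EFin \o g))//.
by apply: integrableD; [exact: measurable_compact|exact: iu|exact: ig].
Qed.

Lemma L1_loc_integrable O D K u g (M : R) : measurable (O : set (rVT R n)) ->
  measurable (D : set (rVT R n)) -> D `<=` O -> compact K -> K `<=` O ->
  L1_loc O u -> rV_measurable_fun D g -> (forall x, D x -> `|g x| <= M) ->
  (forall x, D x -> ~ K x -> g x = 0) -> rV_integrable D (fun x => u x * g x).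
Proof.
move=> mO mD DO cK KO [mu_ iu] mg gM gK.
have mK := measurable_compact cK.
have mDK : measurable (D `&` K : set (rVT R n)) by exact: measurableI.
apply: (@integrable_support D (D `&` K)) => //.
  by move=> x Dx DKx; rewrite gK ?mulr0// => Kx; exact: DKx.
have intM : mu.-integrable (D `&` K) (EFin \o (fun x => M * u x)).
  rewrite (_ : _ \o _ = (fun x => M%:E * (EFin \o u) x)%E)//.
  apply: integrableZl => //.
  by apply: integrableS (iu K cK KO) => //; exact: subIsetr.
apply: le_integrable intM => //.
  apply/measurable_EFinP; apply: measurable_funM.
    by apply: measurable_funS mu_ => // x [/DO].
  by apply: measurable_funS mg => //; exact: subIsetl.
move=> x [Dx Kx] /=; rewrite lee_fin !normrM mulrC ler_wpM2r//.
by rewrite (le_trans (gM x Dx))// ler_norm.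
Qed.

Lemma L1_loc_test O K u f : measurable (O : set (rVT R n)) -> compact K -> K `<=` O ->
  L1_loc O u -> continuous f -> (forall x, ~ K x -> f x = 0) ->
  rV_integrable O (fun x => u x * f x).
Proof.
move=> mO cK KO Lu cf fK; have [M M0 fM] := compact_continuous_bounded cK cf.
apply: (@L1_loc_integrable O O K u f M) => //.
- exact: continuous_measurable_cara.
- move=> x _; have [/fM//|/fK->] := pselect (K x); by rewrite normr0 ltW.
- by move=> x _; exact: fK.
Qed.

Lemma L1_locM O u f : measurable (O : set (rVT R n)) -> L1_loc O u -> continuous f ->
  L1_loc O (fun x => u x * f x).
Proof.
move=> mO Lu cf; split.
  by apply: measurable_funM; [exact: Lu.1|exact: continuous_measurable_cara].
move=> K cK KO; have mK := measurable_compact cK.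
have [M M0 fM] := compact_continuous_bounded cK cf.
apply: (@L1_loc_integrable O K K u f M) => //.
exact: continuous_measurable_cara.
Qed.

Definition test O f df := has_grad f df /\
  exists K, [/\ compact K, K `<=` O & forall x, ~ K x -> f x = 0].

Definition weak_grad O i u g := [/\ L1_loc O u, L1_loc O g & weak_pderiv O i u g].

Lemma test_integrable O u f df : measurable (O : set (rVT R n)) -> test O f df ->
  L1_loc O u -> rV_integrable O (fun x => u x * f x).
Proof.
move=> mO [fdf [K [cK KO fK]]] Lu.
exact: (L1_loc_test mO cK KO Lu (has_grad_continuous fdf) fK).
Qed.

Lemma test_integrable_grad O u f df i : measurable (O : set (rVT R n)) -> test O f df ->
  L1_loc O u -> rV_integrable O (fun x => u x * df i x).
Proof.
move=> mO [fdf [K [cK KO fK]]] Lu; have [_ _ cdf] := fdf.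
apply: (L1_loc_test mO cK KO Lu (cdf i)) => x; apply: (has_grad_outside _ fdf) => //.
by apply: compact_closed => //; exact: norm_hausdorff.
Qed.

Lemma testM O f df g dg : test O f df -> has_grad g dg ->
  test O (fun x => g x * f x) (fun i x => dg i x * f x + g x * df i x).
Proof.
move=> [fdf [K [cK KO fK]]] gdg; split; first exact: has_gradM.
by exists K; split => // x /fK ->; rewrite mulr0.
Qed.

Lemma weak_grad_ibp O i u g f df : measurable (O : set (rVT R n)) ->
  weak_grad O i u g -> test O f df ->
  rV_integral O (fun x => u x * df i x) = - rV_integral O (fun x => g x * f x).
Proof.
move=> mO [Lu Lg wug] [fdf [K [cK KO fK]]].
rewrite -(wug f (has_grad_C1_compact fdf cK KO fK)).
by apply: eq_Rintegral => x _; have [_ -> _] := fdf.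
Qed.

Lemma weak_gradD O i u1 g1 u2 g2 : measurable (O : set (rVT R n)) ->
  weak_grad O i u1 g1 -> weak_grad O i u2 g2 ->
  weak_grad O i (fun x => u1 x + u2 x) (fun x => g1 x + g2 x).
Proof.
move=> mO w1 w2; have [Lu1 Lg1 _] := w1; have [Lu2 Lg2 _] := w2.
split; [exact: L1_locD|exact: L1_locD|move=> f C1f].
have tf : test O f (fun i => pderiv i f).
  split; first exact: C1_compact_has_grad C1f.
  have [_ _ cf sf] := C1f; exists (closure [set x | f x != 0]); split => // x fx.
  by apply: contrapT => /eqP f0; apply: fx; exact: subset_closure.
rewrite /rV_integral.
under eq_Rintegral do rewrite mulrDl.
rewrite RintegralD//; [|exact: (test_integrable_grad i mO tf)..].
under [in RHS]eq_Rintegral do rewrite mulrDl.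
rewrite RintegralD//; [|exact: (test_integrable (df := fun i => pderiv i f))..].
by rewrite opprD; congr (_ + _); [exact: (weak_grad_ibp mO w1 tf)|exact: (weak_grad_ibp mO w2 tf)].
Qed.

(** If [f] is a test function, so is [h f]; testing the weak derivative of [u] against it gives the
    product rule for C^1 multipliers. *)
Lemma weak_gradM O i u g h dh : measurable (O : set (rVT R n)) ->
  weak_grad O i u g -> has_grad h dh ->
  weak_grad O i (fun x => u x * h x) (fun x => g x * h x + u x * dh i x).
Proof.
move=> mO wu hdh; have [Lu Lg _] := wu; have [_ _ cdh] := hdh.
have ch := has_grad_continuous hdh.
split; [exact: L1_locM|by apply: L1_locD; exact: L1_locM|move=> f C1f].
have tf : test O f (fun i => pderiv i f).
  split; first exact: C1_compact_has_grad C1f.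
  have [_ _ cf sf] := C1f; exists (closure [set x | f x != 0]); split => // x fx.
  by apply: contrapT => /eqP f0; apply: fx; exact: subset_closure.
have := weak_grad_ibp mO wu (testM tf hdh).
rewrite /rV_integral.
under eq_Rintegral do rewrite mulrDr !mulrA.
rewrite RintegralD//; last 2 first.
- exact: (test_integrable mO tf (L1_locM mO Lu (cdh i))).
- exact: (test_integrable_grad i mO tf (L1_locM mO Lu ch)).
under [X in _ = - X]eq_Rintegral do rewrite mulrA.
move=> E; under [in RHS]eq_Rintegral do rewrite mulrDl.
rewrite RintegralD//; last 2 first.
- exact: (test_integrable mO tf (L1_locM mO Lg ch)).
- exact: (test_integrable mO tf (L1_locM mO Lu (cdh i))).
by rewrite opprD -E; ring.
Qed.

End weak_derivatives.

(** * L^p means *)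

Section Lp_means.
Context (R : realType) (n : nat).
Local Notation mu := (@lebesgue_rV R n).
Implicit Types (u w : 'rV[R]_n -> R) (p r t : R).
Local Notation A r := (@annulus R n r (2 * r)).
Local Notation vol r := (fine (mu (A r))).

Lemma caratheodory_annulus r s : measurable (annulus r s : set (rVT R n)).
Proof. by apply: caratheodory_borel; exact: measurable_annulus. Qed.

Lemma fin_annulus r s : mu (annulus r s) \is a fin_num.
Proof. by rewrite ge0_fin_numE// annulus_lty. Qed.

Lemma measurable_powR_norm D p u : rV_measurable_fun D u ->
  rV_measurable_fun D (fun x => `|u x| `^ p).
Proof.
move=> mu_; apply: (measurableT_comp (measurable_powR _)).
exact: measurableT_comp.
Qed.

Lemma Mp_integral_le p u r t : 0 < p -> 0 <= t -> rV_measurable_fun (A r) u ->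
  (Mp p u r <= t%:E)%E ->
  (\int[mu]_(x in A r) (`|u x| `^ p)%:E <= (t `^ p * vol r)%:E)%E.
Proof.
move=> p0 t0 mu_ Mt.
have mup := measurable_powR_norm p mu_.
(* If the volume were 0, the factor [(vol r)^-1] would be 0 by convention and [Mt] would say
   nothing, but then the integral vanishes. *)
have := fine_ge0 (measure_ge0 mu (A r)); rewrite le_eqVlt => /predU1P[vol0|vol0].
  have muA0 : mu (A r) = 0 by rewrite -[LHS]fineK ?fin_annulus// -vol0.
  have mup' : measurable_fun (A r : set (rVT R n)) (fun x => (`|u x| `^ p)%:E).
    exact/measurable_EFinP.
  rewrite -vol0 mulr0.
  by rewrite (null_set_integral (caratheodory_annulus r (2 * r)) mup' muA0).
have X0 : (0 <= \int[mu]_(x in A r) (`|u x| `^ p)%:E)%E.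
  by apply: integral_ge0 => x _; rewrite lee_fin powR_ge0.
move: Mt; rewrite /Mp; set X := (\int[mu]_(x in A r) _)%E in X0 *.
move: X0; case: X => [x| |]//= x0.
  rewrite lee_fin in x0; rewrite !lee_fin => xt.
  rewrite mulrC -ler_pdivrMl//.
  have y0 : 0 <= (vol r)^-1 * x by rewrite mulr_ge0 ?invr_ge0 ?(ltW vol0).
  have -> : (vol r)^-1 * x = (((vol r)^-1 * x) `^ p^-1) `^ p.
    by rewrite -powRrM mulVf ?powRr1// lt0r_neq0.
  by apply: (ge0_ler_powR (ltW p0)); rewrite ?nnegrE ?powR_ge0.
(* An infinite integral would make the mean infinite, against the finite bound [t]. *)
by rewrite gt0_muley ?lte_fin ?invr_gt0// poweRyr// invr_neq0// lt0r_neq0.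
Qed.

(* [y <= t (1 + (y / t) ^ p)] replaces Hoelder's inequality. *)
Lemma Mp_L1_le p u w r t : 1 <= p -> 0 < t -> rV_measurable_fun (A r) u ->
  rV_measurable_fun (A r) w -> (forall x, A r x -> `|u x| <= w x) ->
  (Mp p w r <= t%:E)%E ->
  (\int[mu]_(x in A r) (`|u x|)%:E <= (2 * t * vol r)%:E)%E.
Proof.
move=> p1 t0 mu_ mw uw Mt; have p0 : 0 < p by exact: lt_le_trans p1.
have := Mp_integral_le p0 (ltW t0) mw Mt; set X := (\int[mu]_(x in A r) _)%E => Xt.
have mA := @caratheodory_annulus r (2 * r).
have le1 x : A r x -> ((`|u x|)%:E <= (t + t * t `^ (- p) * `|w x| `^ p)%:E)%E.
  move=> Ax; rewrite lee_fin (le_trans (uw x Ax))//.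
  rewrite -[leLHS](mulVKf (lt0r_neq0 t0)) -mulrA.
  have -> : t + t * (t `^ (- p) * `|w x| `^ p) = t * (1 + `|t^-1 * w x| `^ p).
    rewrite mulrDr mulr1 normrM powRM// (gtr0_norm (_ : 0 < t^-1)) ?invr_gt0//.
    by rewrite -powR_inv1 ?ltW// -powRrM mulN1r.
  rewrite ler_pM2l//; apply: le_trans (ler_norm _) (norm_le_powR _ p1).
apply: (@le_trans _ _ (\int[mu]_(x in A r) (t + t * t `^ (- p) * `|w x| `^ p)%:E)%E).
  have mf1 : measurable_fun (A r : set (rVT R n)) (fun x => (`|u x|)%:E).
    by apply/measurable_EFinP; exact: measurableT_comp.
  have mf2 : measurable_fun (A r : set (rVT R n))
      (fun x => (t + t * t `^ (- p) * `|w x| `^ p)%:E).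
    apply/measurable_EFinP; apply: measurable_funD; first exact: measurable_cst.
    apply: measurable_funM; first exact: measurable_cst.
    exact: measurable_powR_norm.
  have f10 x : A r x -> (0 <= (`|u x|)%:E)%E by rewrite lee_fin.
  exact: (@ge0_le_integral _ _ _ mu _ mA _ _ f10 mf1 mf2 le1).
under eq_integral do rewrite EFinD.
have tp0 : 0 <= t * t `^ (- p) by rewrite mulr_ge0 ?powR_ge0 ?ltW.
have mwp : measurable_fun (A r : set (rVT R n)) (fun x => (`|w x| `^ p)%:E).
  by apply/measurable_EFinP; exact: measurable_powR_norm.
have mtwp : measurable_fun (A r : set (rVT R n))
    (fun x => (t * t `^ (- p) * `|w x| `^ p)%:E).
  apply/measurable_EFinP; apply: measurable_funM; first exact: measurable_cst.
  exact: measurable_powR_norm.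
rewrite (ge0_integralD _ mA _ _ _ mtwp); last 3 first.
- by move=> x _; rewrite lee_fin ltW.
- by apply/measurable_EFinP; exact: measurable_cst.
- by move=> x _; rewrite lee_fin mulr_ge0 ?powR_ge0.
under [X in (_ + X)%E]eq_integral do rewrite EFinM.
rewrite (ge0_integralZl _ mA mwp); last 2 first.
- by move=> x _; rewrite lee_fin powR_ge0.
- by rewrite lee_fin.
rewrite (integral_cst _ mA).
apply: (@le_trans _ _ (t%:E * (vol r)%:E +
    (t * t `^ (- p))%:E * (t `^ p * vol r)%:E)%E).
  by apply: leeD; [rewrite fineK ?fin_annulus|apply: lee_wpmul2l; rewrite ?lee_fin].
rewrite -!EFinM -EFinD lee_fin powRN mulrA -(mulrA t) mulVf ?mulr1; first lra.
by rewrite lt0r_neq0// powR_gt0.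
Qed.

(** The terms of [M2p] are nonnegative, so each is at most [B], and the entries of [Du] and [D2u]
    are dominated by [enorm] and [frobenius]. The bounds on the means of [zeta] and [v] are used in
    this L^1 form. *)
Lemma M2p_L1_le p u (Du : 'rV[R]_n -> 'rV[R]_n) (D2u : 'rV[R]_n -> 'M[R]_n) r (B : R) :
  1 <= p -> 0 < r -> 0 < B ->
  rV_measurable_fun (A r) u ->
  (forall i, rV_measurable_fun (A r) (fun x => Du x 0 i)) ->
  (forall i j, rV_measurable_fun (A r) (fun x => D2u x i j)) ->
  (M2p p u Du D2u r <= B%:E)%E ->
  [/\ (\int[mu]_(x in A r) (`|u x|)%:E <= (2 * B * vol r)%:E)%E,
      forall i, (\int[mu]_(x in A r) (`|Du x 0 i|)%:E <= (2 * (B / r) * vol r)%:E)%E &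
      forall i j, (\int[mu]_(x in A r) (`|D2u x i j|)%:E <=
        (2 * (B / r ^+ 2) * vol r)%:E)%E].
Proof.
move=> p1 r0 B0 mu_ mDu mD2u; rewrite /M2p /M1p => MB.
have le3 (a b c : \bar R) : (0 <= a -> 0 <= b -> 0 <= c -> a + (b + c) <= B%:E ->
    [/\ a <= B%:E, b <= B%:E & c <= B%:E])%E.
  move=> a0 b0 c0 abc; split; apply: le_trans abc.
  - by rewrite leeDl// adde_ge0.
  - by rewrite addeCA leeDl// adde_ge0.
  - by rewrite addeA leeDr// adde_ge0.
have Mp0 w : (0 <= Mp p w r)%E by exact: poweR_ge0.
have rMp0 (k : R) w : 0 <= k -> (0 <= k%:E * Mp p w r)%E.
  by move=> k0; apply: mule_ge0; [rewrite lee_fin|exact: Mp0].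
have [M2 M1 M0] :=
  le3 _ _ _ (rMp0 _ _ (exprn_ge0 2 (ltW r0))) (rMp0 _ _ (ltW r0)) (Mp0 _) MB.
have mu_enorm : rV_measurable_fun (A r) (fun x => enorm (Du x)).
  apply: (measurableT_comp (continuous_measurable_fun (@sqrt_continuous R))).
  exact: measurable_dot.
have mu_frob : rV_measurable_fun (A r) (fun x => frobenius (D2u x)).
  apply: (measurableT_comp (continuous_measurable_fun (@sqrt_continuous R))).
  apply: (@measurable_sum _ _ R (A r : set (rVT R n)) _ _
    (fun i x => \sum_j D2u x i j ^+ 2)) => i.
  apply: (@measurable_sum _ _ R (A r : set (rVT R n)) _ _
    (fun j x => D2u x i j ^+ 2)) => j.
  by apply: measurable_funX; exact: mD2u.
split.
- have mnu : rV_measurable_fun (A r) (fun x => `|u x|) by exact: measurableT_comp.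
  apply: (Mp_L1_le p1 B0 mu_ mnu (fun x _ => lexx _)).
  by apply: le_trans M0; rewrite /Mp; under eq_integral do rewrite normr_id.
- move=> i; apply: (Mp_L1_le p1 (divr_gt0 B0 r0) (mDu i) mu_enorm).
    by move=> x _; exact: enorm_coord.
  by rewrite mulrC EFinM (lee_pdivlMl _ _ r0); exact: M1.
- move=> i j; have r20 : 0 < r ^+ 2 by exact: exprn_gt0.
  apply: (Mp_L1_le p1 (divr_gt0 B0 r20) (mD2u i j) mu_frob).
    move=> x _; rewrite -sqrtr_sqr ler_sqrt; last first.
      by apply: sumr_ge0 => k _; apply: sumr_ge0 => l _; exact: sqr_ge0.
    rewrite (bigD1 i)//= (bigD1 j)//= -addrA lerDl addr_ge0// sumr_ge0// => k _.
      exact: sqr_ge0.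
    by apply: sumr_ge0 => l _; exact: sqr_ge0.
  by rewrite mulrC EFinM (lee_pdivlMl _ _ r20); exact: M2.
Qed.

End Lp_means.

(** * The radial integral and the modulus *)

Section radial_integral.
Context (R : realType) (n : nat) (J : R -> R) (eps K : R).
Hypothesis (n3 : (3 <= n)%N) (K0 : 0 <= K).
Hypothesis J_lip : forall r s, 0 < r -> r <= s -> s < eps ->
  `|J r - J s| <= K * ((s ^+ n - r ^+ n) / r ^+ n).
Local Notation leb := (@lebesgue_measure R).
Let g s := s ^- n.-1 * expR (J s).
Let h r := \int[leb]_(s in `]r, eps[) g s.

Lemma J_lip_linear r : 0 < r -> exists2 L, 0 < L &
  forall t, r <= t -> t <= 2 * r -> t < eps -> `|J t - J r| <= L * (t - r).
Proof.
(* The first summand bounds the slope of [t ^+ n] up to [2 * r]; since [K] may be 0, the [+ 1] makes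
   [L] positive. *)
move=> r0; exists (K * (n%:R * (2 * r) ^+ n.-1 / r ^+ n) + 1).
  by rewrite ltr_wpDl// mulr_ge0// !mulr_ge0 ?invr_ge0 ?exprn_ge0 ?ler0n//; lra.
move=> t rt t2r teps; rewrite distrC (le_trans (J_lip r0 rt teps))//.
have tn : t ^+ n - r ^+ n <= n%:R * (2 * r) ^+ n.-1 * (t - r).
  rewrite subrXX mulrC ler_wpM2r ?subr_ge0//.
  rewrite [leRHS](_ : _ = \sum_(i < n) (2 * r) ^+ n.-1); last first.
    by rewrite sumr_const card_ord mulr_natl.
  apply: ler_sum => i _; have n_gt0 : (0 < n)%N by exact: leq_trans n3.
  have in1 : (i <= n.-1)%N by rewrite -ltnS prednK.
  rewrite [leRHS](_ : _ = (2 * r) ^+ (n.-1 - i) * (2 * r) ^+ i); last first.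
    by rewrite -exprD subnK.
  have r2 : 0 <= 2 * r by lra.
  have t0 : 0 <= t by lra.
  apply: ler_pM; rewrite ?exprn_ge0 ?(ltW r0)//.
    by rewrite lerXn2r ?nnegrE.
  by rewrite lerXn2r ?nnegrE ?(ltW r0)//; lra.
apply: (@le_trans _ _ (K * (n%:R * (2 * r) ^+ n.-1 * (t - r) / r ^+ n))).
  by rewrite ler_wpM2l// ler_wpM2r// invr_ge0 exprn_ge0// ltW.
by rewrite [leRHS]mulrDl mul1r mulrAC !mulrA lerDl subr_ge0.
Qed.

Lemma J_continuous s : 0 < s -> s < eps -> {for s, continuous J}.
Proof.
move=> s0 seps; apply/cvgrPdist_le => e e0.
pose b r : R := K * (`|s ^+ n - r ^+ n| / (s / 2) ^+ n).
have b_cvg : b r @[r --> s] --> b s.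
  apply: cvgM; [exact: cvg_cst|apply: cvgM; [|exact: cvg_cst]].
  apply: cvg_norm; apply: cvgB; [exact: cvg_cst|exact: exprn_continuous].
have bs : b s < e by rewrite /b subrr normr0 mul0r mulr0.
near=> r.
have s2r : s / 2 < r by near: r; apply: lt_nbhsr; lra.
have reps : r < eps by near: r; exact: lt_nbhsl.
have bre : b r < e by near: r; exact: cvgr_lt b_cvg _ bs.
have s20 : 0 < s / 2 by lra.
have r0 : 0 < r by lra.
apply: le_trans (ltW bre); rewrite /b.
have X_le (x y : R) : 0 <= x -> x <= y -> x ^+ n <= y ^+ n.
  by move=> x0 xy; apply: lerXn2r; rewrite ?nnegrE// (le_trans x0).
have V_ge0 (x : R) : 0 < x -> 0 <= (x ^+ n)^-1.
  by move=> x0; rewrite invr_ge0 exprn_ge0// ltW.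
have V_le (x y : R) : 0 < x -> x <= y -> (y ^+ n)^-1 <= (x ^+ n)^-1.
  move=> x0 xy; rewrite lef_pV2 ?posrE ?exprn_gt0//; last exact: lt_le_trans xy.
  by apply: X_le => //; exact: ltW.
have [rs|sr] := leP r s.
  rewrite distrC (le_trans (J_lip r0 rs seps))// ler_wpM2l// ler_pM//.
  - by rewrite subr_ge0 X_le// ltW.
  - exact: V_ge0.
  - exact: ler_norm.
  - by apply: V_le => //; exact: ltW.
rewrite (le_trans (J_lip s0 (ltW sr) reps))// ler_wpM2l// ler_pM//.
- by rewrite subr_ge0 X_le// ltW.
- exact: V_ge0.
- by rewrite distrC ler_norm.
- by apply: V_le => //; lra.
Unshelve. all: by end_near. Qed.

Lemma radial_integrand_ge0 s : 0 < s -> 0 <= g s.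
Proof. by move=> s0; rewrite mulr_ge0 ?expR_ge0// invr_ge0 exprn_ge0// ltW. Qed.

Lemma radial_integrand_le r s M : 0 < r -> r <= s -> s < eps -> J s <= M ->
  g s <= r ^- n.-1 * expR M.
Proof.
move=> r0 rs seps JM; apply: ler_pM; rewrite ?expR_ge0 ?ler_expR//.
  by rewrite invr_ge0 exprn_ge0//; lra.
rewrite lef_pV2 ?posrE ?exprn_gt0//; last lra.
by apply: lerXn2r; rewrite ?nnegrE; lra.
Qed.

Lemma J_le r s : 0 < r -> r <= s -> s < eps ->
  J s <= J r + K * ((s ^+ n - r ^+ n) / r ^+ n).
Proof.
move=> r0 rs seps; rewrite -lerBlDl (le_trans _ (J_lip r0 rs seps))//.
by rewrite distrC ler_norm.
Qed.

Lemma integrable_radial r : 0 < r -> leb.-integrable `]r, eps[ (EFin \o g).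
Proof.
move=> r0; apply: measurable_bounded_integrable => //.
- rewrite /= lebesgue_measure_itv/=; case: ifP => _ //; exact: ltry.
- apply: open_continuous_measurable_fun; first exact: interval_open.
  move=> s; rewrite inE/= in_itv/= => /andP[rs seps].
  have s0 : 0 < s by lra.
  apply: cvgM.
    apply: cvgV; first by rewrite expf_neq0 ?lt0r_neq0.
    exact: exprn_continuous.
  by apply: continuous_comp; [exact: J_continuous|exact: continuous_expR].
- pose M := r ^- n.-1 * expR (J r + K * ((eps ^+ n - r ^+ n) / r ^+ n)).
  exists M; split; first exact: num_real.
  move=> y My s /=; rewrite in_itv/= => /andP[rs seps].
  rewrite ger0_norm ?radial_integrand_ge0//; last lra.
  apply: le_trans (ltW My); apply: radial_integrand_le => //; first lra.
  rewrite (le_trans (J_le r0 (ltW rs) seps))// lerD2l ler_wpM2l//.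
  apply: ler_wpM2r; first by rewrite invr_ge0 exprn_ge0// ltW.
  rewrite lerD2r.
  by apply: lerXn2r; rewrite ?nnegrE; lra.
Qed.

Lemma radial_integralB r s : 0 < r -> r <= s -> s < eps ->
  h r - h s = \int[leb]_(t in `]r, s]) g t.
Proof.
move=> r0 rs seps; rewrite /h -(@Rintegral_itvB _ g (BRight r) (BLeft eps) s); last 3 first.
- exact: integrable_radial.
- by rewrite bnd_simp.
- by rewrite bnd_simp.
by rewrite subKr.
Qed.

Lemma int_itv_bounds (f : R -> R) r s (a b : R) : r <= s ->
  leb.-integrable `]r, s] (EFin \o f) -> (forall t, r < t <= s -> a <= f t <= b) ->
  a * (s - r) <= \int[leb]_(t in `]r, s]) f t <= b * (s - r).
Proof.
move=> rs intf fab.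
have cstE (k : R) : \int[leb]_(t in `]r, s]) k = k * (s - r).
  rewrite Rintegral_cst// /= lebesgue_measure_itv/= lte_fin.
  by case: ltP rs => //= rs' rs; rewrite -[r](_ : s = _) ?subrr//; apply/le_anti/andP.
have intc (k : R) : leb.-integrable `]r, s] (EFin \o cst k).
  apply: measurable_bounded_integrable => //.
    by rewrite /= lebesgue_measure_itv/=; case: ifP => _ //; exact: ltry.
  by exists `|k|; split; [exact: num_real|move=> y ky t _; exact: ltW].
rewrite -!cstE; apply/andP; split.
- apply: (le_Rintegral _ (intc a) intf); first exact: measurable_itv.
  by move=> t; rewrite /= in_itv/= => /fab/andP[].
- apply: (le_Rintegral _ intf (intc b)); first exact: measurable_itv.
  by move=> t; rewrite /= in_itv/= => /fab/andP[].
Qed.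

Lemma integrable_radial_oc r s : 0 < r -> s < eps -> leb.-integrable `]r, s] (EFin \o g).
Proof.
move=> r0 seps; apply: integrableS (integrable_radial r0) => //.
by apply: subset_itvl; rewrite bnd_simp.
Qed.

Lemma radial_integral_ge0 r : 0 < r -> 0 <= h r.
Proof.
move=> r0; apply: Rintegral_ge0 => s /=; rewrite in_itv/= => /andP[rs _].
by apply: radial_integrand_ge0; lra.
Qed.

(** Put X(r) = r^(2-n) e^(J(r)) and let q be the exponential in the hypothesis, which bounds the
    growth of e^J from r to 2r. The shell from r to 2r contributes at most q X(r), and X(2r) <=
    (q/2) X(r) because n - 2 >= 1. Hence a bound h <= 4 X at 2r gives h(r) <= q X + 4 (q/2) X = 3 q
    X at r, and this is at most 4 X exactly when q <= 4/3. *)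
Lemma radial_integral_bound r : expR (K * (2 ^+ n - 1)) <= 4 / 3 -> 0 < r -> r < eps ->
  h r <= 4 * (r ^- (n - 2) * expR (J r)).
Proof.
move=> K43; set q := expR _ in K43.
have rn2 (x : R) : 0 < x -> x ^- n.-1 * x = x ^- (n - 2).
  move=> x0; rewrite (_ : n.-1 = (n - 2).+1); last by case: n n3 => // -[|[|m]]//= _; rewrite subn2.
  by rewrite exprS invfM mulrC mulrA mulfV ?mul1r ?lt0r_neq0.
have Jq x s : 0 < x -> x <= s -> s <= 2 * x -> s < eps -> expR (J s) <= q * expR (J x).
  move=> x0 xs s2x seps; rewrite -expRD ler_expR addrC.
  apply: le_trans (J_le x0 xs seps) _; rewrite lerD2l ler_wpM2l//.
  rewrite mulrBl divff ?lerB ?expf_neq0 ?lt0r_neq0//.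
  rewrite ler_pdivrMr ?exprn_gt0// -exprMn.
  by apply: lerXn2r; rewrite ?nnegrE; lra.
have gq x s : 0 < x -> x <= s -> s <= 2 * x -> s < eps ->
    g s <= q * (x ^- n.-1 * expR (J x)).
  move=> x0 xs s2x seps; rewrite mulrCA; apply: ler_pM; rewrite ?expR_ge0//.
  - by rewrite invr_ge0 exprn_ge0//; lra.
  - rewrite lef_pV2 ?posrE ?exprn_gt0//; last lra.
    by apply: lerXn2r; rewrite ?nnegrE; lra.
  - exact: Jq.
have q0 : 0 <= q by exact: expR_ge0.
move=> r0 reps.
(* The induction is on the number of dyadic shells between [r] and [eps]; the case [m = 0]
   contradicts [r < eps]. *)
have [m] : exists m : nat, eps <= 2 ^+ m * r.
  exists (Num.bound (eps / r)); rewrite -ler_pdivrMr//.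
  apply: le_trans (ltW (archi_boundP _)) _; first by rewrite divr_ge0//; lra.
  by rewrite -natrX ler_nat ltnW// ltn_expl.
elim: m r r0 reps => [|m IH] r r0 reps; first by rewrite expr0; lra.
move=> em; have E0 : 0 <= r ^- (n - 2) * expR (J r).
  by rewrite mulr_ge0 ?expR_ge0// invr_ge0 exprn_ge0// ltW.
have [e2r|e2r] := leP eps (2 * r).
  set M := q * (r ^- n.-1 * expR (J r)).
  have M0 : 0 <= M.
    by rewrite mulr_ge0// mulr_ge0 ?expR_ge0// invr_ge0 exprn_ge0// ltW.
  have intM : leb.-integrable `]r, eps[ (EFin \o cst M).
    apply: measurable_bounded_integrable => //.
      by rewrite /= lebesgue_measure_itv/=; case: ifP => _ //; exact: ltry.
    by exists `|M|; split; [exact: num_real|move=> y ky t _; exact: ltW].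
  apply: (@le_trans _ _ (\int[leb]_(t in `]r, eps[) M)).
    apply: (le_Rintegral _ (integrable_radial r0) intM); first exact: measurable_itv.
    move=> t; rewrite /= in_itv/= => /andP[rt teps]; apply: gq => //; lra.
  rewrite Rintegral_cst//= lebesgue_measure_itv/= lte_fin reps/=.
  have Mr : M * r = q * (r ^- (n - 2) * expR (J r)) by rewrite /M -(rn2 r r0); ring.
  have : M * (eps - r) <= M * r by rewrite ler_wpM2l//; lra.
  by rewrite Mr; nra.
have r20 : 0 < 2 * r by lra.
have := IH _ r20 e2r; rewrite mulrA -exprSr => /(_ em) h2r.
have le_r2r : r <= 2 * r by lra.
have := radial_integralB r0 le_r2r e2r.
have /(_ _)/andP[|_ le1] := @int_itv_bounds g r (2 * r) 0 (q * (r ^- n.-1 * expR (J r)))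
  le_r2r (integrable_radial_oc r0 e2r).
  by move=> t /andP[rt ts]; rewrite radial_integrand_ge0 ?gq//; lra.
have E2 : (2 * r) ^- (n - 2) * expR (J (2 * r)) <= q / 2 * (r ^- (n - 2) * expR (J r)).
  have -> : q / 2 * (r ^- (n - 2) * expR (J r)) = (2^-1 * r ^- (n - 2)) * (q * expR (J r)).
    by ring.
  apply: ler_pM; rewrite ?expR_ge0 ?Jq//.
    by rewrite invr_ge0 exprn_ge0// ltW.
  rewrite exprMn invfM ler_wpM2r ?invr_ge0 ?exprn_ge0 ?(ltW r0)//.
  rewrite lef_pV2 ?posrE ?exprn_gt0// -[leLHS]expr1.
  by rewrite ler_weXn2l ?ler1n// subn_gt0.
have qr : q * (r ^- n.-1 * expR (J r)) * (2 * r - r) = q * (r ^- (n - 2) * expR (J r)).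
  by rewrite -(rn2 r r0); ring.
rewrite qr in le1; move=> hE; nra.
Qed.

(** From (1 - x) e^x <= 1, since (1 + 2x) (1 - x) >= 1 on this range. *)
Lemma expR_le1D2x (x : R) : 0 <= x -> x <= 2^-1 -> expR x <= 1 + 2 * x.
Proof.
move=> x0 x2; have := expR_ge1Dx (- x); rewrite expRN => xE.
have eN : (1 - x) * expR x <= 1.
  by rewrite -(ler_pdivlMr _ _ (expR_gt0 x)) div1r.
by have := expR_gt0 x; nra.
Qed.

Lemma bernoulli_le m (y : R) : 0 <= y -> y <= 1 -> 1 - m%:R * (1 - y) <= y ^+ m.
Proof.
move=> y0 y1; elim: m => [|m IH]; first by rewrite expr0 mul0r subr0.
have : 0 <= m%:R * (1 - y) ^+ 2 by rewrite mulr_ge0 ?ler0n ?sqr_ge0.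
have : y * (1 - m%:R * (1 - y)) <= y ^+ m.+1 by rewrite exprS ler_wpM2l.
by rewrite -natr1; nra.
Qed.

(** The slope of [h] at [r] is - g(r) = - r (r^-n e^(J(r))), which is also that of the quadratic
    term, as (s^2 - r^2) / 2 = r (s - r) + (s - r)^2 / 2. The error is quadratic because [g]
    inherits a Lipschitz bound at [r] from [J]. [C] and [d] may depend on [r]. *)
Lemma radial_integral_taylor r : 0 < r -> r < eps -> exists C d : R, [/\ 0 < C, 0 < d &
  forall s, r <= s -> s <= r + d ->
    `|h s - h r + r ^- n * expR (J r) * ((s ^+ 2 - r ^+ 2) / 2)| <= C * (s - r) ^+ 2].
Proof.
move=> r0 reps; have [L L0 JL] := J_lip_linear r0.
set G := g r; have G0 : 0 < G by rewrite mulr_gt0 ?expR_gt0// invr_gt0 exprn_gt0.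
(* The first term accounts for the exponential factor of [g t / G], the second, through Bernoulli's
   inequality, for the power [(r / t) ^+ n.-1]. *)
pose L' := 2 * L + n.-1%:R / r.
have L'0 : 0 <= L' by rewrite /L' addr_ge0// ?mulr_ge0 ?invr_ge0 ?ler0n; lra.
(* The three bounds keep [t] below [2 * r] for [JL], below [eps], and the exponent [L * (t - r)]
   below 1/2 for [expR_le1D2x]. *)
pose d := Num.min (r / 2) (Num.min ((eps - r) / 2) (2^-1 / L)).
have d0 : 0 < d by rewrite /d !lt_min !divr_gt0 ?invr_gt0//; lra.
have dr : d <= r / 2 by rewrite /d ge_min lexx.
have de : d <= (eps - r) / 2 by rewrite /d !ge_min lexx orbT.
have dL : d * L <= 2^-1 by rewrite -ler_pdivlMr// /d !ge_min lexx !orbT.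
have g_near t : r <= t -> t <= r + d -> `|g t - G| <= G * L' * (t - r).
  move=> rt td; have t0 : 0 < t by lra.
  have gE : g t = G * ((r / t) ^+ n.-1 * expR (J t - J r)).
    rewrite /G /g expRB expr_div_n; field.
    by rewrite !expf_neq0 ?lt0r_neq0// expR_gt0.
  have Jt : `|J t - J r| <= L * (t - r) by apply: JL; lra.
  have Lt : L * (t - r) <= 2^-1 by nra.
  have tr0 : 0 <= L * (t - r) by nra.
  have eub : expR (J t - J r) <= 1 + 2 * L * (t - r).
    apply: (@le_trans _ _ (expR (L * (t - r)))).
      by rewrite ler_expR (le_trans (ler_norm _)).
    by rewrite -mulrA; exact: expR_le1D2x.
  have elb : 1 - L * (t - r) <= expR (J t - J r).
    apply: le_trans (expR_ge1Dx _); rewrite lerD2l.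
    by move: Jt; rewrite ler_norml => /andP[].
  have rt0 : 0 <= r / t by rewrite divr_ge0// ltW.
  have rt1 : r / t <= 1 by rewrite ler_pdivrMr// mul1r.
  have p1 : (r / t) ^+ n.-1 <= 1 by exact: exprn_ile1.
  have p0 : 0 <= (r / t) ^+ n.-1 by exact: exprn_ge0.
  have plb : 1 - n.-1%:R / r * (t - r) <= (r / t) ^+ n.-1.
    apply: le_trans (bernoulli_le n.-1 rt0 rt1); rewrite lerD2l lerN2 -mulrA ler_wpM2l//.
    have -> : 1 - r / t = t^-1 * (t - r).
      by rewrite mulrBr mulVf ?lt0r_neq0// (mulrC t^-1).
    by apply: ler_wpM2r; rewrite ?subr_ge0// lef_pV2 ?posrE.
  have nr0 : 0 <= n.-1%:R / r * (t - r) by rewrite mulr_ge0 ?divr_ge0 ?ler0n ?subr_ge0// ltW.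
  rewrite gE -[X in _ - X]mulr1 -mulrBr normrM (gtr0_norm G0) -mulrA ler_pM2l//.
  rewrite ler_norml /L' mulrDl; set P := (r / t) ^+ n.-1 in p0 p1 plb *.
  set e := expR _ in eub elb *; have e0 : 0 <= e by exact: expR_ge0.
  apply/andP; split; nra.
have d20 : 0 < r + d by lra.
exists (G * L' + r ^- n * expR (J r) + 1), d; split => //.
  rewrite ltr_wpDl// addr_ge0// mulr_ge0 ?expR_ge0 ?(ltW G0)//.
  by rewrite invr_ge0 exprn_ge0// ltW.
move=> s rs sd; have seps : s < eps by lra.
have GE : G = r ^- n * expR (J r) * r.
  have -> : r ^- n = r ^- n.-1 / r.
    by rewrite -invfM -exprSr prednK// (leq_trans _ n3).
  by rewrite mulrAC divfK ?lt0r_neq0// mulrC.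
set k := r ^- n * expR (J r) in GE *.
have k0 : 0 <= k by rewrite mulr_ge0 ?expR_ge0// invr_ge0 exprn_ge0// ltW.
have sr0 : 0 <= s - r by lra.
have GL0 : 0 <= G * L' by rewrite mulr_ge0 // ltW.
have bnd t : r < t <= s -> G - G * L' * (s - r) <= g t <= G + G * L' * (s - r).
  move=> /andP[rt ts]; have := g_near t (ltW rt) ltac:(lra).
  have : G * L' * (t - r) <= G * L' * (s - r) by rewrite ler_wpM2l// lerB.
  by rewrite ler_norml; lra.
have := int_itv_bounds rs (integrable_radial_oc r0 seps) bnd.
rewrite -(radial_integralB r0 rs seps) => /andP[].
have s2 : 0 <= (s - r) ^+ 2 by exact: sqr_ge0.
have ks2 : 0 <= k * (s - r) ^+ 2 by exact: mulr_ge0.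
have kE : k * ((s ^+ 2 - r ^+ 2) / 2) = G * (s - r) + k * (s - r) ^+ 2 / 2.
  by rewrite GE; field.
rewrite kE; move: (G * L') => GL; clear -s2 ks2 => lb ub.
have lb' : G * (s - r) - GL * (s - r) ^+ 2 <= h r - h s.
  by apply: le_trans lb; rewrite le_eqVlt; apply/orP; left; apply/eqP; ring.
have ub' : h r - h s <= G * (s - r) + GL * (s - r) ^+ 2.
  by apply: le_trans ub _; rewrite le_eqVlt; apply/orP; left; apply/eqP; ring.
by rewrite ler_norml !mulrDl mul1r; apply/andP; split; lra.
Qed.

End radial_integral.

(** * Decay of omega and sigma from the Dini condition *)

Section modulus_theory.
Context (R : realType) (omega : R -> R).
Hypothesis homega : modulus omega.
Local Notation leb := (@lebesgue_measure R).
Let f r := omega r ^+ 2 / r.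

Lemma integrable_dini : leb.-integrable `]0, 1[ (EFin \o f).
Proof.
have [w0 w_ndec w_int _] := homega.
apply/integrableP; split.
  apply/measurable_EFinP; apply: measurable_funM.
    apply: measurable_funX => mD.
    apply: (measurability _ (@RGenCInfty.measurableE R)) => //.
    (* As [omega] is monotone on ]0, 1[, its superlevel sets there are intervals. *)
    move=> _ [_ [r ->] <-]; apply: is_interval_measurable => s t /=.
    rewrite !in_itv/= !andbT => -[/andP[s0 s1] ws] [/andP[t0 t1] wt] u /andP[su ut].
    rewrite !in_itv/= ?andbT; split; first by apply/andP; split; lra.
    by rewrite (le_trans ws)// w_ndec//; lra.
  apply: open_continuous_measurable_fun; first exact: interval_open.
  move=> r; rewrite inE/= in_itv/= => /andP[r0 _].
  by apply: cvgV; [exact: lt0r_neq0|exact: cvg_id].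
apply: le_lt_trans w_int; rewrite le_eqVlt; apply/orP; left; apply/eqP.
apply: eq_integral => r; rewrite inE/= in_itv/= => /andP[r0 _].
by rewrite /= ger0_norm// mulr_ge0 ?sqr_ge0// invr_ge0 ltW.
Qed.

(** On ]r, 2r[, an interval of length r, the Dini integrand is at least [omega r ^+ 2 / (2 * r)] by
    monotonicity. Decay of [sigma_mod] therefore forces decay of [omega]. *)
Lemma omega_sqr_le r : 0 < r -> r < 2^-1 -> omega r ^+ 2 <= 2 * sigma_mod omega (2 * r).
Proof.
move=> r0 r2; have [w0 w_ndec _ _] := homega.
have i2 : leb.-integrable `]0, (2 * r)[ (EFin \o f).
  apply: integrableS integrable_dini => //.
  by apply: subset_itvl; rewrite bnd_simp; lra.
have ir : leb.-integrable `]r, (2 * r)[ (EFin \o f).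
  apply: integrableS i2 => //.
  by apply: subset_itvr; rewrite bnd_simp; lra.
have -> : omega r ^+ 2 = 2 * (omega r ^+ 2 / (2 * r) * (2 * r - r)).
  by field; exact: lt0r_neq0.
rewrite ler_pM2l//.
have intM (k : R) : leb.-integrable `]r, (2 * r)[ (EFin \o cst k).
  apply: measurable_bounded_integrable => //.
    by rewrite /= lebesgue_measure_itv/=; case: ifP => _ //; exact: ltry.
  by exists `|k|; split; [exact: num_real|move=> y ky t _; exact: ltW].
apply: (@le_trans _ _ (\int[leb]_(s in `]r, (2 * r)[) f s)).
  have <- : \int[leb]_(s in `]r, (2 * r)[) (omega r ^+ 2 / (2 * r)) =
      omega r ^+ 2 / (2 * r) * (2 * r - r).
    by rewrite Rintegral_cst//= lebesgue_measure_itv/= lte_fin; case: ltP => //; lra.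
  apply: (le_Rintegral _ (intM _) ir); first exact: measurable_itv.
  move=> s; rewrite /= in_itv/= => /andP[rs s2r].
  have ws : omega r <= omega s by apply: w_ndec; lra.
  have wr : 0 < omega r by apply: w0; lra.
  apply: ler_pM; rewrite ?sqr_ge0 ?invr_ge0//; first lra.
    by rewrite lerXn2r ?nnegrE ?(ltW wr)// (le_trans (ltW wr)).
  by rewrite lef_pV2 ?posrE; lra.
rewrite /sigma_mod -/f; have := @Rintegral_itvB _ f (BRight 0) (BLeft (2 * r)) r i2.
rewrite !bnd_simp => <-; [|lra..].
rewrite gerBl Rintegral_ge0// => s; rewrite /= in_itv/= => /andP[s0 _].
by rewrite mulr_ge0 ?sqr_ge0// invr_ge0 ltW.
Qed.

(** Continuity of the integral in its upper end point. The integrand is extended by 0 outside ]0,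
    1[, because no hypothesis speaks of [omega] at the end points. *)
Lemma sigma_mod_cvg0 e : 0 < e -> exists2 d : R, 0 < d < 1 &
  forall r, 0 < r < d -> sigma_mod omega r <= e.
Proof.
move=> e0; pose f' := f \_ `]0, 1[.
have if' : leb.-integrable setT (EFin \o f').
  rewrite -restrict_EFin; apply/integrable_restrict => //=.
  by rewrite setTI; exact: integrable_dini.
have if'2 : leb.-integrable `[0, 1] (EFin \o f').
  by apply: integrableS if' => //; exact: measurable_itv.
have [d /= d0 Hd] := parameterized_integral_near_left ltr01 e0 if'2.
exists (Num.min d 2^-1).
  by rewrite lt_min gt_min d0 invr_gt0 ltr0n/= invf_lt1// ltr1n orbT.
move=> r /andP[r0]; rewrite lt_min => /andP[rd r2].
have Hr : `|parameterized_integral leb 0 r f'| < e.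
  by apply: Hd; rewrite /= ?sub0r ?normrN ?gtr0_norm ?ltW.
apply: le_trans (ltW Hr); apply: le_trans (ler_norm _).
rewrite /parameterized_integral -Rintegral_mkcondr (_ : _ `&` _ = `]0, r]%classic).
  rewrite -Rintegral_itv_bndo_bndc//.
  apply: integrableS integrable_dini => //.
  by apply: subset_itvl; rewrite bnd_simp; lra.
apply/seteqP; split => s /=; rewrite !in_itv/=.
  by move=> [/andP[_ ->] /andP[->]].
by move=> /andP[s0 sr]; split; apply/andP; split => //; lra.
Qed.

Lemma modulus_small e : 0 < e -> exists2 d : R, 0 < d < 1 &
  forall r, 0 < r < d -> omega r <= e /\ sigma_mod omega r <= e.
Proof.
(* With [omega_sqr_le] in view: [sigma_mod] at radius [2 * r] has to be at most [e ^+ 2 / 2], which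
   also explains [d2 / 2] below. *)
move=> e0; have e20 : 0 < e ^+ 2 / 2 by rewrite divr_gt0// exprn_gt0.
have [d1 /andP[d10 d11] H1] := sigma_mod_cvg0 e0.
have [d2 /andP[d20 d21] H2] := sigma_mod_cvg0 e20.
have [w0 _ _ _] := homega.
exists (Num.min d1 (d2 / 2)).
  by rewrite lt_min gt_min d10 d11 divr_gt0.
move=> r /andP[r0]; rewrite lt_min => /andP[rd1 rd2]; split; last by apply: H1; rewrite r0.
have wr : 0 < omega r by apply: w0; lra.
have r2 : r < 2^-1 by lra.
have := omega_sqr_le r0 r2; have := H2 (2 * r) ltac:(lra) => le1 le2.
have : omega r ^+ 2 <= e ^+ 2 by lra.
by rewrite ler_sqr ?nnegrE ?(ltW wr) ?(ltW e0).
Qed.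

End modulus_theory.

(** * The Lipschitz bound for I *)

Section I_fun_lipschitz.
Context (R : realType) (n : nat) (a : 'rV[R]_n -> 'M[R]_n) (b : 'rV[R]_n -> 'rV[R]_n)
  (eps W : R).
Local Notation mu := (@lebesgue_rV R n).
Local Notation O := (@punctured_ball R n eps).
Hypothesis n0 : (0 < n)%N.
Hypothesis W0 : 0 <= W.
Hypothesis ma : forall i j, rV_measurable_fun O (fun x => a x i j).
Hypothesis mb : forall k, rV_measurable_fun O (fun x => b x 0 k).
Hypothesis ha : forall x, O x -> forall i j, `|a x i j - (i == j)%:R| <= W.
Hypothesis hb : forall x, O x -> forall k, enorm x * `|b x 0 k| <= W.
Let F z := (\tr (a z) - n%:R * (dot (z *m a z) z / enorm z ^+ 2) + dot (b z) z)
    / enorm z ^+ n.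

(** The first summand comes from the quadratic form in the integrand of I, the second from the trace
    and the drift, each measured in units of [W]. *)
Definition lip_const : R := n%:R * n%:R ^+ 2 + 2 * n%:R.

(** For the identity matrix the trace term n and the term n |x|^2 / |x|^2 cancel, so only the
    deviations a_ij - delta_ij and the drift remain. *)
Lemma I_integrand_bound x : O x -> `|F x| <= W * lip_const / enorm x ^+ n.
Proof.
move=> Ox; have /andP[e0 _] := Ox; set e := enorm x in e0 *.
have en0 : 0 <= (e ^+ n)^-1 by rewrite invr_ge0 exprn_ge0// ltW.
rewrite normrM (ger0_norm en0); apply: ler_wpM2r => //.
have xe i : `|x 0 i| <= e by exact: enorm_coord.
have e2 : 0 < e ^+ 2 by exact: exprn_gt0.
pose S := \sum_i \sum_j (a x i j - (i == j)%:R) * (x 0 i * x 0 j).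
have dotE' : dot (x *m a x) x = S + e ^+ 2.
  rewrite sqr_enorm !dotE /S exchange_big/= -big_split/=; apply: eq_bigr => j _.
  rewrite mxE mulr_suml.
  under [in RHS]eq_bigr do rewrite mulrBl.
  have dE : \sum_i (i == j)%:R * (x 0 i * x 0 j) = x 0 j * x 0 j.
    by rewrite (bigD1 j)//= eqxx mul1r big1 ?addr0// => i /negPf ->; rewrite mul0r.
  rewrite sumrB dE subrK; apply: eq_bigr => i _; ring.
have trE : \tr (a x) = \sum_i (a x i i - (i == i)%:R) + n%:R.
  rewrite sumrB /mxtrace; under [X in _ - X]eq_bigr do rewrite eqxx.
  by rewrite sumr_const card_ord subrK.
have Sle : `|S| <= n%:R ^+ 2 * (W * e ^+ 2).
  rewrite /S (le_trans (ler_norm_sum _ _ _))//.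
  apply: (@le_trans _ _ (\sum_(i < n) n%:R * (W * e ^+ 2))); last first.
    by rewrite sumr_const card_ord -[leLHS]mulr_natl mulrA -expr2.
  apply: ler_sum => i _; rewrite (le_trans (ler_norm_sum _ _ _))//.
  apply: (@le_trans _ _ (\sum_(j < n) (W * e ^+ 2))); last first.
    by rewrite sumr_const card_ord -[leLHS]mulr_natl.
  apply: ler_sum => j _; rewrite normrM ler_pM//; first exact: ha.
  by rewrite normrM expr2 ler_pM.
rewrite trE dotE' mulrDl mulfV ?lt0r_neq0// mulrDr mulr1 opprD addrACA subrr addr0.
set T := \sum_i _; have Tle : `|T| <= n%:R * W.
  rewrite /T (le_trans (ler_norm_sum _ _ _))//.
  apply: (@le_trans _ _ (\sum_(i < n) W)); last first.
    by rewrite sumr_const card_ord -[leLHS]mulr_natl.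
  by apply: ler_sum => i _; exact: ha.
have Ble : `|dot (b x) x| <= n%:R * W.
  rewrite dotE (le_trans (ler_norm_sum _ _ _))//.
  apply: (@le_trans _ _ (\sum_(i < n) W)); last first.
    by rewrite sumr_const card_ord -[leLHS]mulr_natl.
  apply: ler_sum => i _; apply: le_trans (hb Ox i).
  by rewrite normrM mulrC ler_wpM2r.
have Ule : `|n%:R * (S / e ^+ 2)| <= n%:R * (n%:R ^+ 2 * W).
  rewrite normrM (ger0_norm (ler0n _ _)) ler_wpM2l ?ler0n//.
  rewrite normrM normfV (gtr0_norm e2) ler_pdivrMr//.
  by rewrite -mulrA.
apply: le_trans (ler_normD _ _) _.
have := ler_normB T (n%:R * (S / e ^+ 2)); rewrite /lip_const; lra.
Qed.

Lemma measurable_I_integrand : rV_measurable_fun O F.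
Proof.
have mcoord i : rV_measurable_fun O (fun z => z 0 i).
  by apply: continuous_measurable_cara; exact: (@continuous_rV_coord R n i).
have menorm : rV_measurable_fun O (@enorm R n).
  by apply: continuous_measurable_cara; exact: continuous_enorm.
have minv k : rV_measurable_fun O (fun z => (enorm z ^+ k)^-1).
  rewrite (_ : (fun z => _) = (fun z => (enorm z ^+ k) `^ (-1))).
    apply: (measurableT_comp (measurable_powR _)).
    exact: measurable_funX.
  by apply/funext => z; rewrite powR_inv1// exprn_ge0// enorm_ge0.
rewrite (_ : F = (fun z => (\sum_i a z i i -
  n%:R * ((\sum_j (\sum_i z 0 i * a z i j) * z 0 j) * (enorm z ^+ 2)^-1) +
  \sum_k b z 0 k * z 0 k) * (enorm z ^+ n)^-1)); last first.
  apply/funext => z; rewrite /F /mxtrace !dotE; congr ((_ - _ * (_ / _) + _) / _).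
  by apply: eq_bigr => j _; rewrite mxE.
apply: measurable_funM; last exact: minv.
apply: measurable_funD; last first.
  apply: (@measurable_sum _ _ R (O : set (rVT R n)) _ _ (fun k z => b z 0 k * z 0 k)) => k.
  by apply: measurable_funM; [exact: mb|exact: mcoord].
apply: measurable_funB.
  apply: (@measurable_sum _ _ R (O : set (rVT R n)) _ _ (fun i z => a z i i)) => i.
  exact: ma.
apply: measurable_funM; first exact: measurable_cst.
apply: measurable_funM; last exact: minv.
apply: (@measurable_sum _ _ R (O : set (rVT R n)) _ _
  (fun j z => (\sum_i z 0 i * a z i j) * z 0 j)) => j.
apply: measurable_funM; last exact: mcoord.
apply: (@measurable_sum _ _ R (O : set (rVT R n)) _ _ (fun i z => z 0 i * a z i j)) => i.
by apply: measurable_funM; [exact: mcoord|exact: ma].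
Qed.

(** The difference is an integral over the shell r < |z| <= s, where the integrand is at most
    [W * lip_const / r ^+ n]. The volume of the shell is [s ^+ n - r ^+ n] unit balls, and a unit
    ball has volume at most [sphere_area R n]. *)
Lemma I_fun_lip r s : 0 < r -> r <= s -> s < eps ->
  `|I_fun a b eps r - I_fun a b eps s| <= W * lip_const * ((s ^+ n - r ^+ n) / r ^+ n).
Proof.
move=> r0 rs seps.
have mA (x y : R) : measurable (annulus x y : set (rVT R n)) := @caratheodory_annulus _ _ _ _.
pose S := @cball R n s `\` cball r.
have mS : measurable (S : set (rVT R n)).
  apply: caratheodory_borel; apply: measurableD; exact: measurable_cball.
have SA : annulus r eps = S `|` annulus s eps.
  apply/seteqP; split => x; rewrite /annulus /S /cball/=.
    move=> /andP[rx xe]; have [xs|sx] := leP (enorm x) s; [left|right; rewrite xe].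
      by split => //; apply/negP; rewrite -ltNge.
    by [].
  move=> [[xs /negP]|/andP[sx ->]]; last by rewrite (le_lt_trans rs).
  by rewrite -ltNge => ->/=; exact: le_lt_trans seps.
have AO : annulus r eps `<=` O.
  by move=> x /= /andP[rx xe]; rewrite /O/= xe (lt_trans r0).
have C0 : 0 <= lip_const by rewrite /lip_const addr_ge0// !mulr_ge0 ?exprn_ge0 ?ler0n.
pose M := W * lip_const / r ^+ n.
have M0 : 0 <= M by rewrite mulr_ge0 ?mulr_ge0// invr_ge0 exprn_ge0// ltW.
have FM x : annulus r eps x -> `|F x| <= M.
  move=> Ax; apply: le_trans (I_integrand_bound (AO _ Ax)) _; rewrite /M.
  have /andP[rx _] := Ax; apply: ler_wpM2l; first exact: mulr_ge0.
  rewrite lef_pV2 ?posrE ?exprn_gt0 ?(lt_trans r0 rx)//.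
  by apply: lerXn2r; rewrite ?nnegrE ?(ltW r0) ?(ltW rx)// ltW ?(lt_trans r0 rx).
have intF : rV_integrable (annulus r eps) F.
  apply: (@integrable_bounded_support _ _ _ (annulus r eps) F M).
  - exact: mA.
  - exact: mA.
  - exact: annulus_lty.
  - exact: (measurable_funS (mA 0 eps) AO measurable_I_integrand).
  - exact: FM.
  - by [].
have intSF : rV_integrable S F.
  by apply: (integrableS (mA r eps) mS _ intF); rewrite SA; exact: subsetUl.
have E : rV_integral (annulus r eps) F - rV_integral (annulus s eps) F = rV_integral S F.
  rewrite SA /rV_integral Rintegral_setU.
  - by rewrite addrK.
  - exact: mS.
  - exact: mA.
  - by rewrite -SA; exact: intF.
  - rewrite disj_set2E; apply/eqP/seteqP; split => // x [[xs _]] /=.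
    by move=> /andP[sx _]; move: xs; rewrite /cball/= leNgt sx.
rewrite /I_fun -/F -mulrBr E normrM.
have muS : mu S = ((s ^+ n - r ^+ n) * ball_volume R n)%:E.
  rewrite /S measureD; [|exact: (caratheodory_borel (measurable_cball _))..|
    exact: lebesgue_rV_cball_lty].
  rewrite (_ : _ `&` _ = @cball R n r).
    rewrite [X in (X - _)%E](cball_volumeE _ (lt_le_trans r0 rs)).
    by rewrite [X in (_ - X)%E](cball_volumeE _ r0) -EFinB mulrBl.
  by apply/seteqP; split => x; [case|move=> xr; split => //; exact: le_trans xr rs].
have intle : `|rV_integral S F| <= M * ((s ^+ n - r ^+ n) * ball_volume R n).
  apply: le_trans (le_normr_Rintegral mS intSF) _.
  have <- : \int[mu]_(_ in S) M = M * ((s ^+ n - r ^+ n) * ball_volume R n).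
    rewrite (Rintegral_cst _ mS); congr (_ * _); exact: (congr1 fine muS).
  apply: (le_Rintegral mS).
  - exact: integrable_norm.
  - apply: (@integrable_bounded_support _ _ _ S (fun=> M) M).
    + exact: mS.
    + exact: mS.
    + by rewrite muS ltry.
    + exact: measurable_cst.
    + by move=> x _; rewrite ger0_norm.
    + by [].
  - by move=> x Sx; apply: FM; rewrite SA; left.
have V0 := ball_volume_ge0 R n.
have Sp0 : 0 <= (sphere_area R n)^-1 by rewrite invr_ge0 sphere_areaE mulr_ge0 ?ler0n.
have SV : (sphere_area R n)^-1 * ball_volume R n <= 1.
  (* For volume 0 the left-hand side is 0; otherwise the quotient is 1 / n. *)
  rewrite sphere_areaE; have [->|Vn0] := eqVneq (ball_volume R n) 0; first by rewrite mulr0 ler01.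
  by rewrite invfM mulfVK// invf_le1 ?ltr0n// ler1n.
rewrite (ger0_norm Sp0).
apply: le_trans (ler_wpM2l Sp0 intle) _.
have D0 : 0 <= M * (s ^+ n - r ^+ n).
  rewrite mulr_ge0// subr_ge0; apply: lerXn2r; rewrite ?nnegrE ?(ltW r0)//.
  exact: le_trans (ltW r0) rs.
have -> : (sphere_area R n)^-1 * (M * ((s ^+ n - r ^+ n) * ball_volume R n)) =
    (sphere_area R n)^-1 * ball_volume R n * (M * (s ^+ n - r ^+ n)) by ring.
apply: le_trans (ler_wpM2r D0 SV) _.
by rewrite mul1r /M le_eqVlt; apply/orP; left; apply/eqP; ring.
Qed.

End I_fun_lipschitz.

(** * Cutoffs and integration by parts *)

Section cutoffs.
Context (R : realType) (n : nat).
Implicit Types (x : 'rV[R]_n) (i j : 'I_n) (A d : R).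

Lemma has_grad_dot : has_grad (fun x => dot x x) (fun i x => 2 * x 0 i).
Proof.
have H : has_grad (fun x => \sum_(k < n) x 0 k * x 0 k)
    (fun i x => \sum_(k < n) ((k == i)%:R * x 0 k + x 0 k * (k == i)%:R)).
  by apply: has_grad_sum => k; apply: has_gradM; exact: has_grad_coord.
apply: (eq_has_grad H) => [x|i x]; first by rewrite dotE.
rewrite (bigD1 i)//= eqxx mul1r mulr1 big1 ?addr0; first by ring.
by move=> k /negPf ->; rewrite mul0r mulr0 addr0.
Qed.

(** The transition runs over A <= |x|^2 <= A + 3d. It is expressed through |x|^2 because that is a
    polynomial, while |x| is not differentiable at the origin. *)
Definition cutoff A d x : R := step ((dot x x - A) / d).
Definition dcutoff A d i x : R := step1 ((dot x x - A) / d) * (2 * x 0 i / d).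
Definition d2cutoff A d i j x : R :=
  step2 ((dot x x - A) / d) * (2 * x 0 j / d) * (2 * x 0 i / d) +
  step1 ((dot x x - A) / d) * (2 * (i == j)%:R / d).

Lemma has_grad_scaled_dot A d :
  has_grad (fun x => (dot x x - A) / d) (fun i x => 2 * x 0 i / d).
Proof.
apply: eq_has_grad (has_gradZ d^-1 (has_gradD has_grad_dot (has_grad_cst n (- A)))) _ _.
  by move=> x; rewrite mulrC.
by move=> i x; rewrite addr0 mulrC.
Qed.

Lemma has_grad_cutoff A d : has_grad (cutoff A d) (dcutoff A d).
Proof.
exact: (has_grad_comp (@is_derive_step R) (@continuous_step1 R) (has_grad_scaled_dot A d)).
Qed.

Lemma has_grad_dcutoff A d i : has_grad (dcutoff A d i) (d2cutoff A d i).
Proof.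
have H1 := has_grad_comp (@is_derive_step1 R) (@continuous_step2 R) (has_grad_scaled_dot A d).
apply: eq_has_grad (has_gradM H1 (has_gradZ (2 / d) (has_grad_coord R i))) _ _.
  by move=> x; rewrite /dcutoff; ring.
by move=> j x; rewrite /d2cutoff; ring.
Qed.

Lemma cutoff_le A d x : 0 < d -> dot x x <= A ->
  [/\ cutoff A d x = 0, forall i, dcutoff A d i x = 0 & forall i j, d2cutoff A d i j x = 0].
Proof.
move=> d0 xA; have t0 : (dot x x - A) / d <= 0 by rewrite ler_pdivrMr// mul0r subr_le0.
have [s0 s1 s2] := step_le0 t0; split => //.
- by move=> i; rewrite /dcutoff s1 mul0r.
- by move=> i j; rewrite /d2cutoff s1 s2 !mul0r addr0.
Qed.

Lemma cutoff_ge A d x : 0 < d -> A + 3 * d <= dot x x ->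
  [/\ cutoff A d x = 1, forall i, dcutoff A d i x = 0 & forall i j, d2cutoff A d i j x = 0].
Proof.
move=> d0 xA; have t0 : 3 <= (dot x x - A) / d by rewrite ler_pdivlMr// lerBrDl.
have [s0 s1 s2] := step_ge3 t0; split => //.
- by move=> i; rewrite /dcutoff s1 mul0r.
- by move=> i j; rewrite /d2cutoff s1 s2 !mul0r addr0.
Qed.

Lemma cutoff_bound A d x : `|cutoff A d x| <= 36.
Proof. by have [] := step_bound ((dot x x - A) / d). Qed.

Lemma dcutoff_bound A d i x (M : R) : 0 < d -> `|x 0 i| <= M -> `|dcutoff A d i x| <= 72 * M / d.
Proof.
move=> d0 xM; have [_ s1 _] := step_bound ((dot x x - A) / d).
rewrite normrM (_ : 72 * M / d = 36 * (2 * M / d)); last by ring.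
apply: ler_pM => //; rewrite !normrM normfV (gtr0_norm d0) (ger0_norm (ler0n _ 2)).
by rewrite ler_pM2r ?invr_gt0// ler_pM2l.
Qed.

(** The constant is 144 from the [step2] term plus 72 from the [step1] term, whose [1 / d] is
    absorbed into [1 / d ^+ 2] since [d <= 1]. *)
Lemma d2cutoff_bound A d i j x (M : R) : 0 < d -> d <= 1 -> 1 <= M ->
  `|x 0 i| <= M -> `|x 0 j| <= M -> `|d2cutoff A d i j x| <= 216 * M ^+ 2 / d ^+ 2.
Proof.
move=> d0 d1 M1 xi xj; have [_ s1 s2] := step_bound ((dot x x - A) / d).
have b k : `|x 0 k| <= M -> `|2 * x 0 k / d| <= 2 * M / d.
  move=> xk; rewrite !normrM normfV (gtr0_norm d0) (ger0_norm (ler0n _ 2)).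
  by rewrite ler_pM2r ?invr_gt0// ler_pM2l.
have dV : d^-1 <= (d ^+ 2)^-1.
  by rewrite lef_pV2 ?posrE ?exprn_gt0// expr2 ler_piMl// ltW.
have T1 : `|step2 ((dot x x - A) / d) * (2 * x 0 j / d) * (2 * x 0 i / d)| <=
    144 * M ^+ 2 / d ^+ 2.
  rewrite !normrM -!normrM.
  have -> : 144 * M ^+ 2 / d ^+ 2 = 36 * (2 * M / d) * (2 * M / d).
    by rewrite expr2 -(exprVn d 2) expr2; ring.
  rewrite normrM (normrM (step2 _)).
  apply: ler_pM; [exact: mulr_ge0|exact: normr_ge0| |exact: b].
  by apply: ler_pM => //; exact: b.
have T2 : `|step1 ((dot x x - A) / d) * (2 * (i == j)%:R / d)| <= 72 * M ^+ 2 / d ^+ 2.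
  rewrite normrM; apply: (@le_trans _ _ (36 * (2 / d))).
    apply: ler_pM => //; rewrite !normrM normfV (gtr0_norm d0) (ger0_norm (ler0n _ 2)).
    rewrite ler_pM2r ?invr_gt0// ger_pMr// normr_nat; by case: (i == j).
  have M2 : 1 <= M ^+ 2 by rewrite expr_ge1// (le_trans _ M1).
  have dd : 0 < (d ^+ 2)^-1 by rewrite invr_gt0 exprn_gt0.
  by nra.
by rewrite (le_trans (ler_normD _ _))//; lra.
Qed.

End cutoffs.

(** * Double integration by parts with a cutoff *)

Section core_identity.
Context (R : realType) (n : nat) (eps : R).
Local Notation mu := (@lebesgue_rV R n).
Local Notation O := (@punctured_ball R n eps).
Implicit Types (phi u w : 'rV[R]_n -> R).

Lemma measurable_punctured_ball : measurable (O : set (rVT R n)).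
Proof. exact: caratheodory_annulus. Qed.

Lemma closed_enorm_ge (r : R) : closed [set x : 'rV[R]_n | r <= enorm x].
Proof.
rewrite (_ : [set _ | _] = @enorm R n @^-1` `[r, +oo[).
  by apply: closed_comp => [x _|]; [exact: continuous_enorm|exact: interval_closed].
by apply/seteqP; split => x /=; rewrite in_itv/= andbT.
Qed.

Lemma C1_compact_support phi : C1_compact (eball eps) phi ->
  exists K, [/\ compact K, K `<=` eball eps & forall x, ~ K x -> phi x = 0].
Proof.
move=> [_ _ cK Ke]; exists (closure [set x | phi x != 0]); split => // x Kx.
by apply: contrapT => /eqP px; apply: Kx; exact: subset_closure.
Qed.

(** The support of [phi] may contain the origin. Removing |x| < eta leaves a compact subset of the
    punctured ball, and this one set serves for every factor [f] vanishing there. *)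
Lemma annular_support (phi : 'rV[R]_n -> R) eta : 0 < eta -> C1_compact (eball eps) phi ->
  exists K, [/\ compact K, K `<=` O & forall f x,
    (forall x, enorm x < eta -> f x = 0) -> ~ K x ->
    f x * phi x = 0 /\ forall i, f x * pderiv i phi x = 0].
Proof.
move=> eta0 C1p; have [K [cK Ke pK]] := C1_compact_support C1p.
exists (K `&` [set x | eta <= enorm x]); split.
- by apply: compact_closedI => //; exact: closed_enorm_ge.
- by move=> x [/Ke xe ex]; rewrite /O/= (lt_le_trans eta0).
- move=> f x f0 Kx; have [ex|ex] := ltP (enorm x) eta.
    by rewrite f0// mul0r; split => // i; rewrite mul0r.
  have K'x : ~ K x by move=> K'x; apply: Kx.
  split; first by rewrite pK ?mulr0.
  move=> i; rewrite (has_grad_outside i (C1_compact_has_grad C1p) _ pK K'x) ?mulr0//.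
  by apply: compact_closed => //; exact: norm_hausdorff.
Qed.

Lemma test_annular phi f df eta : 0 < eta -> C1_compact (eball eps) phi ->
  has_grad f df -> (forall x, enorm x < eta -> f x = 0) ->
  test O (fun x => f x * phi x) (fun i x => df i x * phi x + f x * pderiv i phi x).
Proof.
move=> eta0 C1p fdf f0; split.
  exact: (has_gradM fdf (C1_compact_has_grad C1p)).
have [K [cK KO fK]] := annular_support eta0 C1p.
by exists K; split => // x Kx; have [] := fK _ _ f0 Kx.
Qed.

Lemma annular_integrable phi (f : 'rV[R]_n -> R) u eta : 0 < eta -> C1_compact (eball eps) phi ->
  continuous f -> (forall x, enorm x < eta -> f x = 0) -> L1_loc O u ->
  rV_integrable O (fun x => u x * (f x * phi x)) /\
  forall i, rV_integrable O (fun x => u x * (f x * pderiv i phi x)).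
Proof.
move=> eta0 C1p cf f0 Lu; have [K [cK KO fK]] := annular_support eta0 C1p.
have gphi := C1_compact_has_grad C1p; have [_ _ cdphi] := gphi.
have cphi := has_grad_continuous gphi.
split=> [|i].
  apply: (L1_loc_test measurable_punctured_ball cK KO Lu).
    by move=> x; exact: (continuousM (cf x) (cphi x)).
  by move=> x /(fK _ _ f0)[].
apply: (L1_loc_test measurable_punctured_ball cK KO Lu).
  by move=> x; exact: (continuousM (cf x) (cdphi i x)).
by move=> x /(fK _ _ f0)[].
Qed.

(** With test function [chi phi], the first integration by parts turns the left-hand side into - int
    w (d_i chi) phi; with test function [(d_i chi) phi], the second moves the remaining derivative
    off [u]. As test functions are C^1, [chi] has to be C^2. The identity is used from left to right
    for [Z], and from right to left for the middle term of the splitting. *)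
Lemma core_identity phi chi dchi d2chi u w (w2 : 'rV[R]_n -> R) i eta : 0 < eta ->
  C1_compact (eball eps) phi -> has_grad chi dchi -> has_grad (dchi i) d2chi ->
  (forall x, enorm x < eta -> chi x = 0) -> (forall x, enorm x < eta -> dchi i x = 0) ->
  weak_grad O i u w -> weak_grad O i w w2 ->
  rV_integral O (fun x => w2 x * (chi x * phi x) + w x * (chi x * pderiv i phi x)) =
  rV_integral O (fun x => u x * (d2chi i x * phi x + dchi i x * pderiv i phi x)).
Proof.
move=> eta0 C1p gchi gdchi chi0 dchi0 uw ww2.
have mO := measurable_punctured_ball.
have t1 := test_annular eta0 C1p gchi chi0.
have t2 := test_annular eta0 C1p gdchi dchi0.
have [Lu Lw _] := uw; have [_ Lw2 _] := ww2.
rewrite (weak_grad_ibp mO uw t2).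
have := weak_grad_ibp mO ww2 t1; rewrite /rV_integral.
under eq_Rintegral do rewrite mulrDr.
have [i1 _] := annular_integrable eta0 C1p (has_grad_continuous gdchi) dchi0 Lw.
have [_ /(_ i) i2] := annular_integrable eta0 C1p (has_grad_continuous gchi) chi0 Lw.
have [i3 _] := annular_integrable eta0 C1p (has_grad_continuous gchi) chi0 Lw2.
rewrite (RintegralD mO i1 i2) (RintegralD mO i3 i2) => E; lra.
Qed.

End core_identity.

Section pairing.
Context (R : realType) (n : nat) (eps : R).
Local Notation mu := (@lebesgue_rV R n).
Local Notation O := (@punctured_ball R n eps).
Implicit Types (phi u w : 'rV[R]_n -> R).

Lemma rV_integral_sum m (D : set 'rV[R]_n) (f : 'I_m -> 'rV[R]_n -> R) :
  measurable (D : set (rVT R n)) -> (forall i, rV_integrable D (f i)) ->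
  rV_integrable D (fun x => \sum_i f i x) /\
  rV_integral D (fun x => \sum_i f i x) = \sum_i rV_integral D (f i).
Proof.
move=> mD; elim: m f => [|m IH] f intf.
  have E0 : (fun x => \sum_(i < 0) f i x) = cst 0 by apply/funext => x; rewrite big_ord0.
  rewrite E0 big_ord0; split; last by rewrite /rV_integral Rintegral_cst ?mul0r.
  exact: integrable0.
have [IH1 IH2] := IH (fun i => f (lift ord0 i)) (fun i => intf _).
have -> : (fun x => \sum_(i < m.+1) f i x) =
    (fun x => f ord0 x + \sum_(i < m) f (lift ord0 i) x).
  by apply/funext => x; rewrite big_ord_recl.
rewrite big_ord_recl -IH2; split; last exact: (RintegralD mD (intf ord0) IH1).
exact: (integrableD mD (intf ord0) IH1).
Qed.

Lemma rV_dominated_cvg (D : set 'rV[R]_n) (f_ : nat -> 'rV[R]_n -> R) (f g : 'rV[R]_n -> R) :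
  measurable (D : set (rVT R n)) -> (forall m, rV_measurable_fun D (f_ m)) ->
  rV_measurable_fun D f -> (forall x, D x -> f_ m x @[m --> \oo] --> f x) ->
  rV_integrable D g -> (forall m x, D x -> `|f_ m x| <= g x) ->
  rV_integral D (f_ m) @[m --> \oo] --> rV_integral D f.
Proof.
move=> mD mf_ mf cf ig fg.
have [] := @dominated_convergence _ _ _ mu D mD (fun m x => (f_ m x)%:E)
  (fun x => (f x)%:E) (fun x => (g x)%:E).
- by move=> m; apply/measurable_EFinP; exact: mf_.
- by apply/measurable_EFinP; exact: mf.
- by apply: aeW => x Dx; apply: cvg_EFin; [exact: nearW|exact: cf].
- exact: ig.
- by apply: aeW => x m Dx; rewrite lee_fin; exact: fg.
move=> if_ _ cint.
have ifm : (\int[mu]_(x in D) (f x)%:E)%E \is a fin_num by exact: integrable_fin_num.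
rewrite /rV_integral /Rintegral; apply: fine_cvg.
by rewrite fineK.
Qed.

Definition closed_annulus (r s : R) : set 'rV[R]_n := [set x | r <= enorm x <= s].

Lemma compact_closed_annulus r s : compact (closed_annulus r s).
Proof.
rewrite (_ : closed_annulus r s = @cball R n s `&` [set x | r <= enorm x]).
  by apply: compact_closedI; [exact: compact_cball|exact: closed_enorm_ge].
rewrite predeqE => x; rewrite /closed_annulus /cball/=.
by split => [/andP[? ?]|[? ?]]; [split|apply/andP].
Qed.

Lemma closed_annulus_sub r s : 0 < r -> s < eps -> closed_annulus r s `<=` O.
Proof.
by move=> r0 se x /andP[rx xs]; rewrite /O/= (lt_le_trans r0 rx) (le_lt_trans xs se).
Qed.

Lemma W2p_weak_grad (p : R) u Du D2u : 1 <= p -> W2p_loc p O u Du D2u ->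
  [/\ forall i, weak_grad O i u (fun x => Du x 0 i),
      forall i j, weak_grad O i (fun x => Du x 0 j) (fun x => D2u x i j) &
      forall i j, L1_loc O (fun x => D2u x i j)].
Proof.
move=> p1 [Lu LDu LD2u wu wDu]; have mO := @measurable_punctured_ball R n eps.
have L f : Lp_loc p O f -> L1_loc O f := Lp_loc_L1_loc mO p1.
split => [i|i j|i j].
- by split; [exact: (L _ Lu)|exact: (L _ (LDu i))|exact: (wu i)].
- by split; [exact: (L _ (LDu j))|exact: (L _ (LD2u i j))|exact: (wDu i j)].
- exact: (L _ (LD2u i j)).
Qed.

End pairing.

(** * The truncated pairing of a solution *)

Section pairing_of_solution.
Context (R : realType) (n : nat) (eps p W : R).
Local Notation mu := (@lebesgue_rV R n).
Local Notation O := (@punctured_ball R n eps).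
Context (a : 'rV[R]_n -> 'M[R]_n) (b : 'rV[R]_n -> 'rV[R]_n).
Context (Z : 'rV[R]_n -> R) (DZ : 'rV[R]_n -> 'rV[R]_n) (D2Z : 'rV[R]_n -> 'M[R]_n).
Hypothesis p1 : 1 <= p.
Hypothesis W0 : 0 <= W.
Hypothesis ma : forall i j, rV_measurable_fun O (fun x => a x i j).
Hypothesis mb : forall k, rV_measurable_fun O (fun x => b x 0 k).
Hypothesis ha : forall x, O x -> forall i j, `|a x i j - (i == j)%:R| <= W.
Hypothesis hb : forall x, O x -> forall k, enorm x * `|b x 0 k| <= W.
Hypothesis solZ : strong_solution a b p eps Z DZ D2Z.
Variable phi : 'rV[R]_n -> R.
Hypothesis C1phi : C1_compact (eball eps) phi.
Local Notation G := (pairing_integrand a b DZ D2Z phi).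

Lemma rV_measurable_sum (D : set 'rV[R]_n) m (f : 'I_m -> 'rV[R]_n -> R) :
  (forall i, rV_measurable_fun D (f i)) -> rV_measurable_fun D (fun x => \sum_i f i x).
Proof. by move=> mf; apply: (@measurable_sum _ _ R (D : set (rVT R n)) _ _ f). Qed.

Let gphi := C1_compact_has_grad C1phi.

Let mphi D : rV_measurable_fun D phi.
Proof. exact: (continuous_measurable_cara (has_grad_continuous gphi)). Qed.

Let mdphi i D : rV_measurable_fun D (pderiv i phi).
Proof. by have [_ _ c] := gphi; exact: (continuous_measurable_cara (c i)). Qed.

Lemma measurable_pairing : rV_measurable_fun O G.
Proof.
have [[_ /(_ _)LD /(_ _ _)LD2 _ _] _] := solZ.
apply: measurable_funD; [apply: measurable_funB|].
- apply: rV_measurable_sum => i; apply: rV_measurable_sum => j.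
  apply: measurable_funM; last exact: mphi.
  apply: measurable_funM; last exact: (LD2 i j).1.
  by apply: measurable_funB; [exact: ma|exact: measurable_cst].
- apply: rV_measurable_sum => i.
  by apply: measurable_funM; [exact: (LD i).1|exact: mdphi].
- apply: rV_measurable_sum => k; apply: measurable_funM; last exact: mphi.
  by apply: measurable_funM; [exact: mb|exact: (LD k).1].
Qed.

Lemma pairing_integrable eta : 0 < eta -> rV_integrable (annulus eta eps) G.
Proof.
move=> eta0; have mO := @measurable_punctured_ball R n eps.
have mD : measurable (annulus eta eps : set (rVT R n)) := @caratheodory_annulus _ _ _ _.
have DO : annulus eta eps `<=` O.
  by move=> x /= /andP[ex xe]; rewrite /O/= xe (lt_trans eta0).
have mS (f : 'rV[R]_n -> R) : rV_measurable_fun O f -> rV_measurable_fun (annulus eta eps) f.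
  exact: (measurable_funS mO DO).
have [_ wD LD2] := W2p_weak_grad p1 solZ.1.
have LD k : L1_loc O (fun x => DZ x 0 k) by have [] := wD k k.
have [K [cK KO fK]] := annular_support eta0 C1phi.
have [phiK dphiK] : (forall x, annulus eta eps x -> ~ K x -> phi x = 0) /\
    (forall i x, annulus eta eps x -> ~ K x -> pderiv i phi x = 0).
  have H x : annulus eta eps x -> ~ K x -> phi x = 0 /\ forall i, pderiv i phi x = 0.
    (* The indicator of |x| >= eta is an admissible factor in [annular_support] and equals 1 on the
       annulus, which isolates [phi] and its derivatives. *)
    move=> /andP[ex _] Kx; pose f (x : 'rV[R]_n) : R := (eta <= enorm x)%R%:R.
    have f0 y : enorm y < eta -> f y = 0 by move=> ye; rewrite /f leNgt ye.
    have := fK f x f0 Kx; rewrite /f (ltW ex) mul1r => -[-> H]; split => // i.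
    by have := H i; rewrite mul1r.
  by split => [x Ax Kx|i x Ax Kx]; have [] := H x Ax Kx.
have [_ _ cdphi] := gphi.
have [M M0 phiM] := compact_continuous_bounded cK (has_grad_continuous gphi).
have phiM' x : annulus eta eps x -> `|phi x| <= M.
  move=> Ax; have [/phiM//|Kx] := pselect (K x); by rewrite phiK// normr0 ltW.
have iG1 i j : rV_integrable (annulus eta eps)
    (fun x => (a x i j - (i == j)%:R) * D2Z x i j * phi x).
  (* The coefficient, bounded and measurable but not continuous, is grouped with [phi], so that
     local integrability of [D2Z] suffices. *)
  have := @L1_loc_integrable R n O (annulus eta eps) K (fun x => D2Z x i j)
    (fun x => (a x i j - (i == j)%:R) * phi x) (W * M) mO mD DO cK KO (LD2 i j).
  have -> : (fun x => D2Z x i j * ((a x i j - (i == j)%:R) * phi x)) =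
    (fun x => (a x i j - (i == j)%:R) * D2Z x i j * phi x) by apply/funext => x; ring.
  apply.
  - apply: measurable_funM; last exact: mphi.
    by apply: measurable_funB; [exact: mS|exact: measurable_cst].
  - move=> x Ax; rewrite normrM; apply: ler_pM => //; last exact: phiM'.
    by apply: ha; exact: DO.
  - by move=> x Ax Kx; rewrite phiK ?mulr0.
have iG2 i : rV_integrable (annulus eta eps) (fun x => DZ x 0 i * pderiv i phi x).
  have [M1 M10 dphiM] := compact_continuous_bounded cK (cdphi i).
  apply: (@L1_loc_integrable R n O (annulus eta eps) K (fun x => DZ x 0 i) _ M1
     mO mD DO cK KO (LD i)).
  - exact: mdphi.
  - move=> x Ax; have [/dphiM//|Kx] := pselect (K x); by rewrite dphiK// normr0 ltW.
  - by move=> x Ax Kx; exact: dphiK.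
have iG3 k : rV_integrable (annulus eta eps) (fun x => b x 0 k * DZ x 0 k * phi x).
  have := @L1_loc_integrable R n O (annulus eta eps) K (fun x => DZ x 0 k)
    (fun x => b x 0 k * phi x) (W / eta * M) mO mD DO cK KO (LD k).
  have -> : (fun x => DZ x 0 k * (b x 0 k * phi x)) =
    (fun x => b x 0 k * DZ x 0 k * phi x) by apply/funext => x; ring.
  apply.
  - by apply: measurable_funM; [exact: mS|exact: mphi].
  - move=> x Ax; rewrite normrM; apply: ler_pM => //; last exact: phiM'.
    rewrite ler_pdivlMr//; apply: le_trans (hb (DO _ Ax) k).
    by rewrite mulrC ler_wpM2r// ltW//; have /andP[] := Ax.
  - by move=> x Ax Kx; rewrite phiK ?mulr0.
have [S1 _] := rV_integral_sum mD (fun i => (rV_integral_sum mD (iG1 i)).1).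
have [S2 _] := rV_integral_sum mD iG2.
have [S3 _] := rV_integral_sum mD iG3.
exact: (integrableD mD (integrableB mD S1 S2) S3).
Qed.

(** By [solZ] the terms with a_ij and b_k cancel almost everywhere, so the integrand of the pairing
    is - sum_i (d_i d_i Z phi + d_i Z d_i phi), and each summand is a case of [core_identity]. *)
Lemma truncated_pairing chi dchi d2chi eta : 0 < eta ->
  has_grad chi dchi -> (forall i, has_grad (dchi i) (d2chi i)) ->
  (forall x, enorm x < eta -> chi x = 0) ->
  (forall i x, enorm x < eta -> dchi i x = 0) ->
  rV_integral O (fun x => chi x * G x) = - \sum_i rV_integral O
    (fun x => Z x * (d2chi i i x * phi x + dchi i x * pderiv i phi x)).
Proof.
move=> eta0 gchi gdchi chi0 dchi0; have mO := @measurable_punctured_ball R n eps.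
have [wZ wD LD2] := W2p_weak_grad p1 solZ.1.
have LD k : L1_loc O (fun x => DZ x 0 k) by have [] := wD k k.
pose f i x := D2Z x i i * (chi x * phi x) + DZ x 0 i * (chi x * pderiv i phi x).
have intf i : rV_integrable O (f i).
  have [i1 _] := annular_integrable eta0 C1phi (has_grad_continuous gchi) chi0 (LD2 i i).
  have [_ i2] := annular_integrable eta0 C1phi (has_grad_continuous gchi) chi0 (LD i).
  exact: (integrableD mO i1 (i2 i)).
have [iS SE] := rV_integral_sum mO intf.
have -> : rV_integral O (fun x => chi x * G x) = rV_integral O (fun x => -1 * \sum_i f i x).
  rewrite /rV_integral /Rintegral; congr fine; apply: ae_eq_integral.
  - exact: mO.
  - apply/measurable_EFinP; apply: measurable_funM; last exact: measurable_pairing.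
    exact: (continuous_measurable_cara (has_grad_continuous gchi)).
  - have /integrableP[+ _] := iS => /measurable_EFinP mS.
    by apply/measurable_EFinP; apply: measurable_funM; [exact: measurable_cst|exact: mS].
  - have [_ [N [mN N0 sN]]] := solZ; exists N; split; [exact: mN|exact: N0|].
    apply: subset_trans sN; apply: subsetC => x Lx Ox; congr EFin.
    have {Lx} := Lx Ox; rewrite /L_op /pairing_integrand => L0.
    have S1 : \sum_i \sum_j (a x i j - (i == j)%:R) * D2Z x i j * phi x =
        phi x * (\sum_i \sum_j a x i j * D2Z x i j - \sum_i D2Z x i i).
      rewrite -sumrB mulr_sumr; apply: eq_bigr => i _.
      rewrite -mulr_suml mulrC; congr (_ * _).
      under eq_bigr do rewrite mulrBl.
      rewrite sumrB; congr (_ - _); rewrite (bigD1 i)//= eqxx mul1r big1 ?addr0//.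
      by move=> j ij; rewrite eq_sym (negPf ij) mul0r.
    have S3 : \sum_k b x 0 k * DZ x 0 k * phi x = phi x * \sum_k b x 0 k * DZ x 0 k.
      by rewrite mulrC mulr_suml.
    rewrite S1 S3 /f big_split/=.
    have -> : \sum_i D2Z x i i * (chi x * phi x) = chi x * phi x * \sum_i D2Z x i i.
      by rewrite mulr_sumr; apply: eq_bigr => i _; rewrite mulrC.
    have -> : \sum_i DZ x 0 i * (chi x * pderiv i phi x) =
        chi x * \sum_i DZ x 0 i * pderiv i phi x.
      by rewrite mulr_sumr; apply: eq_bigr => i _; rewrite mulrCA.
    have -> : \sum_i \sum_j a x i j * D2Z x i j = - \sum_k b x 0 k * DZ x 0 k.
      by apply/eqP; rewrite -addr_eq0 L0.
    ring.
rewrite /rV_integral (RintegralZl _ mO iS) mulN1r; congr (- _).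
rewrite -/(rV_integral _ _) SE; apply: eq_bigr => i _.
exact: (core_identity eta0 C1phi gchi (gdchi i) chi0 (dchi0 i) (wZ i) (wD i i)).
Qed.

End pairing_of_solution.

(** * The pairing near the singularity *)

Section quadratic_part.
Context (R : realType) (n : nat) (eps : R).
Local Notation mu := (@lebesgue_rV R n).
Local Notation O := (@punctured_ball R n eps).
Implicit Types (phi : 'rV[R]_n -> R).

Lemma C1_compact_out phi x : C1_compact (eball eps) phi -> eps <= enorm x ->
  phi x = 0 /\ forall i, pderiv i phi x = 0.
Proof.
move=> C1p ex; have [K [cK Ke pK]] := C1_compact_support C1p.
have Kx : ~ K x by move=> /Ke; rewrite /eball/= ltNge ex.
split=> [|i]; first exact: pK.
apply: (has_grad_outside i (C1_compact_has_grad C1p) _ pK Kx).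
by apply: compact_closed => //; exact: norm_hausdorff.
Qed.

Lemma has_grad_quadratic (h0 kap A : R) :
  has_grad (fun x : 'rV[R]_n => h0 - kap * ((dot x x - A) / 2)) (fun i x => - kap * x 0 i).
Proof.
apply: (eq_has_grad (has_gradD (has_grad_cst n h0)
  (has_gradZ (- kap) (has_grad_scaled_dot n A 2)))) => [x|i x]; first by rewrite mulNr.
by field.
Qed.

(** As d_i chi vanishes near 0 and [phi] near the outer sphere, the integral extends to the whole
    space. There [integral_pderiv0] is applied to H (d_i chi) phi, which eliminates [h0] and leaves
    kap int x_i (d_i chi) phi, and then to (1 - chi) phi x_i. *)
Lemma quadratic_part phi chi dchi d2chi i eta (h0 kap A : R) : 0 < eta ->
  C1_compact (eball eps) phi -> has_grad chi dchi -> has_grad (dchi i) d2chi ->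
  (forall x, enorm x < eta -> dchi i x = 0) ->
  rV_integral O (fun x => (h0 - kap * ((dot x x - A) / 2)) *
    (d2chi i x * phi x + dchi i x * pderiv i phi x)) =
  kap * rV_integral setT (fun x => (1 - chi x) * (phi x + x 0 i * pderiv i phi x)).
Proof.
move=> eta0 C1p gchi gdchi dchi0.
have gphi := C1_compact_has_grad C1p; have [_ _ cdphi] := gphi.
have cphi := has_grad_continuous gphi.
have cdchi := has_grad_continuous gdchi; have [_ _ /(_ i) cd2chi] := gdchi.
have cchi := has_grad_continuous gchi.
have gH := has_grad_quadratic h0 kap A.
have cH := has_grad_continuous gH.
set H := (fun x => h0 - _) in gH cH *.
have d2chi0 x : enorm x < eta -> d2chi i x = 0.
  move=> xe; apply: (has_grad_outside i gdchi (@closed_enorm_ge R n eta)).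
    by move=> y /negP; rewrite -ltNge; exact: dchi0.
  by apply/negP; rewrite -ltNge.
pose P x := d2chi i x * phi x + dchi i x * pderiv i phi x.
have out0 x : eps < enorm x -> phi x = 0 by move=> /ltW /(C1_compact_out C1p)[].
have out1 x : eps < enorm x -> pderiv i phi x = 0 by move=> /ltW /(C1_compact_out C1p)[].
have cP : continuous P.
  move=> x; exact: (continuousD (continuousM (cd2chi x) (cphi x))
    (continuousM (cdchi x) (cdphi i x))).
have cx : continuous (fun x : 'rV[R]_n => x 0 i) := @continuous_rV_coord R n i.
have -> : rV_integral O (fun x => H x * P x) = rV_integral setT (fun x => H x * P x).
  apply/esym; apply: rV_integral_support => // x _ Ox; rewrite /P.
  have [xe|xe] := ltP (enorm x) eta; first by rewrite d2chi0// dchi0// !mul0r addr0 mulr0.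
  have xeps : eps <= enorm x.
    by rewrite leNgt; apply/negP => xe'; apply: Ox; rewrite /O/= xe' (lt_le_trans eta0 xe).
  by have [-> ->] := C1_compact_out C1p xeps; rewrite !mulr0 addr0 mulr0.
have iHP : rV_integrable setT (fun x => H x * P x).
  apply: (@integrable_continuous_support _ _ _ eps).
    by move=> x; exact: (continuousM (cH x) (cP x)).
  by move=> x xe; rewrite /P out0// out1// !mulr0 addr0 mulr0.
have ixdp : rV_integrable setT (fun x => x 0 i * (dchi i x * phi x)).
  apply: (@integrable_continuous_support _ _ _ eps).
    by move=> x; exact: (continuousM (cx x) (continuousM (cdchi x) (cphi x))).
  by move=> x xe; rewrite out0// !mulr0.
have iE : rV_integrable setT (fun x => (1 - chi x) * (phi x + x 0 i * pderiv i phi x)).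
  apply: (@integrable_continuous_support _ _ _ eps).
    move=> x; apply: (continuousM (continuousB (@cst_continuous _ _ (1 : R) x) (cchi x))).
    exact: (continuousD (cphi x) (continuousM (cx x) (cdphi i x))).
  by move=> x xe; rewrite out0// out1// mulr0 addr0 mulr0.
have mT : measurable (setT : set (rVT R n)) by exact: measurableT.
have E1 : rV_integral setT (fun x => H x * P x) =
    kap * rV_integral setT (fun x => x 0 i * (dchi i x * phi x)).
  have := @integral_pderiv0 R n _ _ i eps (has_gradM gH (has_gradM gdchi gphi)).
  rewrite (_ : (fun x => _) = fun x => H x * P x - kap * (x 0 i * (dchi i x * phi x))).
    rewrite /rV_integral (RintegralB mT iHP (integrableZl mT kap ixdp)) => E.
    rewrite -(RintegralZl kap mT ixdp); apply/eqP; rewrite -subr_eq0; apply/eqP; apply: E.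
    by move=> x xe; rewrite out0// !mulr0.
  by apply/funext => x; rewrite /P; ring.
have E2 : rV_integral setT (fun x => x 0 i * (dchi i x * phi x)) =
    rV_integral setT (fun x => (1 - chi x) * (phi x + x 0 i * pderiv i phi x)).
  have g1 : has_grad (fun x => 1 + -1 * chi x) (fun j x => 0 + -1 * dchi j x).
    exact: (has_gradD (has_grad_cst n 1) (has_gradZ (-1) gchi)).
  have := @integral_pderiv0 R n _ _ i eps
    (has_gradM g1 (has_gradM gphi (has_grad_coord R i))).
  rewrite (_ : (fun x => _) = fun x =>
      (1 - chi x) * (phi x + x 0 i * pderiv i phi x) - x 0 i * (dchi i x * phi x)).
    rewrite /rV_integral (RintegralB mT iE ixdp) => E.
    apply/esym/eqP; rewrite -subr_eq0; apply/eqP; apply: E.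
    by move=> x xe; rewrite out0// mul0r mulr0.
  by apply/funext => x; rewrite eqxx mulr1n; ring.
by rewrite E1 E2.
Qed.

(** The shells shrink onto |x| = eta from outside, so every fixed point eventually leaves them.
    Hence the derivatives tend to 0 pointwise although their suprema blow up. *)
Lemma cutoff_cvg (eta : R) (x : 'rV[R]_n) : 0 < eta ->
  \forall m \near \oo, cutoff (eta ^+ 2) m.+1%:R^-1 x = ((eta : R) < enorm x)%R%:R /\
    forall i j, dcutoff (eta ^+ 2) m.+1%:R^-1 i x = 0 /\
      d2cutoff (eta ^+ 2) m.+1%:R^-1 i j x = 0.
Proof.
move=> eta0; have [xe|ex] := leP (enorm x) eta.
  apply: nearW => m; have m0 : 0 < m.+1%:R^-1 :> R by rewrite invr_gt0 ltr0n.
  have xA : dot x x <= eta ^+ 2.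
    by rewrite -sqr_enorm lerXn2r ?nnegrE ?enorm_ge0 ?(ltW eta0).
  by have [-> d0 d20] := cutoff_le m0 xA.
have xA : 0 < (dot x x - eta ^+ 2) / 3.
  by rewrite divr_gt0 ?ltr0n// subr_gt0 -sqr_enorm ltrXn2r ?nnegrE ?enorm_ge0 ?(ltW eta0).
have := @cvg_harmonic R; move/cvgrPdist_lt => /(_ _ xA); apply: filterS => m.
rewrite /harmonic/= sub0r normrN gtr0_norm ?invr_gt0// => hm.
have m0 : 0 < m.+1%:R^-1 :> R by rewrite invr_gt0 ltr0n.
have xA' : eta ^+ 2 + 3 * m.+1%:R^-1 <= dot x x.
  by move: hm; set k := m.+1%:R^-1 => hm; lra.
by have [-> d0 d20] := cutoff_ge m0 xA'.
Qed.

End quadratic_part.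

(** * The contribution of zeta H + v *)

Section perturbation.
Context (R : realType) (n : nat) (eps p eta kap e h0 M : R).
Local Notation mu := (@lebesgue_rV R n).
Local Notation O := (@punctured_ball R n eps).
Local Notation A := (@annulus R n eta (2 * eta)).
Local Notation vol := (fine (mu A)).

(** Integrability travels with the bound, so that bounds can be combined term by term. *)
Definition integral_le (D : set 'rV[R]_n) (f : 'rV[R]_n -> R) (b : R) :=
  rV_integrable D f /\ rV_integral D f <= b.

Lemma integral_leD D f g b c : measurable (D : set (rVT R n)) ->
  integral_le D f b -> integral_le D g c -> integral_le D (fun x => f x + g x) (b + c).
Proof.
move=> mD [intf fb] [intg gc]; split; first exact: (integrableD mD intf intg).
by rewrite /rV_integral (RintegralD mD intf intg) lerD.
Qed.

Lemma integral_leZ D f b c : measurable (D : set (rVT R n)) -> 0 <= c ->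
  integral_le D f b -> integral_le D (fun x => c * f x) (c * b).
Proof.
move=> mD c0 [intf fb]; split; first exact: (integrableZl mD c intf).
by rewrite /rV_integral (RintegralZl c mD intf) ler_wpM2l.
Qed.

Lemma integral_le_norm D f b : measurable (D : set (rVT R n)) ->
  rV_integrable D f -> (\int[mu]_(x in D) (`|f x|)%:E <= b%:E)%E ->
  integral_le D (fun x => `|f x|) b.
Proof.
move=> mD intf fb; have intn := integrable_norm intf; split; first exact: intn.
by rewrite -lee_fin /rV_integral /Rintegral fineK//; exact: (integrable_fin_num mD intn).
Qed.

Lemma integral_le_abs D f g b : measurable (D : set (rVT R n)) -> rV_integrable D f ->
  (forall x, D x -> `|f x| <= g x) -> integral_le D g b -> `|rV_integral D f| <= b.
Proof.
move=> mD intf fg [intg gb]; apply: le_trans (le_normr_Rintegral mD intf) _.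
by apply: le_trans gb; apply: (le_Rintegral mD (integrable_norm intf) intg).
Qed.

Hypothesis p1 : 1 <= p.
Hypothesis eta0 : 0 < eta.
Hypothesis eta1 : eta <= 1.
Hypothesis eta2 : 2 * eta < eps.
Hypothesis kap0 : 0 < kap.
Hypothesis e0 : 0 < e.
Hypothesis M0 : 0 < M.
Hypothesis h0_le : `|h0| <= 4 * eta ^+ 2 * kap.
Variables (z v : 'rV[R]_n -> R) (Dz Dv : 'rV[R]_n -> 'rV[R]_n) (D2z D2v : 'rV[R]_n -> 'M[R]_n).
Hypothesis Wz : W2p_loc p O z Dz D2z.
Hypothesis Wv : W2p_loc p O v Dv D2v.
Hypothesis Mz : (M2p p z Dz D2z eta <= e%:E)%E.
Hypothesis Mv : (M2p p v Dv D2v eta <= (eta ^+ 2 * kap * e)%:E)%E.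
Variable phi : 'rV[R]_n -> R.
Hypothesis C1phi : C1_compact (eball eps) phi.
Hypothesis phiM : forall x, `|phi x| <= M.
Hypothesis dphiM : forall i x, `|pderiv i phi x| <= M.
Variables (chi : 'rV[R]_n -> R) (dchi : 'I_n -> 'rV[R]_n -> R)
  (d2chi : 'I_n -> 'I_n -> 'rV[R]_n -> R) (i : 'I_n).
Hypothesis gchi : has_grad chi dchi.
Hypothesis gdchi : has_grad (dchi i) (d2chi i).
Hypothesis chi36 : forall x, `|chi x| <= 36.
Hypothesis chi0 : forall x, enorm x <= eta -> chi x = 0.
Hypothesis dchi0 : forall x, enorm x <= eta -> dchi i x = 0.
Hypothesis dchi_out : forall x, 2 * eta ^+ 2 < dot x x -> dchi i x = 0 /\ d2chi i i x = 0.

Let H (x : 'rV[R]_n) : R := h0 - kap * ((dot x x - eta ^+ 2) / 2).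
Let gH := has_grad_quadratic n h0 kap (eta ^+ 2).

Let mO := @measurable_punctured_ball R n eps.
Let mA : measurable (A : set (rVT R n)) := @caratheodory_annulus _ _ _ _.

Let AO : A `<=` closed_annulus eta (2 * eta).
Proof. by move=> x /andP[ex xe]; rewrite /closed_annulus/= (ltW ex) (ltW xe). Qed.

Let AO' : A `<=` O.
Proof. by apply: subset_trans AO _; exact: closed_annulus_sub. Qed.

Let int_A u : L1_loc O u -> rV_integrable A u.
Proof.
move=> [_ /(_ _ (@compact_closed_annulus R n eta (2 * eta)))].
move=> /(_ (@closed_annulus_sub R n eps _ _ eta0 eta2)).
apply: integrableS; [|exact: mA|exact: AO].
exact: (measurable_compact (@compact_closed_annulus R n eta (2 * eta))).
Qed.

Let meas_A u : L1_loc O u -> rV_measurable_fun A u.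
Proof. by move=> [mu_ _]; exact: (measurable_funS mO AO' mu_). Qed.

(** With these values [theta] falls from 1 to 0 while |x|^2 goes from 2 eta^2 to 3 eta^2: beyond the
    shell of [dchi], and inside |x| < 2 eta. *)
Let d := eta ^+ 2 / 3.
Let B := 2 * eta ^+ 2.
(* Multiplying [phi] by [theta] changes nothing where [dchi] lives, and confines the
   integral obtained by integrating by parts back to [eta < |x| < 2 eta]. *)
Let theta (x : 'rV[R]_n) : R := 1 + -1 * cutoff B d x.
Let psi (x : 'rV[R]_n) : R := theta x * phi x.

Let d0 : 0 < d. Proof. by rewrite /d divr_gt0// exprn_gt0. Qed.

Let gtheta : has_grad theta (fun j x => 0 + -1 * dcutoff B d j x).
Proof. exact: (has_gradD (has_grad_cst n 1) (has_gradZ (-1) (has_grad_cutoff n B d))). Qed.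

Let gpsi := has_gradM gtheta (C1_compact_has_grad C1phi).

Let dpsiE j x : pderiv j psi x = (0 + -1 * dcutoff B d j x) * phi x + theta x * pderiv j phi x.
Proof. by have [_ -> _] := gpsi. Qed.

Let C1psi : C1_compact (eball eps) psi.
Proof.
have [K [cK Ke pK]] := C1_compact_support C1phi.
by apply: (has_grad_C1_compact gpsi cK Ke) => x Kx; rewrite pK// mulr0.
Qed.

Let psi_in x : dot x x <= B -> psi x = phi x /\ forall j, pderiv j psi x = pderiv j phi x.
Proof.
move=> xB; have [c0 c1 _] := cutoff_le d0 xB.
split=> [|j]; first by rewrite /psi /theta c0 mulr0 addr0 mul1r.
by rewrite dpsiE /theta c0 c1 !mulr0 !addr0 mul0r add0r mul1r.
Qed.

Let psi_out x : 2 * eta <= enorm x -> psi x = 0 /\ forall j, pderiv j psi x = 0.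
Proof.
move=> ex; have xB : B + 3 * d <= dot x x.
  rewrite -sqr_enorm /B /d; apply: (@le_trans _ _ ((2 * eta) ^+ 2)).
    by have := sqr_ge0 eta; rewrite exprMn; lra.
  by apply: lerXn2r; rewrite ?nnegrE ?enorm_ge0// mulr_ge0// ltW.
have [c1 c2 _] := cutoff_ge d0 xB.
split=> [|j]; first by rewrite /psi /theta c1; ring.
by rewrite dpsiE /theta c1 c2; ring.
Qed.

Let psi_le x : `|psi x| <= 37 * M.
Proof.
rewrite /psi normrM; apply: ler_pM => //.
rewrite /theta (le_trans (ler_normD _ _))// normrM normrN normr1 mul1r.
by have := cutoff_bound B d x; lra.
Qed.

(** The constant is 432 + 37: the derivative of [theta] is at most 72 (2 eta) / d = 432 / eta,
    [theta] itself at most 37, and [M <= M / eta] because [eta <= 1]. *)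
Let dpsi_le j x : A x -> `|pderiv j psi x| <= 469 * M / eta.
Proof.
move=> /andP[_ xe].
have xj : `|x 0 j| <= 2 * eta by rewrite (le_trans (enorm_coord _ _))// ltW.
have c1 := dcutoff_bound B d0 xj.
have cE : 72 * (2 * eta) / d = 432 / eta by rewrite /d; field; rewrite lt0r_neq0.
have th : `|theta x| <= 37.
  rewrite /theta (le_trans (ler_normD _ _))// normrM normrN normr1 mul1r.
  by have := cutoff_bound B d x; lra.
rewrite dpsiE add0r mulN1r.
apply: le_trans (ler_normD _ _) _; rewrite !normrM normrN.
apply: (@le_trans _ _ (432 / eta * M + 37 * M)).
  by apply: lerD; apply: ler_pM => //; rewrite -cE.
have : M <= M / eta by rewrite ler_pdivlMr// ler_piMr// ltW.
rewrite (_ : 432 / eta * M = 432 * (M / eta)); last by ring.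
by rewrite (_ : 469 * M / eta = 469 * (M / eta)); [lra|ring].
Qed.

(** The functions [w] and [w2] that follow are d_i u and d_i d_i u by the product rule, with d_i H =
    - kap x_i. *)
Let u (x : 'rV[R]_n) : R := z x * H x + v x.
Let w (x : 'rV[R]_n) : R := Dz x 0 i * H x + z x * (- kap * x 0 i) + Dv x 0 i.
Let w2 (x : 'rV[R]_n) : R := (D2z x i i * H x + Dz x 0 i * (- kap * x 0 i)) +
  (Dz x 0 i * (- kap * x 0 i) + z x * (- kap)) + D2v x i i.

Let wu : weak_grad O i u w.
Proof.
have [wz _ _] := W2p_weak_grad p1 Wz; have [wv _ _] := W2p_weak_grad p1 Wv.
exact: (weak_gradD mO (weak_gradM mO (wz i) gH) (wv i)).
Qed.

Let ww : weak_grad O i w w2.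
Proof.
have [wz wDz _] := W2p_weak_grad p1 Wz; have [wv wDv _] := W2p_weak_grad p1 Wv.
have gx : has_grad (fun x : 'rV[R]_n => - kap * x 0 i) (fun j _ => - kap * (i == j)%:R).
  exact: (has_gradZ (- kap) (has_grad_coord R i)).
have := weak_gradD mO (weak_gradD mO (weak_gradM mO (wDz i i) gH) (weak_gradM mO (wz i) gx))
  (wDv i i).
by rewrite eqxx mulr1.
Qed.

(** After integrating by parts back, [chi] enters undifferentiated and only its bound 36 counts, so
    the estimate does not depend on the width of the shell. All terms then scale alike: on the
    annulus H and its derivatives have size eta^2 kap, eta kap, kap; those of [z] have L^1 norm at
    most 2 e vol / eta^k at order k, those of [v] an extra factor eta^2 kap; and a derivative of
    [psi] costs 1 / eta. *)
Lemma perturbation_bound :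
  `|rV_integral O (fun x => u x * (d2chi i i x * phi x + dchi i x * pderiv i phi x))| <=
  600 * 600 * M * kap * e * vol.
Proof.
have chi0' x : enorm x < eta -> chi x = 0 by move=> /ltW; exact: chi0.
have dchi0' x : enorm x < eta -> dchi i x = 0 by move=> /ltW; exact: dchi0.
have -> : rV_integral O (fun x => u x * (d2chi i i x * phi x + dchi i x * pderiv i phi x)) =
    rV_integral O (fun x => u x * (d2chi i i x * psi x + dchi i x * pderiv i psi x)).
  apply: eq_Rintegral => x _; congr (_ * _).
  have [/psi_in[-> ->]//|xB] := leP (dot x x) B.
  by have [-> ->] := dchi_out xB; rewrite !mul0r.
rewrite -(core_identity eta0 C1psi gchi gdchi chi0' dchi0' wu ww).
rewrite (@rV_integral_support R n O A); first last.
- move=> x Ox Ax; have [xe|xe] := leP (enorm x) eta.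
    by rewrite chi0// !mul0r !mulr0 addr0.
  have ex : 2 * eta <= enorm x.
    by rewrite leNgt; apply/negP => xe'; apply: Ax; rewrite /annulus/= xe xe'.
  by have [-> ->] := psi_out ex; rewrite !mulr0 addr0.
- exact: AO'.
have [Lu Lw _] := wu; have [_ Lw2 _] := ww.
have [i1 _] := annular_integrable eta0 C1psi (has_grad_continuous gchi) chi0' Lw2.
have [_ /(_ i) i2] := annular_integrable eta0 C1psi (has_grad_continuous gchi) chi0' Lw.
have intf := integrableS mO mA AO' (integrableD mO i1 i2).
have [wz wDz LD2z] := W2p_weak_grad p1 Wz; have [wv wDv LD2v] := W2p_weak_grad p1 Wv.
have [Lz _ _] := wz i; have [Lv _ _] := wv i.
have LDz j : L1_loc O (fun x => Dz x 0 j) by have [] := wDz j j.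
have LDv j : L1_loc O (fun x => Dv x 0 j) by have [] := wDv j j.
have Be0 : 0 < eta ^+ 2 * kap * e by rewrite !mulr_gt0// exprn_gt0.
have [z1 z2 z3] := M2p_L1_le p1 eta0 e0 (meas_A Lz) (fun j => meas_A (LDz j))
  (fun j k => meas_A (LD2z j k)) Mz.
have [_ v2 v3] := M2p_L1_le p1 eta0 Be0 (meas_A Lv) (fun j => meas_A (LDv j))
  (fun j k => meas_A (LD2v j k)) Mv.
have bz := integral_le_norm mA (int_A Lz) z1.
have bDz := integral_le_norm mA (int_A (LDz i)) (z2 i).
have bD2z := integral_le_norm mA (int_A (LD2z i i)) (z3 i i).
have bDv := integral_le_norm mA (int_A (LDv i)) (v2 i).
have bD2v := integral_le_norm mA (int_A (LD2v i i)) (v3 i i).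
have c1 : 0 <= 6 * eta ^+ 2 * kap by rewrite !mulr_ge0 ?exprn_ge0 ?ltW.
have c2 : 0 <= 4 * eta * kap by rewrite !mulr_ge0 ?ltW.
have c3 : 0 <= kap by exact: ltW.
have c4 : 0 <= 2 * eta * kap by rewrite !mulr_ge0 ?ltW.
have c5 : 0 <= 36 * 37 * M by rewrite mulr_ge0// ltW.
have c6 : 0 <= 36 * 469 * M / eta.
  apply: divr_ge0; last exact: ltW.
  by apply: mulr_ge0; [apply: mulr_ge0; apply: ler0n|exact: ltW].
have bw2 := integral_leD mA (integral_leD mA (integral_leD mA
  (integral_leZ mA c1 bD2z) (integral_leZ mA c2 bDz)) (integral_leZ mA c3 bz)) bD2v.
have bw := integral_leD mA (integral_leD mA
  (integral_leZ mA c1 bDz) (integral_leZ mA c4 bz)) bDv.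
have bf := integral_leD mA (integral_leZ mA c5 bw2) (integral_leZ mA c6 bw).
apply: le_trans (integral_le_abs mA intf _ bf) _.
  move=> x Ax; have /andP[ex xe] := Ax.
  have xi : `|x 0 i| <= 2 * eta by rewrite (le_trans (enorm_coord _ _))// ltW.
  have Hx : `|H x| <= 6 * eta ^+ 2 * kap.
    rewrite /H (le_trans (ler_normB _ _))//.
    have d1 : eta ^+ 2 <= dot x x.
      by rewrite -sqr_enorm; apply: lerXn2r; rewrite ?nnegrE ?enorm_ge0 ?(ltW eta0)// ltW.
    have d2 : dot x x <= 4 * eta ^+ 2.
      have -> : 4 * eta ^+ 2 = (2 * eta) ^+ 2 by rewrite exprMn; congr (_ * _); ring.
      by rewrite -sqr_enorm; apply: lerXn2r; rewrite ?nnegrE ?enorm_ge0 ?(ltW xe)// mulr_ge0// ltW.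
    rewrite normrM (gtr0_norm kap0) ger0_norm; last by rewrite divr_ge0// subr_ge0.
    have : kap * ((dot x x - eta ^+ 2) / 2) <= kap * (3 * eta ^+ 2 / 2).
      by rewrite ler_wpM2l// ler_pM2r ?invr_gt0//; lra.
    by move: h0_le (mulr_ge0 c3 (sqr_ge0 eta)); lra.
  have kx : `|- kap * x 0 i| <= 2 * eta * kap.
    by rewrite normrM normrN (gtr0_norm kap0) mulrC ler_wpM2r.
  have kk : `|- kap| <= kap by rewrite normrN gtr0_norm.
  have w2x : `|w2 x| <= 6 * eta ^+ 2 * kap * `|D2z x i i| + 4 * eta * kap * `|Dz x 0 i| +
      kap * `|z x| + `|D2v x i i|.
    have t1 : `|D2z x i i * H x| <= 6 * eta ^+ 2 * kap * `|D2z x i i|.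
      by rewrite normrM mulrC ler_wpM2r.
    have t2 : `|Dz x 0 i * (- kap * x 0 i)| <= 2 * eta * kap * `|Dz x 0 i|.
      by rewrite normrM mulrC ler_wpM2r.
    have t3 : `|z x * - kap| <= kap * `|z x|.
      by rewrite normrM mulrC ler_wpM2r.
    have t4 := ler_normD (D2z x i i * H x + Dz x 0 i * (- kap * x 0 i) +
      (Dz x 0 i * (- kap * x 0 i) + z x * - kap)) (D2v x i i).
    have t5 := ler_normD (D2z x i i * H x + Dz x 0 i * (- kap * x 0 i))
      (Dz x 0 i * (- kap * x 0 i) + z x * - kap).
    have t6 := ler_normD (D2z x i i * H x) (Dz x 0 i * (- kap * x 0 i)).
    have t7 := ler_normD (Dz x 0 i * (- kap * x 0 i)) (z x * - kap).
    rewrite /w2; apply: le_trans t4 _; rewrite lerD2r.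
    apply: le_trans t5 _; apply: le_trans (lerD t6 t7) _.
    apply: le_trans (lerD (lerD t1 t2) (lerD t2 t3)) _.
    by rewrite le_eqVlt; apply/orP; left; apply/eqP; ring.
  have wx : `|w x| <= 6 * eta ^+ 2 * kap * `|Dz x 0 i| + 2 * eta * kap * `|z x| + `|Dv x 0 i|.
    apply: le_trans (ler_normD _ _) _; rewrite lerD2r.
    apply: le_trans (ler_normD _ _) _; rewrite !(normrM (Dz x 0 i)) !(normrM (z x)).
    by apply: lerD; rewrite mulrC; apply: ler_wpM2r.
  apply: le_trans (ler_normD _ _) _.
  rewrite !(normrM (w2 x)) !(normrM (w x)).
  apply: lerD.
    rewrite mulrC; apply: ler_pM => //.
    rewrite normrM (_ : 36 * 37 * M = 36 * (37 * M)); last by ring.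
    by apply: ler_pM.
  rewrite mulrC; apply: ler_pM => //.
  rewrite normrM (_ : 36 * 469 * M / eta = 36 * (469 * M / eta)); last by ring.
  by apply: ler_pM => //; exact: dpsi_le.
have vol0 : 0 <= vol by apply: fine_ge0; exact: measure_ge0.
have eta' : eta != 0 by rewrite lt0r_neq0.
set V := vol in vol0 *.
(* Here 24 = 12 + 8 + 2 + 2 collects the four terms of [w2], and 18 = 12 + 4 + 2 the three terms of
   [w]; 600 * 600 is a round number above the result. *)
rewrite [leLHS](_ : _ = 36 * (37 * 24 + 469 * 18) * (M * kap * e * V)); last by field.
rewrite [leRHS](_ : _ = 600 * 600 * (M * kap * e * V)); last by ring.
apply: ler_wpM2r; last by lra.
by apply: mulr_ge0 => //; apply: mulr_ge0; [apply: mulr_ge0|]; exact: ltW.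
Qed.

End perturbation.

Lemma cvg_sumr (R : realType) (T : Type) (F : set_system T) (FF : Filter F) m
    (f : 'I_m -> T -> R) (l : 'I_m -> R) :
  (forall i, f i x @[x --> F] --> l i) -> \sum_i f i x @[x --> F] --> \sum_i l i.
Proof.
elim: m f l => [|m IH] f l fl.
  by rewrite big_ord0; under eq_cvg do rewrite big_ord0; exact: cvg_cst.
rewrite big_ord_recl; under eq_cvg do rewrite big_ord_recl.
by apply: cvgD; [exact: fl|apply: IH => i; exact: fl].
Qed.

(** * The pairing over eta < |x| < eps at a fixed eta *)

Section pairing_estimate.
Context (R : realType) (n : nat) (eps p W : R).
Local Notation mu := (@lebesgue_rV R n).
Local Notation O := (@punctured_ball R n eps).
Context (a : 'rV[R]_n -> 'M[R]_n) (b : 'rV[R]_n -> 'rV[R]_n).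
Context (Z : 'rV[R]_n -> R) (DZ : 'rV[R]_n -> 'rV[R]_n) (D2Z : 'rV[R]_n -> 'M[R]_n).
Hypothesis p1 : 1 <= p.
Hypothesis W0 : 0 <= W.
Hypothesis ma : forall i j, rV_measurable_fun O (fun x => a x i j).
Hypothesis mb : forall k, rV_measurable_fun O (fun x => b x 0 k).
Hypothesis ha : forall x, O x -> forall i j, `|a x i j - (i == j)%:R| <= W.
Hypothesis hb : forall x, O x -> forall k, enorm x * `|b x 0 k| <= W.
Hypothesis solZ : strong_solution a b p eps Z DZ D2Z.
Variables (phi : 'rV[R]_n -> R) (M : R).
Hypothesis C1phi : C1_compact (eball eps) phi.
Hypothesis M0 : 0 < M.
Hypothesis phiM : forall x, `|phi x| <= M.
Hypothesis dphiM : forall i x, `|pderiv i phi x| <= M.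
Variables (eta kap e C d1 : R) (h zeta : R -> R) (v : 'rV[R]_n -> R).
Variables (Dz Dv : 'rV[R]_n -> 'rV[R]_n) (D2z D2v : 'rV[R]_n -> 'M[R]_n).
Hypothesis eta0 : 0 < eta.
Hypothesis eta1 : eta <= 1.
Hypothesis eta2 : 2 * eta < eps.
Hypothesis kap0 : 0 < kap.
Hypothesis e0 : 0 < e.
Hypothesis h_le : `|h eta| <= 4 * eta ^+ 2 * kap.
Hypothesis C0 : 0 < C.
Hypothesis d10 : 0 < d1.
Hypothesis h_taylor : forall s, eta <= s -> s <= eta + d1 ->
  `|h s - h eta + kap * ((s ^+ 2 - eta ^+ 2) / 2)| <= C * (s - eta) ^+ 2.
Hypothesis ZE : forall x, O x -> Z x = h (enorm x) * (1 + zeta (enorm x)) + v x.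
Hypothesis Wz : W2p_loc p O (zeta \o @enorm R n) Dz D2z.
Hypothesis Wv : W2p_loc p O v Dv D2v.
Hypothesis Mz : (M2p p (zeta \o @enorm R n) Dz D2z eta <= e%:E)%E.
Hypothesis Mv : (M2p p v Dv D2v eta <= (eta ^+ 2 * kap * e)%:E)%E.
Local Notation G := (pairing_integrand a b DZ D2Z phi).

Let mO := @measurable_punctured_ball R n eps.
Let K := @closed_annulus R n eta (2 * eta).
Let KO : K `<=` O := @closed_annulus_sub R n eps _ _ eta0 eta2.
Let mK : measurable (K : set (rVT R n)).
Proof. exact: (measurable_compact (@compact_closed_annulus R n eta (2 * eta))). Qed.

Let H (x : 'rV[R]_n) : R := h eta - kap * ((dot x x - eta ^+ 2) / 2).
Let u (x : 'rV[R]_n) : R := zeta (enorm x) * H x + v x.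
Let chi (d : R) := @cutoff R n (eta ^+ 2) d.
Let P (d : R) i (x : 'rV[R]_n) : R :=
  d2cutoff (eta ^+ 2) d i i x * phi x + dcutoff (eta ^+ 2) d i x * pderiv i phi x.
(* The part of the pairing that comes from [(h - H) (1 + zeta)]. *)
Let T (d : R) i (x : 'rV[R]_n) : R := Z x * P d i x - (H x * P d i x + u x * P d i x).

Let gphi := C1_compact_has_grad C1phi.

Let dot_le (x : 'rV[R]_n) : enorm x <= eta -> dot x x <= eta ^+ 2.
Proof.
by move=> xe; rewrite -sqr_enorm; apply: lerXn2r; rewrite ?nnegrE ?enorm_ge0 ?(ltW eta0).
Qed.

Let chi0 (d : R) x : 0 < d -> enorm x <= eta ->
  [/\ chi d x = 0, forall i, dcutoff (eta ^+ 2) d i x = 0 &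
      forall i j, d2cutoff (eta ^+ 2) d i j x = 0].
Proof. by move=> d0 /dot_le; exact: cutoff_le. Qed.

Let P0 (d : R) i x : 0 < d -> enorm x <= eta -> P d i x = 0.
Proof. by move=> d0 xe; have [_ c1 c2] := chi0 d0 xe; rewrite /P c1 c2 !mul0r addr0. Qed.

Let P_out (d : R) i x : 0 < d -> 3 * d <= eta ^+ 2 -> 2 * eta < enorm x -> P d i x = 0.
Proof.
move=> d0 d3 ex; have xB : eta ^+ 2 + 3 * d <= dot x x.
  rewrite -sqr_enorm; apply: (@le_trans _ _ ((2 * eta) ^+ 2)).
    by have := sqr_ge0 eta; rewrite exprMn; move: d3; set q := eta ^+ 2; lra.
  by apply: lerXn2r; rewrite ?nnegrE ?enorm_ge0 ?(ltW ex)// mulr_ge0// ltW.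
by have [_ c1 c2] := cutoff_ge d0 xB; rewrite /P c1 c2 !mul0r addr0.
Qed.

Let intP (d : R) i w : 0 < d -> L1_loc O w -> rV_integrable O (fun x => w x * P d i x).
Proof.
move=> d0 Lw; have gd := @has_grad_dcutoff R n (eta ^+ 2) d i; have [_ _ /(_ i) cd2] := gd.
have c1 x : enorm x < eta -> dcutoff (eta ^+ 2) d i x = 0.
  by move=> /ltW xe; have [_ -> _] := chi0 d0 xe.
have c2 x : enorm x < eta -> d2cutoff (eta ^+ 2) d i i x = 0.
  by move=> /ltW xe; have [_ _ ->] := chi0 d0 xe.
have [i1 _] := annular_integrable eta0 C1phi cd2 c2 Lw.
have [_ /(_ i) i2] := annular_integrable eta0 C1phi (has_grad_continuous gd) c1 Lw.
rewrite (_ : (fun _ => _) = fun x => w x * (d2cutoff (eta ^+ 2) d i i x * phi x) +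
  w x * (dcutoff (eta ^+ 2) d i x * pderiv i phi x)).
  exact: (integrableD mO i1 i2).
by apply/funext => x; rewrite /P mulrDr.
Qed.

Let cH : continuous H.
Proof. exact: (has_grad_continuous (has_grad_quadratic n (h eta) kap (eta ^+ 2))). Qed.

Let Lz : L1_loc O (zeta \o @enorm R n).
Proof. by have [L _ _ _ _] := Wz; exact: (Lp_loc_L1_loc mO p1 L). Qed.

Let Lv : L1_loc O v.
Proof. by have [L _ _ _ _] := Wv; exact: (Lp_loc_L1_loc mO p1 L). Qed.

Let LZ : L1_loc O Z.
Proof. by have [[L _ _ _ _] _] := solZ; exact: (Lp_loc_L1_loc mO p1 L). Qed.

Let LH : L1_loc O H.
Proof. exact: (continuous_L1_loc mO cH). Qed.

Let Lu : L1_loc O u.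
Proof. exact: (L1_locD (L1_locM mO Lz cH) Lv). Qed.

Let intT (d : R) i : 0 < d -> rV_integrable O (T d i).
Proof.
move=> d0.
exact: (integrableB mO (intP i d0 LZ) (integrableD mO (intP i d0 LH) (intP i d0 Lu))).
Qed.

Let integral_ZP (d : R) i : 0 < d -> rV_integral O (fun x => Z x * P d i x) =
  rV_integral O (fun x => H x * P d i x) + rV_integral O (fun x => u x * P d i x) +
  rV_integral O (T d i).
Proof.
move=> d0; have i1 := intP i d0 LH; have i2 := intP i d0 Lu.
rewrite /rV_integral -(RintegralD mO i1 i2).
rewrite -(RintegralD mO (integrableD mO i1 i2) (intT i d0)).
by apply: eq_Rintegral => x _; rewrite /T /=; ring.
Qed.

(* [P = O(d^-2)] lives in a shell of width [O(d)], where [h - H = O(d^2)]. *)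
Let T_bound (d : R) i x : 0 < d -> d <= 1 -> 3 * d <= eta ^+ 2 -> 3 * d <= 2 * eta * d1 ->
  O x -> `|T d i x| <= 9 * 36 * 28 * C * M / (4 * eta ^+ 2) * `|1 + zeta (enorm x)|.
Proof.
move=> d0 d_1 d_2 d_3 Ox.
have B0 : 0 <= 9 * 36 * 28 * C * M / (4 * eta ^+ 2).
  apply: divr_ge0; last by apply: mulr_ge0 => //; exact: sqr_ge0.
  by apply: mulr_ge0; [apply: mulr_ge0; rewrite ?(ltW C0)//|exact: ltW].
have TE : T d i x = (h (enorm x) - H x) * P d i x * (1 + zeta (enorm x)).
  by rewrite /T ZE// /u; ring.
rewrite TE normrM; apply: ler_wpM2r => //.
have [xe|ex] := leP (enorm x) eta; first by rewrite P0// mulr0 normr0.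
have [xB|xB] := leP (eta ^+ 2 + 3 * d) (dot x x).
  by have [_ c1 c2] := cutoff_ge d0 xB; rewrite /P c1 c2 !mul0r addr0 mulr0 normr0.
set s := enorm x in ex *; have sE : s ^+ 2 = dot x x := sqr_enorm x.
(* The shell is thin in |x|^2; dividing by s + eta >= 2 eta makes it thin in |x|. *)
have s_eta : (s - eta) * (2 * eta) <= 3 * d.
  apply: (@le_trans _ _ (s ^+ 2 - eta ^+ 2)); last by rewrite sE; lra.
  by rewrite subr_sqr ler_wpM2l//; lra.
have s_d1 : s <= eta + d1.
  have e20 : 0 < 2 * eta by rewrite mulr_gt0.
  by rewrite -lerBlDl -(ler_pM2r e20) (le_trans s_eta)// (le_trans d_3)// mulrC.
have hH : `|h s - H x| <= 9 * C * d ^+ 2 / (4 * eta ^+ 2).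
  have -> : h s - H x = h s - h eta + kap * ((s ^+ 2 - eta ^+ 2) / 2) by rewrite /H sE; ring.
  apply: le_trans (h_taylor (ltW ex) s_d1) _.
  rewrite ler_pdivlMr; last by rewrite mulr_gt0// exprn_gt0.
  have -> : C * (s - eta) ^+ 2 * (4 * eta ^+ 2) = C * ((s - eta) * (2 * eta)) ^+ 2 by ring.
  have -> : 9 * C * d ^+ 2 = C * (3 * d) ^+ 2 by ring.
  apply: ler_wpM2l; first exact: ltW.
  have e20 : 0 <= 2 * eta by rewrite mulr_ge0// ltW.
  have d30 : 0 <= 3 * d by rewrite mulr_ge0// ltW.
  have se0 : 0 <= s - eta by rewrite subr_ge0 ltW.
  by apply: lerXn2r s_eta; rewrite nnegrE// mulr_ge0.
have xi j : `|x 0 j| <= 2.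
  apply: le_trans (enorm_coord _ _) _; rewrite -(@ler_pXn2r _ 2)// ?nnegrE ?enorm_ge0//.
  rewrite sqr_enorm (le_trans (ltW xB))//.
  have : eta ^+ 2 <= 1 by rewrite expr_le1// ltW.
  by move: d_2; set q := eta ^+ 2; lra.
have c1 := dcutoff_bound (eta ^+ 2) d0 (xi i).
have c2 := d2cutoff_bound (eta ^+ 2) d0 d_1 (ler1n _ 2) (xi i) (xi i).
(* The constant 36 * 28 is 216 * 4 + 72 * 2, from the two cutoff bounds at |x_i| <= 2. The [d ^+ 2]
   cancels against that of [hH]. *)
have PB : `|P d i x| <= 36 * 28 * M / d ^+ 2.
  have dV : d^-1 <= (d ^+ 2)^-1.
    by rewrite lef_pV2 ?posrE ?exprn_gt0// expr2 ler_piMl// ltW.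
  apply: le_trans (ler_normD _ _) _; rewrite (normrM _ (phi x)) (normrM _ (pderiv i phi x)).
  apply: (@le_trans _ _ (216 * 2 ^+ 2 / d ^+ 2 * M + 72 * 2 / d * M)).
    by apply: lerD; apply: ler_pM.
  have : 72 * 2 * M * d^-1 <= 72 * 2 * M * (d ^+ 2)^-1.
    apply: ler_wpM2l => //; rewrite -mulrA; apply: mulr_ge0 => //.
    by apply: mulr_ge0 => //; exact: ltW.
  move: M0; set q1 := d^-1; set q2 := (d ^+ 2)^-1; lra.
rewrite normrM; apply: le_trans (ler_pM (normr_ge0 _) (normr_ge0 _) hH PB) _.
rewrite le_eqVlt; apply/orP; left; apply/eqP; field.
by rewrite !lt0r_neq0.
Qed.

Let N0 : exists N, forall m, (N <= m)%N ->
  3 * m.+1%:R^-1 <= eta ^+ 2 /\ 3 * m.+1%:R^-1 <= 2 * eta * d1.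
Proof.
have q0 : 0 < Num.min (eta ^+ 2) (2 * eta * d1) / 3.
  by rewrite divr_gt0// lt_min exprn_gt0//= !mulr_gt0.
have := @cvg_harmonic R; move/cvgrPdist_lt => /(_ _ q0) [N _ NH]; exists N => m /NH /=.
rewrite /harmonic sub0r normrN gtr0_norm ?invr_gt0//.
rewrite ltr_pdivlMr// mulrC => /ltW; rewrite le_min => /andP[A B]; split; [exact: A|exact: B].
Qed.

Let dd m : R := m.+1%:R^-1.
Let dd0 m : 0 < dd m. Proof. by rewrite /dd invr_gt0 ltr0n. Qed.
Let dd1 m : dd m <= 1. Proof. by rewrite /dd invf_le1 ?ltr0n// ler1n. Qed.

Let T_cvg i : rV_integral O (T (dd m) i) @[m --> \oo] --> (0 : R).
Proof.
have [N NH] := N0.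
(* The dominating bound [T_bound] is available only from index [N] on. *)
rewrite -(cvg_shiftn N).
have TK m : (N <= m)%N -> rV_integral O (T (dd m) i) = rV_integral K (T (dd m) i).
  move=> Nm; have [n1 n2] := NH m Nm; apply: (rV_integral_support KO) => x Ox Kx.
  have PK : P (dd m) i x = 0.
    have [xe|ex] := leP (enorm x) eta; first by rewrite P0.
    apply: P_out => //; rewrite ltNge; apply/negP => xe'; apply: Kx.
    by rewrite /K /closed_annulus/= (ltW ex).
  by rewrite /T PK !mulr0 addr0 subr0.
have -> : (fun m => rV_integral O (T (dd (m + N)) i)) =
    (fun m => rV_integral K (T (dd (m + N)) i)).
  by apply/funext => m; rewrite TK// leq_addl.
have E0 : rV_integral K (fun=> 0) = 0 by rewrite /rV_integral Rintegral_cst ?mul0r.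
suff : rV_integral K (T (dd (m + N)) i) @[m --> \oo] --> rV_integral K (fun=> 0) by rewrite E0.
have iT m : rV_integrable K (T (dd m) i) := integrableS mO mK KO (intT i (dd0 m)).
have i1 : rV_integrable K (fun x => 9 * 36 * 28 * C * M / (4 * eta ^+ 2) * `|1 + zeta (enorm x)|).
  have L1 : L1_loc O (fun x => 1 + zeta (enorm x)).
    exact: (L1_locD (continuous_L1_loc mO (@cst_continuous _ _ (1 : R))) Lz).
  have := L1.2 K (@compact_closed_annulus R n eta (2 * eta)) KO.
  by move=> /integrable_norm iL; exact: (integrableZl mK _ iL).
apply: (@rV_dominated_cvg R n K (fun m => T (dd (m + N)) i) (fun=> 0) _ mK _ _ _ i1).
- by move=> m; have /integrableP[/measurable_EFinP + _] := iT (m + N)%N.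
- exact: measurable_cst.
- move=> x Kx; rewrite (cvg_shiftn N (fun m => T (dd m) i x)).
  apply: cvg_near_cst; have := @cutoff_cvg R n eta x eta0; apply: filterS => m [_ H0].
  by have [c1 c2] := H0 i i; rewrite /T /P c1 c2 !mul0r addr0 !mulr0 addr0 subr0.
- move=> m x Kx; have [n1 n2] := NH (m + N)%N (leq_addl _ _).
  by apply: T_bound; rewrite ?dd0 ?dd1//; exact: KO.
Qed.

Let pairing_cvg : rV_integral O (fun x => chi (dd m) x * G x) @[m --> \oo] -->
  rV_integral (annulus eta eps) G.
Proof.
have mD : measurable (annulus eta eps : set (rVT R n)) := @caratheodory_annulus _ _ _ _.
have DO : annulus eta eps `<=` O.
  by move=> x /= /andP[ex xe]; rewrite /O/= xe (lt_trans eta0).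
have iG := pairing_integrable p1 ma mb ha hb solZ C1phi eta0.
have -> : (fun m => rV_integral O (fun x => chi (dd m) x * G x)) =
    (fun m => rV_integral (annulus eta eps) (fun x => chi (dd m) x * G x)).
  apply/funext => m; apply: (rV_integral_support DO) => x /andP[x0 xe] Dx.
  have [ex|ex] := leP (enorm x) eta; first by have [-> _ _] := chi0 (dd0 m) ex; rewrite mul0r.
  by exfalso; apply: Dx; rewrite /annulus/= ex.
have mG : rV_measurable_fun (annulus eta eps) G by have /integrableP[/measurable_EFinP + _] := iG.
have iG36 := integrableZl mD 36 (integrable_norm iG).
apply: (@rV_dominated_cvg R n _ (fun m x => chi (dd m) x * G x) G _ mD _ mG _ iG36).
- move=> m; apply: measurable_funM; last exact: mG.
  exact: (continuous_measurable_cara (has_grad_continuous (@has_grad_cutoff R n _ _))).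
- move=> x /andP[ex _]; apply: cvg_near_cst.
  have := @cutoff_cvg R n eta x eta0; apply: filterS => m [H0 _].
  by rewrite /chi H0 ex mul1r.
- by move=> m x _; rewrite normrM; apply: ler_wpM2r => //; exact: cutoff_bound.
Qed.

Let quadratic_cvg i : rV_integral O (fun x => H x * P (dd m) i x) @[m --> \oo] -->
  kap * rV_integral (cball eta) (fun x => phi x + x 0 i * pderiv i phi x).
Proof.
have [_ _ cdphi] := gphi; have cphi := has_grad_continuous gphi.
have cF : continuous (fun x : 'rV[R]_n => phi x + x 0 i * pderiv i phi x).
  move=> x; exact: (continuousD (cphi x)
    (continuousM (@continuous_rV_coord R n i x) (cdphi i x))).
set F := (fun x => _ + _) in cF *.
have mT : measurable (setT : set (rVT R n)) by exact: measurableT.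
have mF : rV_measurable_fun setT F := continuous_measurable_cara cF.
have iF : rV_integrable setT F.
  apply: (@integrable_continuous_support _ _ _ eps) => // x /ltW xe.
  by have [f0 df0] := C1_compact_out C1phi xe; rewrite /F f0 df0 mulr0 addr0.
have -> : (fun m => rV_integral O (fun x => H x * P (dd m) i x)) =
    (fun m => kap * rV_integral setT (fun x => (1 - chi (dd m) x) * F x)).
  apply/funext => m; apply: (quadratic_part _ _ _ eta0 C1phi (@has_grad_cutoff R n _ _)
    (@has_grad_dcutoff R n _ _ i)).
  by move=> x /ltW xe; have [_ -> _] := chi0 (dd0 m) xe.
apply: cvgM; first exact: cvg_cst.
(* The cutoffs vanish on |x| = eta, so 1 - chi tends to the indicator of the closed ball. *)
have -> : rV_integral (cball eta) F =
    rV_integral setT (fun x => (1 - ((eta : R) < enorm x)%R%:R) * F x).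
  rewrite (@rV_integral_support R n setT (cball eta))//.
    apply: eq_Rintegral => x /set_mem xe.
    have /negPf -> : ~~ (eta < enorm x) by rewrite -leNgt.
    by rewrite subr0 mul1r.
  by move=> x _ /negP; rewrite -ltNge => ->; rewrite subrr mul0r.
have iF37 := integrableZl mT 37 (integrable_norm iF).
apply: (@rV_dominated_cvg R n _ (fun m x => (1 - chi (dd m) x) * F x) _ _ mT _ _ _ iF37).
- move=> m; apply: measurable_funM; last exact: mF.
  apply: measurable_funB; first exact: measurable_cst.
  exact: (continuous_measurable_cara (has_grad_continuous (@has_grad_cutoff R n _ _))).
- apply: measurable_funM; last exact: mF.
  apply: measurable_funB; first exact: measurable_cst.
  rewrite (_ : (fun _ => _) = \1_(~` cball eta)).
    apply: measurable_indic; apply: measurableC.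
    exact: (@caratheodory_borel R n _ (measurable_cball _)).
  apply/funext => x; rewrite indicE /cball; congr (_%:R); congr nat_of_bool.
  by apply/idP/idP => [xe|/set_mem/negP]; [apply/mem_set/negP; rewrite -ltNge|rewrite -ltNge].
- move=> x _; apply: cvg_near_cst.
  have := @cutoff_cvg R n eta x eta0; apply: filterS => m [H0 _].
  by rewrite /chi H0.
- move=> m x _; rewrite normrM; apply: ler_wpM2r => //.
  have := cutoff_bound (eta ^+ 2) (dd m) x.
  by have := ler_normB 1 (chi (dd m) x); rewrite normr1; lra.
Qed.

Lemma pairing_estimate :
  `|rV_integral (annulus eta eps) G +
    kap * \sum_i rV_integral (cball eta) (fun x => phi x + x 0 i * pderiv i phi x)| <=
  n%:R * (600 * 600 * M * kap * e * fine (mu (annulus eta (2 * eta)))).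
Proof.
have [N NH] := N0; set B := _ * fine _.
pose S m := rV_integral O (fun x => chi (dd m) x * G x) +
  \sum_i (rV_integral O (fun x => H x * P (dd m) i x) + rV_integral O (T (dd m) i)).
have S_cvg : `|S m| @[m --> \oo] --> `|rV_integral (annulus eta eps) G +
    kap * \sum_i rV_integral (cball eta) (fun x => phi x + x 0 i * pderiv i phi x)|.
  apply: cvg_norm; apply: cvgD; first exact: pairing_cvg.
  rewrite mulr_sumr; apply: cvg_sumr => i. 
  have := cvgD (@quadratic_cvg i) (@T_cvg i); rewrite addr0; exact.
rewrite -(cvg_lim (@Rhausdorff R) S_cvg); apply: limr_le.
  by apply/cvg_ex; eexists; exact: S_cvg.
exists N => // m /NH[n1 n2].
(* This is exact for each [m], by [truncated_pairing] and [integral_ZP]. The bound on the right-hand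
   side does not involve [m], so it survives the limit. *)
have -> : S m = - \sum_i rV_integral O (fun x => u x * P (dd m) i x).
  rewrite /S (truncated_pairing p1 ma mb solZ C1phi eta0 (@has_grad_cutoff R n (eta ^+ 2) (dd m))
    (@has_grad_dcutoff R n (eta ^+ 2) (dd m))).
  - under eq_bigr do rewrite integral_ZP//.
    by rewrite -!sumrN -big_split/=; apply: eq_bigr => i _; ring.
  - by move=> x /ltW xe; have [c _ _] := chi0 (dd0 m) xe; exact: c.
  - by move=> i x /ltW xe; have [_ c _] := chi0 (dd0 m) xe; exact: c.
rewrite normrN; apply: le_trans (ler_norm_sum _ _ _) _.
have -> : n%:R * B = \sum_(i < n) B by rewrite sumr_const card_ord mulr_natl.
apply: ler_sum => i _.
apply: (perturbation_bound p1 eta0 eta1 eta2 kap0 e0 M0 h_le Wz Wv Mz Mv C1phi phiM dphiM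
  (@has_grad_cutoff R n (eta ^+ 2) (dd m)) (@has_grad_dcutoff R n (eta ^+ 2) (dd m) i)).
- exact: cutoff_bound.
- by move=> x xe; have [c _ _] := chi0 (dd0 m) xe; exact: c.
- by move=> x xe; have [_ c _] := chi0 (dd0 m) xe; exact: c.
- move=> x xe; have xB : eta ^+ 2 + 3 * dd m <= dot x x.
    by move: xe n1; rewrite /dd; set q := eta ^+ 2; set k := m.+1%:R^-1; lra.
  by have [_ -> ->] := cutoff_ge (dd0 m) xB.
Qed.

End pairing_estimate.

(** * The limit eta -> 0 *)

Lemma C1_compact_bounded (R : realType) n (eps : R) (phi : 'rV[R]_n -> R) :
  C1_compact (eball eps) phi -> exists M, [/\ 0 < M, forall x, `|phi x| <= M &
    forall i x, `|pderiv i phi x| <= M].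
Proof.
move=> C1phi; have gphi := C1_compact_has_grad C1phi; have [_ _ cdphi] := gphi.
have bounded (f : 'rV[R]_n -> R) : continuous f -> (forall x, eps <= enorm x -> f x = 0) ->
    exists M, 0 < M /\ forall x, `|f x| <= M.
  move=> cf f0; have [M M0 fM] := compact_continuous_bounded (@compact_cball R n eps) cf.
  exists M; split=> // x; have [xe|/ltW/f0 ->] := leP (enorm x) eps; first exact: fM.
  by rewrite normr0 ltW.
have [M0 [M00 phiM]] := bounded phi (has_grad_continuous gphi)
  (fun x xe => (C1_compact_out C1phi xe).1).
have [M MP] := choice (fun i => bounded (pderiv i phi) (cdphi i)
  (fun x xe => (C1_compact_out C1phi xe).2 i)).
have S0 : 0 <= \sum_i M i by apply: sumr_ge0 => i _; exact: ltW (MP i).1.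
exists (M0 + \sum_i M i); split.
- by rewrite ltr_pwDl.
- by move=> x; rewrite (le_trans (phiM x))// lerDl.
- move=> i x; rewrite (le_trans ((MP i).2 x))// (bigD1 i)//= addrCA lerDl.
  by rewrite addr_ge0 ?(ltW M00)// sumr_ge0// => j _; exact: ltW (MP j).1.
Qed.

Lemma near_enorm (R : realType) n (phi : 'rV[R]_n -> R) e : continuous phi -> 0 < e ->
  exists2 d : R, 0 < d & forall x, enorm x < d -> `|phi x - phi 0| <= e.
Proof.
move=> cphi e0; have /cvgrPdist_le /(_ _ e0) /nbhs_ballP[d /= d0 dB] := cphi 0.
exists d => // x xd; rewrite distrC; apply: dB; split=> // i j.
by rewrite ord1 !mxE /ball/= sub0r normrN (le_lt_trans (enorm_coord _ _)).
Qed.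

(** Summed over [i], the integrand is div (phi x), and the main terms add up to n phi(0) times the
    volume of the ball; this is where the surface area of the sphere comes from. *)
Lemma ball_average (R : realType) n (eps : R) (phi : 'rV[R]_n -> R) (M e eta : R) i :
  C1_compact (eball eps) phi -> 0 < eta ->
  (forall x, enorm x <= eta -> `|phi x - phi 0| <= e) -> (forall x, `|pderiv i phi x| <= M) ->
  `|rV_integral (cball eta) (fun x => phi x + x 0 i * pderiv i phi x) -
    phi 0 * (eta ^+ n * ball_volume R n)| <= (e + eta * M) * (eta ^+ n * ball_volume R n).
Proof.
move=> C1phi eta0 phie dphiM.
have mB : measurable (@cball R n eta : set (rVT R n)).
  exact: (@caratheodory_borel R n _ (measurable_cball _)).
have cst_int (k : R) : rV_integrable (@cball R n eta) (fun=> k).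
  apply: (@integrable_bounded_support _ _ _ (cball eta) _ `|k| mB mB) => //.
  - exact: lebesgue_rV_cball_lty.
  - exact: measurable_cst.
have cst_val (k : R) : rV_integral (@cball R n eta) (fun=> k) = k * (eta ^+ n * ball_volume R n).
  rewrite /rV_integral (Rintegral_cst _ mB); congr (k * _).
  exact: (congr1 fine (cball_volumeE n eta0)).
have gphi := C1_compact_has_grad C1phi; have [_ _ cdphi] := gphi.
have cphi := has_grad_continuous gphi.
have cF : continuous (fun x : 'rV[R]_n => phi x + x 0 i * pderiv i phi x).
  move=> x; exact: (continuousD (cphi x)
    (continuousM (@continuous_rV_coord R n i x) (cdphi i x))).
have iF : rV_integrable (cball eta) (fun x => phi x + x 0 i * pderiv i phi x).
  have [N N0 FN] := compact_continuous_bounded (@compact_cball R n eta) cF.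
  apply: (@integrable_bounded_support _ _ _ (cball eta) _ N mB mB) => //.
  - exact: lebesgue_rV_cball_lty.
  - exact: continuous_measurable_cara.
rewrite -!cst_val /rV_integral -(RintegralB mB iF (cst_int _)).
apply: le_trans (le_normr_Rintegral mB (integrableB mB iF (cst_int _))) _.
apply: (le_Rintegral mB (integrable_norm (integrableB mB iF (cst_int _))) (cst_int _)).
move=> x xe /=; rewrite addrAC; apply: le_trans (ler_normD _ _) _.
apply: lerD; first exact: phie.
by rewrite normrM; apply: ler_pM => //; rewrite (le_trans (enorm_coord _ _)).
Qed.

Lemma expR_cvgNy (R : realType) (f : R -> R) (F : set_system R) : Filter F ->
  f x @[x --> F] --> -oo -> expR (f x) @[x --> F] --> (0 : R).
Proof.
move=> FF /cvgrNyPlt fF; apply/cvgrPdist_lt => e e0.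
have := fF (ln e); apply: filterS => x xe.
by rewrite sub0r normrN gtr0_norm ?expR_gt0// -[ltRHS](lnK e0) ltr_expR.
Qed.

Section asymptotics.
Context (R : realType) (n : nat) (eps p W : R) (omega : R -> R).
Local Notation O := (@punctured_ball R n eps).
Context (a : 'rV[R]_n -> 'M[R]_n) (b : 'rV[R]_n -> 'rV[R]_n).
Context (Z : 'rV[R]_n -> R) (DZ : 'rV[R]_n -> 'rV[R]_n) (D2Z : 'rV[R]_n -> 'M[R]_n).
Hypothesis n3 : (3 <= n)%N.
Hypothesis p1 : 1 <= p.
Hypothesis eps0 : 0 < eps.
Hypothesis W0 : 0 <= W.
Hypothesis W_small : expR (W * lip_const R n * (2 ^+ n - 1)) <= 4 / 3.
Hypothesis homega : modulus omega.
Hypothesis ma : forall i j, rV_measurable_fun O (fun x => a x i j).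
Hypothesis mb : forall k, rV_measurable_fun O (fun x => b x 0 k).
Hypothesis ha : forall x, O x -> forall i j, `|a x i j - (i == j)%:R| <= W.
Hypothesis hb : forall x, O x -> forall k, enorm x * `|b x 0 k| <= W.
Hypothesis solZ : singular_solution a b p omega eps Z DZ D2Z.
Variable phi : 'rV[R]_n -> R.
Hypothesis C1phi : C1_compact (eball eps) phi.
Local Notation J eta := (rV_integral (annulus eta eps) (pairing_integrand a b DZ D2Z phi)).
Local Notation E eta := (expR (I_fun a b eps eta)).
Local Notation V := (ball_volume R n).

(** The error is relative to [E eta], so that one estimate covers both a finite limit of I and I ->
    -oo. *)
Lemma pairing_asymptotics d : 0 < d -> exists2 r : R, 0 < r & forall eta, 0 < eta < r ->
  `|J eta + sphere_area R n * E eta * phi 0| <= d * E eta.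
Proof.
move=> d0; have [M [M0 phiM dphiM]] := C1_compact_bounded C1phi.
have [sZ [c [zeta [Dz [D2z [v [Dv [D2v [Wz Wv ZE Mz Mv]]]]]]]]] := solZ.
have n_gt0 : (0 < n)%N by exact: leq_trans n3.
have V0 : 0 <= V := ball_volume_ge0 R n.
have N0 : 0 <= n%:R * V by rewrite mulr_ge0.
set q := 2 ^+ n - 1 : R; have q0 : 0 < q.
  by rewrite subr_gt0 exprn_egt1 ?ltr1n// -lt0n.
(* Three errors of size [n%:R * V * E eta * e1] have to fit into [d * E eta]; the [+ 1] makes the
   divisor positive. *)
pose e1 := d / (3 * (n%:R * V + 1)).
have e10 : 0 < e1 by rewrite divr_gt0// mulr_gt0// ltr_wpDl.
(* This cancels the constant of [pairing_estimate], where [q * eta ^+ n * V] is the volume of the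
   annulus. *)
pose e := e1 / (600 * 600 * M * q).
have C0 : 0 < 600 * 600 * M * q.
  by apply: mulr_gt0 q0; apply: mulr_gt0 M0; apply: mulr_gt0; rewrite ltr0n.
have e0 : 0 < e by rewrite divr_gt0.
have c10 : 0 < `|c| + 1 by rewrite ltr_wpDl.
(* The constant [c] of [singular_solution] has no prescribed sign; moduli below [e2] bring both mean
   bounds below their targets through [|c| * e2 <= e]. *)
pose e2 := e / (`|c| + 1).
have e20 : 0 < e2 by rewrite divr_gt0.
have ce2 : `|c| * e2 <= e.
  by rewrite /e2 mulrCA ler_piMr ?(ltW e0)// ler_pdivrMr// mul1r lerDl.
have [d1 /andP[d10 d11] mod_small] := modulus_small homega e20.
have [d2 d20 phi_osc] := near_enorm (has_grad_continuous (C1_compact_has_grad C1phi)) e10.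
(* In order: small moduli and [eta <= 1], small oscillation of [phi], room for the annulus up to
   [2 * eta], and a small gradient term in [ball_average]. *)
pose r := Num.min (Num.min d1 d2) (Num.min (eps / 2) (e1 / M)).
exists r.
  by rewrite /r !lt_min d10 d20 (divr_gt0 eps0 (ltr0n _ 2)) (divr_gt0 e10 M0).
move=> eta /andP[eta0]; rewrite /r !lt_min => /andP[/andP[eta_d1 eta_d2] /andP[eta_eps eta_M]].
have [w_le s_le] : omega eta <= e2 /\ sigma_mod omega eta <= e2 by apply: mod_small; rewrite eta0.
have eta1 : eta <= 1 by rewrite ltW// (lt_trans eta_d1).
have eta2 : 2 * eta < eps by rewrite mulrC -ltr_pdivlMr.
have eta_r : 0 < eta < eps / 2 by rewrite eta0.
have etaM : eta * M <= e1 by rewrite -ler_pdivlMr// ltW.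
have en0 : 0 < eta ^+ n by rewrite exprn_gt0.
have E0 : 0 < E eta := expR_gt0 _.
pose kap := eta ^- n * E eta.
have kap0 : 0 < kap by rewrite mulr_gt0// invr_gt0.
have kapE : kap * eta ^+ n = E eta by rewrite /kap mulrAC mulVf ?mul1r// lt0r_neq0.
have kap2 : eta ^- (n - 2) * E eta = eta ^+ 2 * kap.
  rewrite /kap mulrA; congr (_ * _); rewrite -{2}(subnK (ltnW n3)) exprD invfM mulrCA.
  by rewrite mulfV ?mulr1// lt0r_neq0// exprn_gt0.
have ome0 : 0 < omega eta by case: homega => + _ _ _; apply; rewrite eta0 (lt_trans eta_d1).
have J_lip := I_fun_lip n_gt0 W0 ma mb ha hb.
have K0 : 0 <= W * lip_const R n.
  by rewrite mulr_ge0// /lip_const addr_ge0// mulr_ge0// exprn_ge0.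
have e2e : eta <= 2 * eta by rewrite mulr_natl mulr2n lerDl ltW.
have eta_lt : eta < eps := le_lt_trans e2e eta2.
have h_le : `|h_fun a b eps eta| <= 4 * eta ^+ 2 * kap.
  rewrite ger0_norm; last exact: (radial_integral_ge0 n (I_fun a b eps) eps eta0).
  by rewrite -mulrA -kap2; exact: (radial_integral_bound n3 K0 J_lip W_small eta0 eta_lt).
have [C [d3 [C_0 d30 h_tay]]] := radial_integral_taylor n3 K0 J_lip eta0 eta_lt.
have Mz' : (M2p p (zeta \o @enorm R n) Dz D2z eta <= e%:E)%E.
  apply: le_trans (Mz _ eta_r) _; rewrite lee_fin (le_trans _ ce2)//.
  apply: (@le_trans _ _ (`|c| * Num.max (omega eta) (sigma_mod omega eta))).
    by rewrite ler_wpM2r ?ler_norm// le_max (ltW ome0).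
  by rewrite ler_wpM2l// ge_max w_le s_le.
have Mv' : (M2p p v Dv D2v eta <= (eta ^+ 2 * kap * e)%:E)%E.
  apply: le_trans (Mv _ eta_r) _; rewrite lee_fin kap2 mulrCA.
  have k0 : 0 <= eta ^+ 2 * kap by rewrite mulr_ge0 ?exprn_ge0 ?ltW.
  rewrite ler_wpM2l// (le_trans _ ce2)//.
  apply: (@le_trans _ _ (`|c| * omega eta)); first by rewrite ler_wpM2r ?ler_norm// ltW.
  by rewrite ler_wpM2l.
have T1 := pairing_estimate p1 ma mb ha hb sZ C1phi M0 phiM dphiM eta0 eta1 eta2 kap0 e0 h_le
  C_0 d30 h_tay ZE Wz Wv Mz' Mv'.
have volE : fine (@lebesgue_rV R n (annulus eta (2 * eta))) = q * (eta ^+ n * V).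
  by rewrite annulus_volumeE//= exprMn /q; ring.
set Q := fun i : 'I_n => rV_integral (cball eta) (fun x => phi x + x 0 i * pderiv i phi x).
have {}T1 : `|J eta + kap * \sum_i Q i| <= n%:R * V * E eta * e1.
  apply: le_trans T1 _; rewrite volE -kapE /e le_eqVlt; apply/orP; left; apply/eqP.
  by field; rewrite !lt0r_neq0.
have T2 : `|kap * \sum_i Q i - sphere_area R n * E eta * phi 0| <= n%:R * V * E eta * (2 * e1).
  have -> : sphere_area R n * E eta * phi 0 = kap * \sum_(i < n) phi 0 * (eta ^+ n * V).
    by rewrite sumr_const card_ord sphere_areaE -kapE -mulr_natl; ring.
  rewrite -mulrBr -sumrB normrM (gtr0_norm kap0).
  apply: (@le_trans _ _ (kap * \sum_(i < n) (2 * e1) * (eta ^+ n * V))).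
    rewrite ler_wpM2l ?(ltW kap0)//; apply: le_trans (ler_norm_sum _ _ _) _.
    apply: ler_sum => i _.
    apply: le_trans (ball_average (i := i) C1phi eta0 _ (dphiM i)) _.
      by move=> x xe; apply: phi_osc; exact: le_lt_trans eta_d2.
    by apply: ler_wpM2r; [rewrite mulr_ge0// ltW|rewrite (mulr_natl e1) mulr2n lerD2l].
  rewrite sumr_const card_ord -kapE -mulr_natl le_eqVlt; apply/orP; left; apply/eqP; ring.
have -> : J eta + sphere_area R n * E eta * phi 0 = (J eta + kap * \sum_i Q i) -
  (kap * \sum_i Q i - sphere_area R n * E eta * phi 0) by ring.
apply: le_trans (ler_normB _ _) _; apply: le_trans (lerD T1 T2) _.
have -> : n%:R * V * E eta * e1 + n%:R * V * E eta * (2 * e1) =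
    n%:R * V / (n%:R * V + 1) * (d * E eta).
  by rewrite /e1; field; rewrite lt0r_neq0// ltr_wpDl.
rewrite ler_piMl ?(ltW (mulr_gt0 d0 E0))// ler_pdivrMr ?mul1r ?lerDl//.
by rewrite ltr_wpDl.
Qed.

Lemma pairing_limit (E0 : R) : E eta @[eta --> 0^'+] --> E0 ->
  J eta @[eta --> 0^'+] --> - (sphere_area R n * E0 * phi 0).
Proof.
(* Since [E eta] converges, it is eventually below [|E0| + 1], and the relative error becomes an
   absolute error of at most [e / 2]. *)
move=> cE; apply/cvgrPdist_lt => e e0; have d0 : 0 < e / (2 * (`|E0| + 1)).
  by rewrite divr_gt0// mulr_gt0// ltr_wpDl.
have [r r0 asym] := pairing_asymptotics d0.
have cS : sphere_area R n * E eta * phi 0 @[eta --> 0^'+] --> sphere_area R n * E0 * phi 0.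
  by apply: cvgMl; apply: cvgMr.
have /cvgrPdist_lt := cS; have e20 : 0 < e / 2 by rewrite divr_gt0.
move=> /(_ _ e20) near1; have /cvgrPdist_lt := cE; move=> /(_ 1 ltr01) near2.
near=> eta.
have T1 : `|sphere_area R n * E0 * phi 0 - sphere_area R n * E eta * phi 0| < e / 2.
  by near: eta.
have T2 : `|E0 - E eta| < 1 by near: eta.
have eta0 : 0 < eta by near: eta; exact: nbhs_right_gt.
have etar : eta < r by near: eta; exact: nbhs_right_lt.
have T3 : `|J eta + sphere_area R n * E eta * phi 0| <= e / (2 * (`|E0| + 1)) * E eta.
  by apply: asym; rewrite eta0.
have T4 : e / (2 * (`|E0| + 1)) * E eta <= e / 2.
  rewrite invfM mulrA -mulrA ger_pMr// ler_pdivrMl ?mulr1 ?ltr_wpDl//.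
  apply: le_trans (ler_norm _) _; rewrite -{1}(subKr E0 (E eta)).
  by rewrite (le_trans (ler_normB _ _))// lerD2l ltW.
have -> : - (sphere_area R n * E0 * phi 0) - J eta =
  - (sphere_area R n * E0 * phi 0 - sphere_area R n * E eta * phi 0) -
  (J eta + sphere_area R n * E eta * phi 0) by ring.
apply: le_lt_trans (ler_normB _ _) _; rewrite normrN [ltRHS]splitr.
exact: ltr_leD T1 (le_trans T3 T4).
Unshelve. all: by end_near. Qed.

End asymptotics.

Theorem theorem2 (R : realType) (n : nat) (hn : (3 <= n)%N)
    (p : R) (hp : 1 < p)
    (U : set 'rV[R]_n) (openU : open U) (U0 : U 0)
    (r0 : R) (hr0 : 0 < r0 <= 1) (Ur0 : closure (eball r0) `<=` U)
    (a : 'rV[R]_n -> 'M[R]_n) (b : 'rV[R]_n -> 'rV[R]_n)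
    (ma : forall i j, rV_measurable_fun U (fun x => a x i j))
    (mb : forall k, rV_measurable_fun U (fun x => b x 0 k))
    (a_sym : forall x, U x -> (a x)^T = a x)
    (a_pos : forall x, U x ->
       forall y : 'rV[R]_n, y != 0 -> 0 < dot (y *m a x) y)
    (omega : R -> R) (homega : modulus omega)
    (ha : forall r, 0 < r < r0 -> forall i j x, enorm x = r ->
       `|a x i j - (i == j)%:R| <= omega r)
    (c : R)
    (hb : forall r, 0 < r < r0 -> forall k x, enorm x = r ->
       enorm x * `|b x 0 k| <= c * omega r) :
  exists2 eps0 : R, 0 < eps0 <= r0 &
    forall eps : R, 0 < eps < eps0 ->
    forall (Z : 'rV[R]_n -> R) (DZ : 'rV[R]_n -> 'rV[R]_n)
      (D2Z : 'rV[R]_n -> 'M[R]_n),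
    singular_solution a b p omega eps Z DZ D2Z ->
    (forall I0 : R, I_fun a b eps r @[r --> 0^'+] --> I0 ->
       minus_L_eq_delta a b eps DZ D2Z (sphere_area R n * expR I0)) /\
    (I_fun a b eps r @[r --> 0^'+] --> -oo ->
       minus_L_eq_delta a b eps DZ D2Z 0).
Proof.
have n_gt0 : (0 < n)%N by exact: leq_trans hn.
have lip0 : 0 <= lip_const R n by rewrite /lip_const addr_ge0// mulr_ge0// exprn_ge0.
have q0 : 0 < 2 ^+ n - 1 :> R by rewrite subr_gt0 exprn_egt1 ?ltr1n// -lt0n.
pose A : R := lip_const R n * (2 ^+ n - 1); have A0 : 0 <= A by rewrite mulr_ge0// ltW.
(* Then [W * A <= 1 / 6], and [expR_le1D2x] gives an exponential of at most 1 + 2 / 6 = 4 / 3, as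
   [radial_integral_bound] requires. *)
pose W := (6 * (A + 1))^-1.
have W0 : 0 < W by rewrite invr_gt0 mulr_gt0// ltr_wpDl.
have W_small : expR (W * lip_const R n * (2 ^+ n - 1)) <= 4 / 3.
  rewrite -mulrA -/A; have WA : W * A <= 6^-1.
    rewrite /W invfM -mulrA ger_pMr ?invr_gt0// ler_pdivrMl ?ltr_wpDl//.
    by rewrite mulr1 lerDl.
  have WA0 : 0 <= W * A by rewrite mulr_ge0// ltW.
  by apply: le_trans (expR_le1D2x WA0 _) _; lra.
have c10 : 0 < `|c| + 1 by rewrite ltr_wpDl.
(* With [omega] below this value, both [omega] and [c * omega] are at most [W], whatever the sign of
   [c]. *)
have e0 : 0 < W / (`|c| + 1) by rewrite divr_gt0.
have [d /andP[d0 d1] small] := modulus_small homega e0.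
have /andP[r00 r01] := hr0.
exists (Num.min d r0); first by rewrite lt_min d0 r00 ge_min lexx orbT.
move=> eps /andP[eps0]; rewrite lt_min => /andP[epsd epsr] Z DZ D2Z solZ.
set O := @punctured_ball R n eps.
have mO : measurable (O : set (rVT R n)) := @measurable_punctured_ball R n eps.
have OU : O `<=` U.
  move=> x /andP[x0 xe]; apply: Ur0; apply: subset_closure.
  exact: lt_trans xe epsr.
have mU : measurable (U : set (rVT R n)) := caratheodory_borel (open_measurable_rV openU).
have ma' i j : rV_measurable_fun O (fun x => a x i j) := measurable_funS mU OU (ma i j).
have mb' k : rV_measurable_fun O (fun x => b x 0 k) := measurable_funS mU OU (mb k).
have om x : O x -> 0 < omega (enorm x) <= W / (`|c| + 1) /\ 0 < enorm x < r0.
  move=> /andP[x0 xe]; have xd := lt_trans xe epsd.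
  have [-> _] := small (enorm x) (introT andP (conj x0 xd)).
  rewrite x0 (lt_trans xe epsr) andbT; split => //.
  by case: homega => + _ _ _; apply; rewrite x0 (lt_trans xd).
have W_le : W / (`|c| + 1) <= W by rewrite ler_pdivrMr// ler_peMr ?(ltW W0)// lerDr.
have ha' x : O x -> forall i j, `|a x i j - (i == j)%:R| <= W.
  move=> /om[/andP[_ ow] xr] i j.
  exact: le_trans (ha _ xr i j x erefl) (le_trans ow W_le).
have hb' x : O x -> forall k, enorm x * `|b x 0 k| <= W.
  move=> /om[/andP[w0 ow] xr] k; apply: le_trans (hb _ xr k x erefl) _.
  apply: (@le_trans _ _ ((`|c| + 1) * (W / (`|c| + 1)))).
    apply: le_trans (ler_wpM2r (ltW w0) (ler_norm c)) _.
    by apply: (ler_pM (normr_ge0 _) (ltW w0) _ ow); rewrite lerDl.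
  by rewrite mulrCA mulfV ?mulr1// lt0r_neq0.
(* Both claims are the single statement that C_0 is |S^(n-1)| times the limit of e^I, the limit
   being 0 when I -> -oo. *)
have key E0 : expR (I_fun a b eps eta) @[eta --> 0^'+] --> E0 ->
    minus_L_eq_delta a b eps DZ D2Z (sphere_area R n * E0).
  move=> cE phi C1phi; split; last first.
    exact: (pairing_limit hn (ltW hp) eps0 (ltW W0) W_small homega ma' mb' ha' hb' solZ C1phi cE).
  move=> eta /andP[eta0 _].
  exact: (pairing_integrable (ltW hp) ma' mb' ha' hb' solZ.1 C1phi eta0).
split=> [I0 cI|cI]; last first.
  rewrite -(mulr0 (sphere_area R n)); apply: key. exact: (expR_cvgNy _ cI).
by apply: key; apply: (cvg_comp _ _ cI); exact: continuous_expR.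
Qed.
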